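(* The mean-centered cuboidal (m.c.c.) lattice $M_3$, that is, the lattice in $\mathbb{R}^3$ (unique up to isometry) with Gram matrix $$\frac{1}{2}\begin{pmatrix} 1+\sqrt{2} & -1 & -1\\ -1 & 1+\sqrt{2} & 1-\sqrt{2}\\ -1 & 1-\sqrt{2} & 1+\sqrt{2}\end{pmatrix},$$ is the optimal quantizer among all isodual three-dimensional lattices: for every isodual lattice $\Lambda\subset\mathbb{R}^3$ one has $G(M_3)\le G(\Lambda)$, where $G$ denotes the quantization error (normalized second moment of the Voronoi cell).
   Context: A three-dimensional lattice is a full-rank lattice $\Lambda\subset\mathbb{R}^3$, i.e. the $\mathbb{Z}$-span of a basis $v_1,v_2,v_3$ of $\mathbb{R}^3$; its Gram matrix with respect to this basis is $(v_i\cdot v_j)_{i,j}$. Its dual is $\Lambda^*=\{x\in\mathbb{R}^3 : x\cdot y\in\mathbb{Z}\text{ for all }y\in\Lambda\}$. The lattice $\Lambda$ is called isodual if it is geometrically similar to its dual, i.e. $\Lambda^*=c\,\sigma(\Lambda)$ for some real $c>0$ and some orthogonal transformation $\sigma$ of $\mathbb{R}^3$. The lattice $M_3$ is isodual and has determinant $1$. The Voronoi cell of an $n$-dimensional lattice $\Lambda\subset\mathbb{R}^n$ containing the origin is $V=\{x\in\mathbb{R}^n : |x|\le|x-y|\text{ for all }y\in\Lambda\}$. The quantization error, or normalized second moment, of $\Lambda$ is defined by first scaling $\Lambda$ so that $V$ has unit volume and then setting $$G(\Lambda)=\frac{1}{n}\int_V x\cdot x\,dx .$$ Equivalently, without rescaling,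 $G(\Lambda)=\frac{1}{n}\,\mathrm{vol}(V)^{-1-2/n}\int_V x\cdot x\,dx$. Here $n=3$. A lattice is the optimal quantizer in a class of lattices if its quantization error $G$ is the smallest in that class. *)

(* Defs.v *)
From HB Require Import structures.
From mathcomp Require Import all_boot all_order all_algebra.
From mathcomp Require Import all_classical all_reals all_analysis.
From mathcomp Require Import ring lra.
Set Implicit Arguments.
Unset Strict Implicit.
Unset Printing Implicit Defensive.
Import Order.TTheory GRing.Theory Num.Theory.
Local Open Scope classical_set_scope.
Local Open Scope ring_scope.

Definition dotv (R : realType) (n : nat) (x y : 'rV[R]_n) : R :=
  \sum_i x 0 i * y 0 i.

(* The library norm `|x| on 'rV[R]_n is the sup norm. *)
Definition enorm (R : realType) (n : nat) (x : 'rV[R]_n) : R :=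
  Num.sqrt (dotv x x).

(* A basis is given by the rows of an invertible matrix. *)
Definition zspan (R : realType) (n : nat) (B : 'M[R]_n) : set 'rV[R]_n :=
  [set x | exists z : 'I_n -> int, x = \sum_i row i B *~ z i].

Definition is_lattice (R : realType) (n : nat) (L : set 'rV[R]_n) : Prop :=
  exists B : 'M[R]_n, B \in unitmx /\ L = zspan B.

Definition gram (R : realType) (n : nat) (B : 'M[R]_n) : 'M[R]_n :=
  \matrix_(i, j) dotv (row i B) (row j B).

Definition dual (R : realType) (n : nat) (L : set 'rV[R]_n) : set 'rV[R]_n :=
  [set x | forall y, L y -> dotv x y \is a Num.int].

(* Row vectors: the orthogonal transformation attached to S is x |-> x *m S. *)
Definition isodual_lattice (R : realType) (n : nat) (L : set 'rV[R]_n) : Prop :=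
  is_lattice L /\
  exists (c : R) (S : 'M[R]_n),
    [/\ 0 < c, S *m S^T = 1%:M & dual L = [set c *: (x *m S) | x in L]].

Definition voronoi (R : realType) (n : nat) (L : set 'rV[R]_n) : set 'rV[R]_n :=
  [set x | forall y, L y -> enorm x <= enorm (x - y)].

(* The library has no Lebesgue measure on 'rV[R]_3: we use the product measure
   on R * R * R and identify triples with row vectors through vec3. *)
Definition vec3 (R : realType) (p : R * R * R) : 'rV[R]_3 :=
  \row_i [:: p.1.1; p.1.2; p.2]`_i.

Definition leb3 (R : realType) : {measure set
    (measurableTypeR R * measurableTypeR R * measurableTypeR R) -> \bar R} :=
  ((@lebesgue_measure R \x @lebesgue_measure R) \x @lebesgue_measure R)%E.

Definition volume3 (R : realType) (A : set 'rV[R]_3) : R :=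
  fine (leb3 R (@vec3 R @^-1` A)).

Definition second_moment3 (R : realType) (A : set 'rV[R]_3) : R :=
  (\int[leb3 R]_(p in @vec3 R @^-1` A) dotv (vec3 p) (vec3 p))%R.

(* The normalized second moment (1/n) vol(V)^(-1-2/n) \int_V x.x dx for n = 3;
   for a lattice L the cell V is a convex body, so that the volume is positive
   and both quantities are finite. *)
Definition quantization_error (R : realType) (L : set 'rV[R]_3) : R :=
  3%:R^-1 * volume3 (voronoi L) `^ (- 1 - 2 / 3) *
  second_moment3 (voronoi L).

Definition optimal_quantizer_in (R : realType) (C : set 'rV[R]_3 -> Prop)
    (L : set 'rV[R]_3) : Prop :=
  C L /\ forall L', C L' -> quantization_error L <= quantization_error L'.

Definition mcc_gram (R : realType) : 'M[R]_3 :=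
  let s := Num.sqrt 2 in
  2^-1 *: \matrix_(i, j)
    nth 0 (nth [::] [:: [:: 1 + s;    - 1;    - 1];
                        [::   - 1;  1 + s;  1 - s];
                        [::   - 1;  1 - s;  1 + s]] i) j.

(* The mean-centered cuboidal lattice, which is determined up to isometry. *)
Definition is_mcc (R : realType) (L : set 'rV[R]_3) : Prop :=
  exists B : 'M[R]_3, [/\ B \in unitmx, gram B = mcc_gram R & L = zspan B].

Lemma is_mcc_exists (R : realType) : exists L : set 'rV[R]_3, is_mcc L.
Proof.
pose s : R := Num.sqrt 2.
have s2 : s ^+ 2 = 2 by rewrite sqr_sqrtr.
have s0 : 0 < s by rewrite sqrtr_gt0.
pose p : R := Num.sqrt ((1 + s) / 2).
pose u : R := Num.sqrt (s / (2 * (1 + s))).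
pose w : R := Num.sqrt (s / 2).
have p0 : 0 < p by rewrite sqrtr_gt0; lra.
have u0 : 0 < u by rewrite sqrtr_gt0 divr_gt0 //; lra.
have w0 : 0 < w by rewrite sqrtr_gt0; lra.
have p2 : p ^+ 2 = (1 + s) / 2 by rewrite sqr_sqrtr //; lra.
have u2 : u ^+ 2 = s / (2 * (1 + s)).
  by rewrite sqr_sqrtr // ltW // divr_gt0 //; lra.
have w2 : w ^+ 2 = s / 2 by rewrite sqr_sqrtr //; lra.
pose q : R := - (2 * p)^-1.
have pq : p * q = - 2^-1 by rewrite /q; field; lra.
have q2 : q ^+ 2 = (2 * (1 + s))^-1.
  rewrite /q sqrrN exprVn exprMn p2; congr (_^-1); lra.
have qu : q ^+ 2 + u ^+ 2 = 2^-1 by rewrite q2 u2; field; lra.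
pose B : 'M[R]_3 := \matrix_(i, j)
  nth 0 (nth [::] [:: [:: p; 0; 0]; [:: q; u; w]; [:: q; u; - w]] i) j.
pose C : 'M[R]_3 := \matrix_(i, j)
  nth 0 (nth [::] [:: [:: p^-1; 0; 0];
                      [:: - q / (p * u); (2 * u)^-1; (2 * u)^-1];
                      [:: 0; (2 * w)^-1; - (2 * w)^-1]] i) j.
exists (zspan B), B; split => //.
  suff /mulmx1_unit[] : B *m C = 1%:M by [].
  apply/matrixP => i j; rewrite !mxE !big_ord_recl big_ord0 !mxE.
  case: i => [[|[|[|//]]] ?]; case: j => [[|[|[|//]]] ?] /=; field; lra.
apply/matrixP => i j; rewrite !mxE /dotv !big_ord_recl big_ord0 !mxE -/s.
case: i => [[|[|[|//]]] ?]; case: j => [[|[|[|//]]] ?] /=; nra.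
Qed.

(* Main.v *)
Require Import Defs.
From HB Require Import structures.
From mathcomp Require Import all_boot all_order all_algebra all_fingroup.
From mathcomp Require Import all_classical all_reals all_analysis.
From mathcomp Require Import measurable_realfun zify ring lra.
Set Implicit Arguments.
Unset Strict Implicit.
Unset Printing Implicit Defensive.
Import Order.TTheory GRing.Theory Num.Theory.
Import numFieldNormedType.Exports.
Local Open Scope classical_set_scope.
Local Open Scope ring_scope.

(* A unimodular isodual Gram matrix G satisfies U G^-1 U^T = G for some integral
   U of determinant 1, so that S = U G^-1 is a rotation of the form G.
   - If U is symmetric, S is the identity and G is integral, or S is a half-turn
     and G + U = 2 w^T w, U being an integral Lorentz form.  Both kinds of
     integral forms are diagonalizable over the integers; then either G splits
     off a unit vector, or reducing w by the integral orthogonal group of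
     x^2 - y^2 - z^2 gives an explicit obtuse superbase.
   - If U is not symmetric, the axis of its skew part is fixed by S; in a basis
     adapted to the axis, integrality leaves rotation angles for which G again
     belongs to the cases above or is the form of M_3 itself.
   In every case G has an obtuse superbase.  In terms of its six Selling
   parameters the Voronoi cell is a zonotope, which is cut into 16
   parallelepipeds, one for each spanning tree of K_4; this gives the second
   moment as a polynomial in the parameters, and the theorem becomes an
   inequality between polynomials. *)

(** * Linear changes of variables for the product measure *)

(** The 16 parallelepipeds are shown only to be pairwise disjoint, being optimality regions of one
    linear program with unique optima, and to lie in the cell. That they exhaust it follows from
    volumes: theirs add up to det G by the matrix-tree theorem, and the cell cannot have more
    because its lattice translates pack. The rest is a null set. Nor is a general reduction to
    obtuse superbases needed. They are exhibited only for the three kinds of forms that isoduality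
    leaves: a unit vector plus a binary form, a two-parameter family coming from half-turns, and M_3
    itself. Hermite's bound 4/3 leads there: it makes the corner entry of an integral G equal to 1,
    and that of the Lorentz form equal to -1, 0 or 1. If U is not symmetric, with axis of norm [al]
    and skew entry d, determinants give 4 k^2 + al d^2 = 4 for the cosine k, which leaves finitely
    many pairs (al, d). The bound is attained by M_3, which also occurs in the half-turn family; so
    the square root of 2 must be treated exactly there, while the prisms leave room for rational
    estimates. *)

Section LinearChangeOfVariables.
Variable R : realType.
Local Notation mR := (measurableTypeR R).
Local Notation mu := (@lebesgue_measure R).
Local Notation T3 := (mR * mR * mR)%type.

Let affine (a k : R) : mR -> mR := fun z => a * z + k.

Let measurable_affine a k : measurable_fun setT (affine a k).
Proof.
apply: measurable_funD; last exact: measurable_cst.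
exact: mulrl_measurable.
Qed.

Let affine_image a k :=
  measure_function_pushforward__canonical__measure_function_Measure
    (lebesgue_measure_lebesgue_measure__canonical__measure_function_Measure R)
    (measurable_affine a k).

(** By uniqueness of Lebesgue measure: the pushforward times [|a|] gives each half-open interval its
    length. For negative a the preimage is open on the other side, hence the two cases. *)
Lemma lebesgue_measure_affine (a k : R) (A : set mR) : a != 0 -> measurable A ->
  mu (affine a k @^-1` A) = (`|a|^-1%:E * mu A)%E.
Proof.
move=> a0 mA; have na0 : 0 < `|a| by rewrite normr_gt0.
have ng : 0 <= `|a| by [].
suff -> : mu A = mscale (NngNum ng) (affine_image a k) A.
  by rewrite /mscale/= /pushforward/= muleA -EFinM mulVf ?mul1e// gt_eqF.
apply: (@lebesgue_measure_unique _ (mscale (NngNum ng) (affine_image a k))) => // _ [[x y]] _ <-.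
rewrite [RHS](_ : _ = `|a|%:E * mu (affine a k @^-1` `]x, y]))%E//.
rewrite lebesgue_measure_itv/= lte_fin.
have [aP|aN] : (0 < a) \/ (a < 0) by case: (ltgtP a 0) a0 => //; auto.
- have -> : affine a k @^-1` `]x, y] = `](x - k) / a, (y - k) / a]%classic.
    apply/seteqP; split => z /=; rewrite /affine !in_itv/= ltr_pdivrMr// ler_pdivlMr// ltrBlDr lerBrDr;
      by rewrite (mulrC z).
  rewrite lebesgue_measure_itv/= lte_fin ltr_pM2r ?invr_gt0// ltrD2r.
  case: ifPn => _; last by rewrite mule0.
  rewrite gtr0_norm// -!EFinD -EFinM; congr (_%:E); by field.
- have -> : affine a k @^-1` `]x, y] = `[(y - k) / a, (x - k) / a[%classic.
    apply/seteqP; split => z /=; rewrite /affine !in_itv/= ltr_ndivlMr// ler_ndivrMr// ltrBlDr lerBrDr;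
      by rewrite (mulrC z) andbC.
  rewrite lebesgue_measure_itv/= lte_fin ltr_nM2r ?invr_lt0// ltrD2r.
  case: ifPn => _; last by rewrite mule0.
  rewrite ltr0_norm// -!EFinD -EFinM; congr (_%:E); by field.
Qed.

Lemma integral_affine (a k : R) (f : mR -> \bar R) : a != 0 ->
  measurable_fun setT f -> (forall x, 0 <= f x)%E ->
  (\int[mu]_x f (a * x + k)%R = `|a|^-1%:E * \int[mu]_x f x)%E.
Proof.
move=> a0 mf f0.
have := @ge0_integral_pushforward _ _ _ _ R _ (measurable_affine a k) mu setT f.
move=> /(_ measurableT mf (fun y _ => f0 y)); rewrite preimage_setT => <-.
have ng : 0 <= `|a|^-1 by [].
rewrite -(ge0_integral_mscale mu measurableT (NngNum ng))//.
apply: eq_measure_integral => A mA _.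
by rewrite /mscale/= /pushforward lebesgue_measure_affine.
Qed.

(* The library registers the product of two sigma-finite measures as
   sigma-finite, but the canonical instance is shadowed by the one for
   subprobabilities, hence the explicit packing. *)
Let mu2 : {sigma_finite_measure set (mR * mR)%type -> \bar R} :=
  HB.pack (product_measure1 mu mu)
   (lebesgue_integral_fubini.measure_function_Measure_isSigmaFinite__to__measure_function_isSFinite mu mu)
   (lebesgue_integral_fubini.measure_function_Measure_isSigmaFinite__to__measure_function_isSigmaFinite mu mu).

Lemma integral_leb3 (f : T3 -> \bar R) : measurable_fun setT f ->
  (forall p, 0 <= f p)%E ->
  (\int[leb3 R]_p f p = \int[mu]_x \int[mu]_y \int[mu]_z f (x, y, z))%E.
Proof.
move=> mf f0.
have h := @fubini_tonelli1 _ _ _ _ R mu2 mu f mf f0.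
have mF := @measurable_fun_fubini_tonelli_F _ _ _ _ R mu f mf f0.
have h' := @fubini_tonelli1 _ _ _ _ R mu mu _ mF.
apply: (eq_trans h); apply: h' => p.
exact: integral_ge0.
Qed.

Lemma measurable_slice1 (f : T3 -> \bar R) (x y : R) : measurable_fun setT f ->
  measurable_fun setT (fun z : mR => f (x, y, z)).
Proof. by move=> mf; apply: measurableT_comp mf _; exact: measurable_pair1. Qed.

Lemma measurable_slice2 (f : T3 -> \bar R) (x : R) : measurable_fun setT f ->
  (forall p, 0 <= f p)%E ->
  measurable_fun setT (fun y : mR => \int[mu]_z f (x, y, z))%E.
Proof.
move=> mf f0.
apply: (measurableT_comp (measurable_fun_fubini_tonelli_F f mf f0)).
exact: measurable_pair1.
Qed.

Lemma measurable_slice3 (f : T3 -> \bar R) : measurable_fun setT f ->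
  (forall p, 0 <= f p)%E ->
  measurable_fun setT (fun x : mR => \int[mu]_y \int[mu]_z f (x, y, z))%E.
Proof.
move=> mf f0.
apply: (measurable_fun_fubini_tonelli_F (fun p => \int[mu]_z f (p, z))%E).
- exact: measurable_fun_fubini_tonelli_F.
- by move=> p; apply: integral_ge0.
Qed.

(** The variables are substituted one at a time from the innermost integral outwards; at each stage
    the terms in the outer variables are a constant shift. *)
Lemma integral_leb3_triangular (a b c k1 k2 k3 l1 l2 l3 : R)
    (f : T3 -> \bar R) :
  a != 0 -> b != 0 -> c != 0 -> measurable_fun setT f ->
  (forall p, 0 <= f p)%E ->
  (\int[leb3 R]_p f ((a * p.1.1 + k1)%R, (b * p.1.2 + (l1 * p.1.1 + k2))%R,
     (c * p.2 + (l2 * p.1.1 + l3 * p.1.2 + k3))%R) =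
   (`|a| * `|b| * `|c|)^-1%:E * \int[leb3 R]_p f p)%E.
Proof.
move=> a0 b0 c0 mf f0.
have mx : measurable_fun setT (fun p : T3 => p.1.1).
  exact: (measurableT_comp (@measurable_fst _ _ _ _) (@measurable_fst _ _ _ _)).
have my : measurable_fun setT (fun p : T3 => p.1.2).
  exact: (measurableT_comp (@measurable_snd _ _ _ _) (@measurable_fst _ _ _ _)).
have mz : measurable_fun setT (fun p : T3 => p.2) by exact: measurable_snd.
have mul (k : R) (g : T3 -> mR) : measurable_fun setT g ->
    measurable_fun setT (fun p => k * g p : mR).
  by move=> mg; apply: (measurableT_comp (mulrl_measurable k) mg).
have add (g h : T3 -> mR) : measurable_fun setT g -> measurable_fun setT h ->
    measurable_fun setT (fun p => g p + h p : mR).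
  exact: measurable_funD.
have cst (k : R) : measurable_fun setT (fun _ : T3 => k : mR).
  exact: measurable_cst.
rewrite integral_leb3//; last first.
  apply: (measurableT_comp mf); apply: measurable_fun_pair => /=; [apply: measurable_fun_pair => /=|].
  - by apply: (add); [exact: mul|].
  - by apply: (add); [exact: mul|apply: (add); [exact: mul|]].
  - apply: (add); [exact: mul|apply: (add); [|exact: cst]].
    by apply: (add); exact: mul.
have stepz x y : (\int[mu]_z f ((a * x + k1)%R, (b * y + (l1 * x + k2))%R,
    (c * z + (l2 * x + l3 * y + k3))%R) =
    `|c|^-1%:E * \int[mu]_z f ((a * x + k1)%R, (b * y + (l1 * x + k2))%R, z))%E.
  apply: (@integral_affine c _ (fun z => f (_, _, z))) => //.
  exact: measurable_slice1.
have stepy x : (\int[mu]_y \int[mu]_z f ((a * x + k1)%R,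
    (b * y + (l1 * x + k2))%R, (c * z + (l2 * x + l3 * y + k3))%R) =
    (`|b|^-1 * `|c|^-1)%:E * \int[mu]_y \int[mu]_z f ((a * x + k1)%R, y, z))%E.
  under eq_integral do rewrite stepz.
  rewrite ge0_integralZl//; last first.
  - by move=> y _; exact: integral_ge0.
  - have mg : measurable_fun setT (fun y : mR => b * y + (l1 * x + k2) : mR).
      apply: measurable_funD; last exact: measurable_cst.
      exact: mulrl_measurable.
    exact: (measurableT_comp (measurable_slice2 (a * x + k1) mf f0) mg).
  rewrite (@integral_affine b (l1 * x + k2)
    (fun y => \int[mu]_z f ((a * x + k1)%R, y, z))%E)//; last 2 first.
  - exact: measurable_slice2.
  - by move=> y; exact: integral_ge0.
  by rewrite muleA -EFinM [(`|c|^-1 * _)%R]mulrC.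
have stepx : (\int[mu]_x \int[mu]_y \int[mu]_z f ((a * x + k1)%R, y, z) =
    `|a|^-1%:E * \int[mu]_x \int[mu]_y \int[mu]_z f (x, y, z))%E.
  rewrite (@integral_affine a k1 (fun x => \int[mu]_y \int[mu]_z f (x, y, z))%E)//.
    exact: measurable_slice3.
  by move=> x; apply: integral_ge0 => y _; exact: integral_ge0.
under eq_integral do rewrite stepy.
have mg : measurable_fun setT (fun y : mR => a * y + k1 : mR).
  apply: measurable_funD; last exact: measurable_cst.
  exact: mulrl_measurable.
have mF := measurableT_comp (measurable_slice3 mf f0) mg.
rewrite (ge0_integralZl mu measurableT mF); last first.
- by rewrite lee_fin mulr_ge0.
- by move=> x _; apply: integral_ge0 => y _; exact: integral_ge0.
rewrite stepx -integral_leb3// muleA -EFinM; congr (_%:E * _)%E.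
by rewrite !invfM mulrC mulrA.
Qed.

End LinearChangeOfVariables.

(** * Change of variables for invertible linear maps of space *)

Section LinearMaps.
Variable R : realType.
Local Notation mR := (measurableTypeR R).
Local Notation mu := (@lebesgue_measure R).
Local Notation T3 := (mR * mR * mR)%type.

Definition unvec3 (x : 'rV[R]_3) : T3 := (x 0 0, x 0 1, x 0 2%:R).

Lemma vec3K : cancel (@vec3 R) unvec3.
Proof. by move=> [[x y] z]; rewrite /unvec3 !mxE. Qed.

Lemma unvec3K : cancel unvec3 (@vec3 R).
Proof.
move=> x; apply/rowP => i; rewrite mxE.
by case: i => [[|[|[|//]]] ?] /=; congr (x _ _); exact/val_inj.
Qed.

Lemma measurable_coord (i : 'I_3) : measurable_fun setT (fun p : T3 => vec3 p 0 i : mR).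
Proof.
under eq_fun do rewrite mxE.
case: i => [[|[|[|//]]] ?] /=.
- exact: (measurableT_comp (@measurable_fst _ _ _ _) (@measurable_fst _ _ _ _)).
- exact: (measurableT_comp (@measurable_snd _ _ _ _) (@measurable_fst _ _ _ _)).
- exact: measurable_snd.
Qed.

Definition act3 (M : 'M[R]_3) (v : 'rV[R]_3) (p : T3) : T3 :=
  unvec3 (vec3 p *m M + v).

Lemma measurable_act3 M v : measurable_fun setT (act3 M v).
Proof.
have mc j : measurable_fun setT (fun p : T3 => (vec3 p *m M + v) 0 j : mR).
  under eq_fun do rewrite mxE.
  apply: measurable_funD; last exact: measurable_cst.
  under eq_fun do rewrite mxE.
  apply: measurable_sum => i.
  exact: (measurableT_comp (mulrr_measurable (M i j)) (measurable_coord i)).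
apply: measurable_fun_pair => /=; last exact: mc.
by apply: measurable_fun_pair => /=; exact: mc.
Qed.

(** This property is stable under products, so it suffices to establish it for the factors of an LUP
    decomposition. *)
Definition scales_leb3 (M : 'M[R]_3) : Prop := M \in unitmx /\
  forall f : T3 -> \bar R, measurable_fun setT f -> (forall p, 0 <= f p)%E ->
    (\int[leb3 R]_p f (act3 M 0 p) = `|\det M|^-1%:E * \int[leb3 R]_p f p)%E.

Lemma act3_mul M N p : act3 (M *m N) 0 p = act3 N 0 (act3 M 0 p).
Proof. by rewrite /act3 unvec3K !addr0 mulmxA. Qed.

Lemma scales_leb3M M N : scales_leb3 M -> scales_leb3 N -> scales_leb3 (M *m N).
Proof.
move=> [uM hM] [uN hN]; split; first by rewrite unitmx_mul uM.
move=> f mf f0; under eq_integral do rewrite act3_mul.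
rewrite (hM (fun p => f (act3 N 0 p)))//; last first.
  exact: (measurableT_comp mf (measurable_act3 N 0)).
by rewrite hN// muleA -EFinM det_mulmx normrM invfM mulrC.
Qed.

Lemma scales_leb3_upper M : M \in unitmx ->
  (forall i j : 'I_3, (j < i)%N -> M i j = 0) -> scales_leb3 M.
Proof.
move=> uM tM; split=> // f mf f0.
have dM : \det M = M 0 0 * M 1 1 * M 2%:R 2%:R.
  rewrite -det_tr det_trig.
    by rewrite !big_ord_recl big_ord0 mulr1 mulrA !mxE; congr (_ * _ * _);
      congr (M _ _); exact/val_inj.
  by apply/is_trig_mxP => i j ij; rewrite mxE tM.
have : \det M != 0 by rewrite -unitfE -unitmxE.
rewrite dM !mulf_eq0 !negb_or -andbA => /and3P[a0 b0 c0].
rewrite !normrM.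
rewrite -(integral_leb3_triangular 0 0 0 (M 0 1) (M 0 2%:R) (M 1 2%:R) a0 b0 c0 mf f0).
apply: eq_integral => -[[x y] z] _; congr (f _).
rewrite /act3 /unvec3 addr0 !mxE !big_ord_recl !big_ord0 !mxE/=.
have e1 : lift ord0 ord0 = 1 :> 'I_3 by exact/val_inj.
have e2 : lift ord0 (lift ord0 ord0) = 2%:R :> 'I_3 by exact/val_inj.
have e0 : ord0 = 0 :> 'I_3 by exact/val_inj.
rewrite e1 e2 e0 (tM 1 0)// (tM 2%:R 0)// (tM 2%:R 1)//.
by congr (_, _, _); ring.
Qed.

Lemma integral_leb3_swap12 (f : T3 -> \bar R) : measurable_fun setT f ->
  (forall p, 0 <= f p)%E ->
  (\int[leb3 R]_p f (p.1.2, p.1.1, p.2) = \int[leb3 R]_p f p)%E.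
Proof.
move=> mf f0.
have mg : measurable_fun setT (fun p : T3 => (p.1.2, p.1.1, p.2) : T3).
  apply: measurable_fun_pair => /=; [apply: measurable_fun_pair => /=|].
  - exact: (measurableT_comp (@measurable_snd _ _ _ _) (@measurable_fst _ _ _ _)).
  - exact: (measurableT_comp (@measurable_fst _ _ _ _) (@measurable_fst _ _ _ _)).
  - exact: measurable_snd.
have e1 := integral_leb3 mf f0.
have e2 := integral_leb3 (measurableT_comp mf mg) (fun p => f0 _).
apply: (eq_trans e2); apply: (eq_trans _ (esym e1)); rewrite {e1 e2}/=.
have mF := @measurable_fun_fubini_tonelli_F _ _ _ _ R mu f mf f0.
have mF' := measurableT_comp mF (@measurable_swap _ _ mR mR).
apply: (@fubini_tonelli _ _ _ _ R mu mu _ mF') => q.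
exact: integral_ge0.
Qed.

Lemma integral_leb3_swap23 (f : T3 -> \bar R) : measurable_fun setT f ->
  (forall p, 0 <= f p)%E ->
  (\int[leb3 R]_p f (p.1.1, p.2, p.1.2) = \int[leb3 R]_p f p)%E.
Proof.
move=> mf f0.
have mg : measurable_fun setT (fun p : T3 => (p.1.1, p.2, p.1.2) : T3).
  apply: measurable_fun_pair => /=; [apply: measurable_fun_pair => /=|].
  - exact: (measurableT_comp (@measurable_fst _ _ _ _) (@measurable_fst _ _ _ _)).
  - exact: measurable_snd.
  - exact: (measurableT_comp (@measurable_snd _ _ _ _) (@measurable_fst _ _ _ _)).
have e1 := integral_leb3 mf f0.
have e2 := integral_leb3 (measurableT_comp mf mg) (fun p => f0 _).
apply: (eq_trans e2); apply: (eq_trans _ (esym e1)); rewrite {e1 e2}/=.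
apply: eq_integral => x _.
have mh : measurable_fun setT (fun q : mR * mR => (x, q.2, q.1) : T3).
  apply: measurable_fun_pair => //=; apply: measurable_fun_pair => //=.
exact: (@fubini_tonelli _ _ _ _ R mu mu _ (measurableT_comp mf mh) (fun=> f0 _)).
Qed.

Let i2 : 'I_3 := 2%:R.

Lemma act3_perm (s : 'S_3) p :
  act3 (perm_mx s) 0 p = (vec3 p 0 (s^-1%g 0), vec3 p 0 (s^-1%g 1), vec3 p 0 (s^-1%g i2)).
Proof.
rewrite /act3 addr0 -[in perm_mx _](invgK s) -col_permE /unvec3.
by congr (_, _, _); rewrite mxE.
Qed.

Let scales_leb3_perm_of (s : 'S_3) :
  (forall f : T3 -> \bar R, measurable_fun setT f -> (forall p, 0 <= f p)%E ->
    (\int[leb3 R]_p f ((vec3 p 0 (s^-1%g 0))%R, (vec3 p 0 (s^-1%g 1))%R,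
       (vec3 p 0 (s^-1%g i2))%R) = \int[leb3 R]_p f p)%E) ->
  scales_leb3 (perm_mx s).
Proof.
move=> h; split; first exact: unitmx_perm.
move=> f mf f0; under eq_integral do rewrite act3_perm.
rewrite det_perm normrX normrN1 expr1n invr1 mul1e; exact: h.
Qed.

Let scales_leb3_tperm01 : scales_leb3 (tperm_mx 0 1).
Proof.
apply: scales_leb3_perm_of => f mf f0; rewrite -(integral_leb3_swap12 mf f0).
apply: eq_integral => -[[x y] z] _; rewrite tpermV tpermL tpermR tpermD//.
by rewrite !mxE.
Qed.

Let scales_leb3_tperm12 : scales_leb3 (tperm_mx 1 i2).
Proof.
apply: scales_leb3_perm_of => f mf f0; rewrite -(integral_leb3_swap23 mf f0).
apply: eq_integral => -[[x y] z] _; rewrite tpermV tpermL tpermR tpermD//.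
by rewrite !mxE.
Qed.

Let scales_leb3_tperm02 : scales_leb3 (tperm_mx 0 i2).
Proof.
rewrite /tperm_mx; have -> : tperm 0 i2 = (tperm 0%R 1%R * tperm 1%R i2 * tperm 0%R 1%R)%g.
  by rewrite -{1}(tpermV 0 1) -mulgA -/(conjg _ _) tpermJ tpermR tpermD.
by rewrite !perm_mxM; do 2 apply: scales_leb3M => //.
Qed.

Lemma scales_leb3_perm (s : 'S_3) : scales_leb3 (perm_mx s).
Proof.
have [ts -> dts] := prod_tpermP s.
elim: ts dts => [|[i j] ts IH] /=.
  move=> _; rewrite big_nil; apply: scales_leb3_perm_of => f mf f0.
  by apply: eq_integral => -[[x y] z] _; rewrite invg1 !perm1 !mxE.
move=> /andP[dij /IH{}IH]; rewrite big_cons perm_mxM; apply: scales_leb3M => //=.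
have two : i2 = Ordinal (isT : 2 < 3)%N by exact/val_inj.
have one : 1 = Ordinal (isT : 1 < 3)%N by exact/val_inj.
have zero : 0 = Ordinal (isT : 0 < 3)%N by exact/val_inj.
move: dij; rewrite /dpair/=.
case: i => [[|[|[|//]]] hi]; case: j => [[|[|[|//]]] hj] //= _;
  rewrite ?(bool_irrelevance hi isT) ?(bool_irrelevance hj isT) -?two -?one -?zero //;
  rewrite tpermC; try exact: scales_leb3_tperm01; try exact: scales_leb3_tperm12; try exact: scales_leb3_tperm02.
Qed.

Lemma scales_leb3_unitmx (M : 'M[R]_3) : M \in unitmx -> scales_leb3 M.
Proof.
move=> uM.
move: (cormen_lup_correct M) (cormen_lup_detL M).
move: (cormen_lup_perm M) (@cormen_lup_lower _ _ M) (@cormen_lup_upper _ _ M).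
case: (cormen_lup M) => -[P L] U; rewrite [(P, L, U).1.1]/= [(P, L, U).1.2]/= [(P, L, U).2]/=.
move=> /is_perm_mxP[s ->] hL hU E dL.
have {}E : perm_mx s *m M = L *m U by exact: E.
have uU : U \in unitmx.
  have : perm_mx s *m M \in unitmx by rewrite unitmx_mul unitmx_perm uM.
  by rewrite E unitmx_mul => /andP[].
have -> : M = perm_mx s^-1%g *m (L *m U).
  by rewrite -E mulmxA -perm_mxM mulVg perm_mx1 mul1mx.
apply: scales_leb3M; first exact: scales_leb3_perm.
apply: scales_leb3M; last by apply: scales_leb3_upper => // i j; exact: hU.
(* Conjugation by the reversal of the indices turns the lower triangular factor into an upper
   triangular one. *)
pose w : 'S_3 := perm (@rev_ord_inj 3).
have ww : (w * w)%g = 1%g by apply/permP => i; rewrite permM !permE rev_ordK.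
have -> : L = perm_mx w *m (perm_mx w *m L *m perm_mx w) *m perm_mx w.
  by rewrite !mulmxA -perm_mxM ww perm_mx1 mul1mx -mulmxA -perm_mxM ww perm_mx1 mulmx1.
apply: scales_leb3M; last exact: scales_leb3_perm.
apply: scales_leb3M; first exact: scales_leb3_perm.
have wV : w^-1%g = w by rewrite -(mulg1 w^-1%g) -ww mulgA mulVg mul1g.
apply: scales_leb3_upper.
  by rewrite !unitmx_mul !unitmx_perm /= unitmxE dL unitr1.
move=> i j ji; rewrite -row_permE -[X in _ *m perm_mx X]wV -col_permE !mxE !permE.
rewrite hL /=; last by move: (ltn_ord i) (ltn_ord j) ji; lia.
by case: eqP => // /rev_ord_inj e; rewrite e ltnn in ji.
Qed.

Lemma integral_act3 (M : 'M[R]_3) (v : 'rV[R]_3) (f : T3 -> \bar R) :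
  M \in unitmx -> measurable_fun setT f -> (forall p, 0 <= f p)%E ->
  (\int[leb3 R]_p f (act3 M v p) = `|\det M|^-1%:E * \int[leb3 R]_p f p)%E.
Proof.
move=> uM mf f0; have [_ hM] := scales_leb3_unitmx uM.
have -> : (\int[leb3 R]_p f p = \int[leb3 R]_p f (act3 1%:M v p))%E.
  have o0 : (1 : R) != 0 by exact: oner_neq0.
  have := integral_leb3_triangular (v 0 0) (v 0 1) (v 0 i2) 0 0 0 o0 o0 o0 mf f0.
  rewrite !normr1 !mulr1 invr1 mul1e => <-; apply: eq_integral => -[[x y] z] _.
  by congr (f _); rewrite /act3 mulmx1 /unvec3 !mxE/= !mul1r !mul0r !add0r.
have mg := measurableT_comp mf (measurable_act3 1%:M v).
rewrite -(hM _ mg (fun=> f0 _)); apply: eq_integral => p _ /=.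
by rewrite /act3 unvec3K addr0 mulmx1.
Qed.

End LinearMaps.

(** * Sets with disjoint integer translates *)

Section Packing.
Variable R : realType.
Local Notation mR := (measurableTypeR R).
Local Notation mu := (@lebesgue_measure R).
Local Notation T3 := (mR * mR * mR)%type.

Lemma integral_act3_set (M : 'M[R]_3) v (D : set T3) (f : T3 -> \bar R) :
  M \in unitmx -> measurable D -> measurable_fun D f -> (forall p, 0 <= f p)%E ->
  (\int[leb3 R]_(p in act3 M v @^-1` D) f (act3 M v p) =
   `|\det M|^-1%:E * \int[leb3 R]_(p in D) f p)%E.
Proof.
move=> uM mD mf f0.
have mfD : measurable_fun setT (f \_ D) by exact/(measurable_restrictT _ mD).
have fD0 p : (0 <= (f \_ D) p)%E by rewrite patchE; case: ifP.
rewrite (integral_mkcond D) -(integral_act3 v uM mfD fD0).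
by rewrite integral_mkcond; apply: eq_integral => p _; rewrite !patchE.
Qed.

Lemma leb3_act3 (M : 'M[R]_3) v (D : set T3) : M \in unitmx -> measurable D ->
  (leb3 R (act3 M v @^-1` D) = `|\det M|^-1%:E * leb3 R D)%E.
Proof.
move=> uM mD; have mF := measurable_act3 M v.
have mD' : measurable (act3 M v @^-1` D) by rewrite -[X in measurable X]setTI; exact: mF.
have mI : measurable_fun setT (fun p => (\1_D p)%:E : \bar R) by exact/measurable_EFinP.
have I0 p : (0 <= (\1_D p)%:E :> \bar R)%E by rewrite lee_fin.
have := integral_act3 v uM mI I0; rewrite [in RHS]integral_indic// setIT => <-.
by rewrite -[X in leb3 R X]setIT -integral_indic.
Qed.

Definition floor3 (p : T3) : int * int * int :=
  (Num.floor p.1.1, Num.floor p.1.2, Num.floor p.2).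

Definition intvec3 (z : int * int * int) : 'rV[R]_3 :=
  vec3 (z.1.1%:~R, z.1.2%:~R, z.2%:~R).

Lemma act3_intvec3 z p : act3 1%:M (intvec3 z) p =
  (p.1.1 + z.1.1%:~R, p.1.2 + z.1.2%:~R, p.2 + z.2%:~R).
Proof. by rewrite /act3 mulmx1 /unvec3 !mxE. Qed.

Let cell z : set T3 := [set p | floor3 p = z].

Let cellE z : cell z =
  (`[z.1.1%:~R, z.1.1%:~R + 1[ `*` `[z.1.2%:~R, z.1.2%:~R + 1[ `*` `[z.2%:~R, z.2%:~R + 1[)%classic.
Proof.
case: z => [[a b] c]; apply/seteqP; split=> -[[x y] z]; rewrite /cell /floor3 /= !in_itv/=.
- by move=> [<- <- <-]; rewrite -!intrD1 !floor_itv.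
- by move=> [[hx hy] hz]; congr (_, _, _); apply/eqP; rewrite floor_eq intrD1.
Qed.

Let measurable_cell z : measurable (cell z).
Proof. by rewrite cellE; do 2 apply: measurableX => //. Qed.

Let leb3_cell0 : leb3 R (cell 0) = 1%E.
Proof.
rewrite cellE -[LHS]/(((mu \x mu) \x mu)%E _) product_measure1E//; last exact: measurableX.
rewrite -[X in (X * _)%E]/((mu \x mu)%E _) product_measure1E//.
pose I : set R := `[(0 : int)%:~R, (0 : int)%:~R + 1[%classic.
rewrite -[LHS]/(mu I * mu I * mu I)%E /I.
by rewrite lebesgue_measure_itv/= lte_fin add0r ltr01 -EFinB subr0 !mul1e.
Qed.

(** Cut A along the unit cubes of the integer grid and translate every piece into the cube at the
    origin: the pieces stay disjoint there, so their volumes add up to at most 1. *)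
Lemma leb3_packing_le1 (A : set T3) : measurable A ->
  (forall p z z', A (act3 1%:M (intvec3 z) p) -> A (act3 1%:M (intvec3 z') p) -> z = z') ->
  (leb3 R A <= 1)%E.
Proof.
move=> mA dA.
(* [F] lists the pieces of A and [G] their translates in the cube at the origin; numbers that encode
   no integer triple get the empty set. *)
pose F n := if pickle_inv n is Some z then A `&` cell z else set0.
pose G n := if pickle_inv n is Some z
  then act3 1%:M (intvec3 z) @^-1` (A `&` cell z) else set0.
have mF n : measurable (F n).
  by rewrite /F; case: pickle_inv => // z; exact: measurableI.
have mG n : measurable (G n).
  rewrite /G; case: pickle_inv => // z; rewrite -[X in measurable X]setTI.
  by apply: measurable_act3 => //; exact: measurableI.
have FG n : leb3 R (F n) = leb3 R (G n).
  rewrite /F /G; case: pickle_inv => [z|]; last by rewrite !measure0.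
  rewrite leb3_act3//; last exact: measurableI.
    by rewrite det1 normr1 invr1 mul1e.
  exact: unitmx1.
have inj i j (z : int * int * int) :
    pickle_inv i = Some z -> pickle_inv j = Some z -> i = j.
  have K (k : nat) : oapp pickle k (pickle_inv k : option (int * int * int)) = k.
    exact: pickle_invK.
  by move=> Ei Ej; rewrite -(K i) -(K j) Ei Ej.
have tF : trivIset setT F.
  apply/trivIsetP => i j _ _ ij; apply/seteqP; split=> // p [].
  rewrite /F; case Ei : (pickle_inv i) => [z|//]; case Ej : (pickle_inv j) => [z'|//].
  rewrite /cell => -[_ /= e1] [_ /= e2]; move: ij.
  by rewrite (inj i j z) ?eqxx// Ej -e2 e1.
have tG : trivIset setT G.
  apply/trivIsetP => i j _ _ ij; apply/seteqP; split=> // p [].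
  rewrite /G; case Ei : (pickle_inv i) => [z|//]; case Ej : (pickle_inv j) => [z'|//].
  move=> -[/= Az _] [/= Az' _]; move: ij.
  by rewrite (inj i j z) ?eqxx// Ej (dA _ _ _ Az Az').
have -> : A = \bigcup_n F n.
  apply/seteqP; split=> [p Ap|p [n _]].
    by exists (pickle (floor3 p)); [exact: I|rewrite /F pickleK_inv; split].
  by rewrite /F; case: pickle_inv => // z [].
rewrite measure_bigcup// (eq_eseriesr (fun n _ => FG n)) -measure_bigcup//.
rewrite -leb3_cell0; apply: le_measure; rewrite ?inE//; first exact: bigcup_measurable.
move=> p [n _]; rewrite /G; case: pickle_inv => // -[[a b] c] [_].
rewrite /cell /= act3_intvec3 /floor3 /= !floorDrz ?intr_int// !intrKfloor.
case=> ha hb hc; have aux (x y : int) : x + y = y -> x = 0 by lia.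
by rewrite (aux _ _ ha) (aux _ _ hb) (aux _ _ hc).
Qed.

End Packing.

(** * Quadratic polynomials integrated over boxes *)

Section BoxIntegral.
Variable R : realType.
Local Notation mR := (measurableTypeR R).
Local Notation mu := (@lebesgue_measure R).
Local Notation T3 := (mR * mR * mR)%type.

(** Open, so that the parallelepipeds built on such boxes are disjoint and not merely without common
    interior. *)
Definition segment (h : R) : set mR := `]-h, h[%classic.

Lemma measurable_segment h : measurable (segment h).
Proof. exact: measurable_itv. Qed.

Lemma integral_quadratic_segment (a b c h : R) : 0 <= h ->
  (\int[mu]_(x in segment h) (a + b * x + c * x ^+ 2)%R%:E =
   (2 * h * (a + c * h ^+ 2 / 3))%R%:E)%E.
Proof.
rewrite /segment le_eqVlt => /predU1P[<-|h0].
  by rewrite oppr0 set_itvoo0 integral_set0 mulr0 mul0r.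
pose P : {poly R} := a *: 'X + (b / 2) *: 'X^2 + (c / 3) *: 'X^3.
have P'E x : (deriv P).[x] = a + b * x + c * x ^+ 2.
  rewrite /P !poly.derivE !hornerE/=; by field.
have mP : measurable_fun setT (fun x => (deriv P).[x]%:E).
  by apply/measurable_EFinP; apply: continuous_measurable_fun; exact: continuous_horner.
under eq_integral do rewrite -P'E.
rewrite integral_itv_obnd_cbnd ?integral_itv_bndo_bndc//; [|exact: measurable_funTS..].
rewrite (@continuous_FTC2 _ (horner (deriv P)) (horner P)).
- by rewrite -EFinB; congr (_%:E); rewrite /P !hornerE/=; by field.
- lra.
- exact/continuous_subspaceT/continuous_horner.
- split; first by move=> x _; exact: derivable_horner.
  + exact/cvg_at_right_filter/continuous_horner.
  + exact/cvg_at_left_filter/continuous_horner.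
- by move=> x _; rewrite derivE.
Qed.

Definition box3 (h : T3) : set T3 :=
  segment h.1.1 `*` segment h.1.2 `*` segment h.2.

Lemma measurable_box3 h : measurable (box3 h).
Proof.
apply: measurableX; last exact: measurable_segment.
by apply: measurableX; exact: measurable_segment.
Qed.

(** The box is symmetric in each coordinate, so linear and mixed terms integrate to 0. Nonnegativity
    of [g] serves Tonelli's theorem. *)
Lemma integral_quadratic_box (c0 l1 l2 l3 a b c d e f h1 h2 h3 : R)
    (g := fun p : T3 => c0 + l1 * p.1.1 + l2 * p.1.2 + l3 * p.2 +
      a * p.1.1 ^+ 2 + b * p.1.2 ^+ 2 + c * p.2 ^+ 2 + d * p.1.1 * p.1.2 +
      e * p.1.1 * p.2 + f * p.1.2 * p.2) :
  0 <= h1 -> 0 <= h2 -> 0 <= h3 -> measurable_fun setT g -> (forall p, 0 <= g p) ->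
  (\int[leb3 R]_(p in box3 (h1, h2, h3)) (g p)%:E =
   (8 * h1 * h2 * h3 * (c0 + (a * h1 ^+ 2 + b * h2 ^+ 2 + c * h3 ^+ 2) / 3))%:E)%E.
Proof.
move=> h10 h20 h30 mg g0.
have mgE : measurable_fun setT (fun p => (g p)%:E) by exact/measurable_EFinP.
have mG : measurable_fun setT ((fun p => (g p)%:E) \_ (box3 (h1, h2, h3))).
  apply/(measurable_restrictT _ (measurable_box3 _)).
  exact: measurable_funTS.
have G0 p : (0 <= ((fun p => (g p)%:E) \_ (box3 (h1, h2, h3))) p)%E.
  by rewrite patchE; case: ifP => // _; rewrite lee_fin.
rewrite integral_mkcond (integral_leb3 mG G0).
have boxE x y z : ((x, y, z) \in box3 (h1, h2, h3)) =
    [&& x \in segment h1, y \in segment h2 & z \in segment h3].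
  by rewrite /box3 !in_setX andbA.
have stepz x y : (\int[mu]_z ((fun p => (g p)%:E) \_ (box3 (h1, h2, h3))) (x, y, z) =
    if (x \in segment h1) && (y \in segment h2) then
      (2 * h3 * (c0 + l1 * x + l2 * y + a * x ^+ 2 + b * y ^+ 2 + d * x * y + c * h3 ^+ 2 / 3))%R%:E
    else 0)%E.
  case: ifPn => xy; last first.
    rewrite integral0_eq// => z _; rewrite patchE boxE.
    by case: ifP => // /and3P[hx hy _]; rewrite hx hy in xy.
  have [hx hy] := andP xy.
  have := integral_quadratic_segment (c0 + l1 * x + l2 * y + a * x ^+ 2 + b * y ^+ 2 + d * x * y)
    (l3 + e * x + f * y) c h30.
  rewrite integral_mkcond => <-; apply: eq_integral => z _.
  rewrite !patchE boxE hx hy/=; case: ifP => // _; congr (_%:E); rewrite /g /=; by ring.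
have stepy x : (\int[mu]_y \int[mu]_z ((fun p => (g p)%:E) \_ (box3 (h1, h2, h3))) (x, y, z) =
    if x \in segment h1 then
      (4 * h2 * h3 * (c0 + l1 * x + a * x ^+ 2 + (b * h2 ^+ 2 + c * h3 ^+ 2) / 3))%R%:E
    else 0)%E.
  under eq_integral do rewrite stepz.
  case: ifPn => hx /=; last by rewrite integral0.
  have H := integral_quadratic_segment (2 * h3 * (c0 + l1 * x + a * x ^+ 2 + c * h3 ^+ 2 / 3))
    (2 * h3 * (l2 + d * x)) (2 * h3 * b) h20.
  rewrite integral_mkcond in H; transitivity (\int[mu]_y (((fun y => (2 * h3 * (c0 + l1 * x + a * x ^+ 2 + c * h3 ^+ 2 / 3) + 2 * h3 * (l2 + d * x) * y + 2 * h3 * b * y ^+ 2)%R%:E) \_ (segment h2)) y))%E.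
    apply: eq_integral => y _; rewrite patchE; case: ifP => // _; congr (_%:E); by ring.
  by rewrite H; congr (_%:E); by field.
under eq_integral do rewrite stepy.
have H := integral_quadratic_segment (4 * h2 * h3 * (c0 + (b * h2 ^+ 2 + c * h3 ^+ 2) / 3))
  (4 * h2 * h3 * l1) (4 * h2 * h3 * a) h10.
rewrite integral_mkcond in H; transitivity (\int[mu]_x (((fun x => (4 * h2 * h3 * (c0 + (b * h2 ^+ 2 + c * h3 ^+ 2) / 3) + 4 * h2 * h3 * l1 * x + 4 * h2 * h3 * a * x ^+ 2)%R%:E) \_ (segment h1)) x))%E.
  apply: eq_integral => x _; rewrite [in RHS]patchE; case: (x \in segment h1) => //=; congr (_%:E); by ring.
by rewrite H; congr (_%:E); by field.
Qed.

End BoxIntegral.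

(** * The Voronoi cell of an obtuse superbase *)

Section VoronoiCell.
Variable R : realType.
Local Notation mR := (measurableTypeR R).
Local Notation T3 := (mR * mR * mR)%type.

Definition bform n (A : 'M[R]_n) (x y : 'rV[R]_n) : R := (x *m A *m y^T) 0 0.

Lemma bformDl n (A : 'M[R]_n) x y z : bform A (x + y) z = bform A x z + bform A y z.
Proof. by rewrite /bform !mulmxDl mxE. Qed.

Lemma bformDr n (A : 'M[R]_n) x y z : bform A x (y + z) = bform A x y + bform A x z.
Proof. by rewrite /bform linearD/= mulmxDr mxE. Qed.

Lemma bformZl n (A : 'M[R]_n) a x y : bform A (a *: x) y = a * bform A x y.
Proof. by rewrite /bform -!scalemxAl mxE. Qed.

Lemma bformZr n (A : 'M[R]_n) a x y : bform A x (a *: y) = a * bform A x y.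
Proof. by rewrite /bform linearZ/= -scalemxAr mxE. Qed.

Lemma bformNl n (A : 'M[R]_n) x y : bform A (- x) y = - bform A x y.
Proof. by rewrite -scaleN1r bformZl mulN1r. Qed.

Lemma bformNr n (A : 'M[R]_n) x y : bform A x (- y) = - bform A x y.
Proof. by rewrite -scaleN1r bformZr mulN1r. Qed.

Lemma bformC n (A : 'M[R]_n) x y : A^T = A -> bform A x y = bform A y x.
Proof.
move=> sA; have -> : bform A x y = (y *m A *m x^T)^T 0 0.
  by rewrite !trmx_mul trmxK sA mulmxA.
by rewrite mxE.
Qed.

Lemma bform_mull n (A M : 'M[R]_n) x y : bform A (x *m M) y = bform (M *m A) x y.
Proof. by rewrite /bform !mulmxA. Qed.

Lemma bform_mulr n (A M : 'M[R]_n) x y : bform A x (y *m M) = bform (A *m M^T) x y.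
Proof. by rewrite /bform trmx_mul !mulmxA. Qed.

Lemma dotvE n (x y : 'rV[R]_n) : dotv x y = bform 1%:M x y.
Proof.
by rewrite /bform mulmx1 mxE; apply: eq_bigr => i _; rewrite mxE.
Qed.

Lemma gramE n (B : 'M[R]_n) : gram B = B *m B^T.
Proof.
by apply/matrixP => i j; rewrite !mxE; apply: eq_bigr => k _; rewrite !mxE.
Qed.

Lemma zspanE (B : 'M[R]_3) : zspan B = [set intvec3 R z *m B | z in setT].
Proof.
apply/seteqP; split=> x /=.
- move=> [z ->]; exists (z 0, z 1, z 2%:R) => //.
  rewrite mulmx_sum_row; apply: eq_bigr => i _; rewrite !mxE.
  rewrite -[RHS]scaler_int; congr (_ *: _).
  by case: i => [[|[|[|//]]] ?] /=; congr (z _)%:~R; exact/val_inj.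
- move=> [[[a b] c] _ <-]; exists (fun i : 'I_3 => [:: a; b; c]`_i).
  rewrite mulmx_sum_row; apply: eq_bigr => i _; rewrite !mxE -[RHS]scaler_int; congr (_ *: _).
  by case: i => [[|[|[|//]]] ?].
Qed.

(* The Voronoi cell, in the coordinates [x *m B^T] given by the inner products
   with the basis vectors. *)
Definition dual_cell (G : 'M[R]_3) : set 'rV[R]_3 :=
  [set f | forall z, 2 * bform 1%:M f (intvec3 R z) <= bform G (intvec3 R z) (intvec3 R z)].

(** Squaring turns the comparison of distances into 2 x.y <= y.y; for y = z B the product x.y is
    that of x B^T with z. *)
Lemma voronoi_zspan (B : 'M[R]_3) (x : 'rV[R]_3) :
  voronoi (zspan B) x <-> dual_cell (gram B) (x *m B^T).
Proof.
have key (y : 'rV[R]_3) :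
    (enorm x <= enorm (x - y)) = (2 * dotv x y <= dotv y y).
  rewrite /enorm ler_sqrt; last by apply: sumr_ge0 => i _; rewrite -expr2 sqr_ge0.
  rewrite !dotvE !(bformDl, bformDr, bformNl, bformNr).
  by rewrite (bformC y x (trmx1 _ _)); lra.
rewrite /voronoi zspanE gramE /dual_cell /=; split.
- move=> h z; have := h _ (ex_intro2 _ _ z I erefl).
  by rewrite key !dotvE !(bform_mulr, bform_mull) !(mul1mx, mulmx1).
- move=> h y [z _ <-]; move: (h z).
  by rewrite key !dotvE !(bform_mulr, bform_mull) !(mul1mx, mulmx1).
Qed.

Definition rowset (A : set 'rV[R]_3) : set T3 := @vec3 R @^-1` A.

Lemma measurable_bform (A : 'M[R]_3) (y : 'rV[R]_3) :
  measurable_fun setT (fun p : T3 => bform A (vec3 p) y : mR).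
Proof.
have -> : (fun p : T3 => bform A (vec3 p) y) =
    fun p : T3 => \sum_i vec3 p 0 i * (A *m y^T) i 0.
  by apply/funext => p; rewrite /bform -mulmxA mxE.
apply: measurable_sum => i.
exact: (measurableT_comp (mulrr_measurable _) (@measurable_coord R i)).
Qed.

Lemma measurable_quad (A : 'M[R]_3) :
  measurable_fun setT (fun p : T3 => bform A (vec3 p) (vec3 p) : mR).
Proof.
have -> : (fun p : T3 => bform A (vec3 p) (vec3 p)) =
    fun p : T3 => \sum_j (\sum_i vec3 p 0 i * A i j) * vec3 p 0 j.
  apply/funext => p; rewrite /bform mxE; apply: eq_bigr => j _.
  by rewrite mxE [X in _ * X]mxE.
apply: measurable_sum => j; apply: measurable_funM; last exact: (@measurable_coord R).
apply: measurable_sum => i.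
exact: (measurableT_comp (mulrr_measurable _) (@measurable_coord R i)).
Qed.

(** There are countably many half-spaces to intersect, one for each integer vector, enumerated by
    [pickle]. *)
Lemma measurable_dual_cell (G : 'M[R]_3) : measurable (rowset (dual_cell G)).
Proof.
have -> : rowset (dual_cell G) = \bigcap_n
    if pickle_inv n is Some z then
      [set p : T3 | 2 * bform 1%:M (vec3 p) (intvec3 R z) <= bform G (intvec3 R z) (intvec3 R z)]
    else setT.
  apply/seteqP; split=> p /= h.
    by move=> n _; case: pickle_inv => // z; exact: h.
  by move=> z; have := h (pickle z) I; rewrite pickleK_inv.
apply: bigcapT_measurable => n; case: pickle_inv => // z.
rewrite -[X in measurable X]setTI; apply: measurable_fun_ler => //.
apply: (measurableT_comp (mulrl_measurable 2) (measurable_bform _ _)).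
Qed.

(** In these coordinates the lattice is generated by the rows of G. The cell itself meets its
    translates along the boundary; shrunk by any factor r > 1 it does not, and the packing bound
    applies. Then r tends to 1. *)
Lemma dual_cell_packing (G : 'M[R]_3) : 0 < \det G ->
  (forall z, z != 0 -> 0 < bform G (intvec3 R z) (intvec3 R z)) ->
  (leb3 R (rowset (dual_cell G)) <= (\det G)%:E)%E.
Proof.
move=> D0 posG; have mC := measurable_dual_cell G.
have scaled r : 1 < r -> (leb3 R (rowset (dual_cell G)) <= (r ^+ 3 * \det G)%:E)%E.
  move=> r1; have r0 : 0 < r by lra.
  have uM : r *: G \in unitmx by rewrite unitmxE detZ unitfE mulf_neq0 ?expf_neq0 ?gt_eqF.
  have rD0 : 0 < r ^+ 3 * \det G by rewrite mulr_gt0// exprn_gt0.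
  have := @leb3_packing_le1 R (act3 (r *: G) 0 @^-1` rowset (dual_cell G)).
  rewrite leb3_act3// detZ gtr0_norm// => h.
  have {}h : ((r ^+ 3 * \det G)^-1%:E * leb3 R (rowset (dual_cell G)) <= 1)%E.
    apply: h; first by rewrite -[X in measurable X]setTI; exact: measurable_act3.
    move=> p z z'; rewrite /rowset /= /act3 !unvec3K !addr0 !mulmx1 => h h'.
    (* If two translates share a point, the inequalities of the cell at w and -w add up to r q <= q,
       where q > 0 is the norm of w. *)
    pose w : int * int * int := z - z'.
    have wE : intvec3 R w = intvec3 R z - intvec3 R z'.
      apply/rowP => i; rewrite !mxE /w.
      by case: i => [[|[|[|//]]] ?] /=; rewrite ?rmorphB.
    have wN : intvec3 R (- w) = - intvec3 R w.
      apply/rowP => i; rewrite !mxE.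
      by case: i => [[|[|[|//]]] ?] /=; rewrite ?rmorphN.
    have [w0|w0] := eqVneq w 0; first by apply/eqP; rewrite -subr_eq0; exact/eqP.
    have := posG _ w0; have := h' (- w); have := h w.
    rewrite wN -!scalemxAr !(bformNl, bformNr, bformZl).
    rewrite !(bform_mulr, bform_mull) !(mul1mx, mulmx1) !bformDl.
    have : bform G (intvec3 R w) (intvec3 R w) =
      bform G (intvec3 R z) (intvec3 R w) - bform G (intvec3 R z') (intvec3 R w).
      by rewrite {1}wE bformDl bformNl.
    move: (bform G (intvec3 R w) (intvec3 R w)) (bform G (vec3 p) _) (bform G (intvec3 R z) _) (bform G (intvec3 R z') _).
    by move=> q a b c -> h1 h2 h3; exfalso; nra.
  move: h; rewrite lee_pdivrMl ?mule1//.
have fC : leb3 R (rowset (dual_cell G)) \is a fin_num.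
  rewrite ge0_fin_numE//; apply: (le_lt_trans (scaled 2 _)); last exact: ltry.
  by lra.
rewrite -(fineK fC) lee_fin; set v := fine _; set D := \det G in D0 scaled *.
rewrite leNgt; apply/negP => Dv.
(* Chosen so that 7 D e < v - D, that is, D (1 + 7 e) < v; since (1 + e)^3 <= 1 + 7 e for e <= 1,
   the bound with r = 1 + e is contradicted. *)
pose e := (v - D) / (v - D + 7 * D).
have e0 : 0 < e by rewrite divr_gt0//; lra.
have e1 : e < 1 by rewrite ltr_pdivrMr; lra.
have eE : e * (v - D + 7 * D) = v - D by rewrite mulfVK// gt_eqF//; lra.
have := scaled (1 + e); rewrite -(fineK fC) lee_fin -/v => /(_ ltac:(lra)) h.
have : (1 + e) ^+ 3 <= 1 + 7 * e by nra.
nra.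
Qed.

Lemma rowset_voronoi (B : 'M[R]_3) :
  rowset (voronoi (zspan B)) = act3 B^T 0 @^-1` rowset (dual_cell (gram B)).
Proof.
apply/seteqP; split=> p; rewrite /rowset /= /act3 unvec3K addr0.
  by move=> /voronoi_zspan.
by move=> h; apply/voronoi_zspan.
Qed.

Lemma leb3_voronoi (B : 'M[R]_3) : B \in unitmx ->
  leb3 R (rowset (voronoi (zspan B))) =
    (`|\det B|^-1%:E * leb3 R (rowset (dual_cell (gram B))))%E.
Proof.
move=> uB; rewrite rowset_voronoi leb3_act3 ?unitmx_tr ?det_tr//.
exact: measurable_dual_cell.
Qed.

(** The hypothesis makes [A] equal to k times the inverse Gram matrix, whose form at x B^T is k
    (x.x). The factor k allows [A] to be the adjugate, which is polynomial in the Gram matrix. *)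
Lemma integral_voronoi (B A : 'M[R]_3) (k : R) : B \in unitmx -> 0 < k ->
  gram B *m A = k%:M ->
  (\int[leb3 R]_(p in rowset (voronoi (zspan B))) (dotv (vec3 p) (vec3 p))%:E =
   (`|\det B|^-1 / k)%:E * \int[leb3 R]_(p in rowset (dual_cell (gram B)))
      (bform A (vec3 p) (vec3 p))%:E)%E.
Proof.
move=> uB k0 BA.
have BAB : B^T *m A *m B = k%:M.
  apply: (can_inj (mulKmx uB)).
  by rewrite !mulmxA -gramE BA mul_mx_scalar mul_scalar_mx.
have qE x : bform A (x *m B^T) (x *m B^T) = k * dotv x x.
  by rewrite dotvE bform_mulr bform_mull trmxK mulmxA BAB /bform mul_mx_scalar -scalemxAl mxE mulmx1.
have mC := measurable_dual_cell (gram B).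
have uBT : B^T \in unitmx by rewrite unitmx_tr.
have q0 p : 0 <= bform A (vec3 p) (vec3 p).
  rewrite -(mulmxKV uBT (vec3 p)) qE; apply: mulr_ge0; first exact: ltW.
  by apply: sumr_ge0 => i _; rewrite -expr2 sqr_ge0.
have mqT : measurable_fun setT (fun p : T3 => (bform A (vec3 p) (vec3 p))%:E).
  by apply/measurable_EFinP; exact: measurable_quad.
have mq := measurable_funTS mqT : measurable_fun (rowset (dual_cell (gram B))) _.
have := integral_act3_set 0 uBT mC mq (fun p => ltac:(by rewrite lee_fin)).
rewrite -rowset_voronoi det_tr EFinM -muleA [((k^-1)%:E * _)%E]muleC muleA => <-.
rewrite muleC -ge0_integralZl//.
- by apply: eq_integral => p _; rewrite /act3 unvec3K addr0 qE -EFinM mulKf// gt_eqF.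
- by rewrite rowset_voronoi -[X in measurable X]setTI; exact: measurable_act3.
- exact: (measurable_funTS (measurableT_comp mqT (measurable_act3 B^T 0))).
- by move=> p _; rewrite lee_fin.
- by rewrite lee_fin invr_ge0 ltW.
Qed.

End VoronoiCell.

(* The edges 0, ..., 5 are the pairs 01, 02, 03, 12, 13, 23 of vertices of K_4;
   the coordinates are the entries of the incidence matrix at the vertices
   1, 2, 3. *)
Definition edge (e j : nat) : int :=
  (nth [::] [:: [:: -1; 0; 0]; [:: 0; -1; 0]; [:: 0; 0; -1];
                [:: 1; -1; 0]; [:: 1; 0; -1]; [:: 0; 1; -1]] e)`_j.

(* The edges of the k-th spanning tree have sign 0; in the k-th cell, the flow
   through any other edge is constant, at the end of its range given by the
   sign. *)
Definition tree_sign (k e : nat) : int :=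
  (nth [::] [:: [:: 0; 0; 0; -1; 1; -1];
                [:: 0; 0; -1; -1; 0; -1];
                [:: 0; 0; 1; -1; 1; 0];
                [:: 0; 1; 0; 0; 1; -1];
                [:: 0; -1; 0; -1; 1; 0];
                [:: 0; 1; -1; 0; 0; -1];
                [:: 0; 1; 1; 0; 1; 0];
                [:: 0; -1; -1; -1; 0; 0];
                [:: -1; 0; 0; 0; 1; -1];
                [:: 1; 0; 0; -1; 0; -1];
                [:: -1; 0; -1; 0; 0; -1];
                [:: -1; 0; 1; 0; 1; 0];
                [:: 1; 0; 1; -1; 0; 0];
                [:: 1; 1; 0; 0; 0; -1];
                [:: -1; -1; 0; 0; 1; 0];
                [:: 1; -1; 0; -1; 0; 0]] k)`_e.

(* The cells are the optimality regions of the bases of a minimum cost flow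
   problem with generic costs; [potential k] is the dual solution for the k-th
   tree. *)
Definition edge_cost (e : nat) : int := [:: 0; 0; 1; 1; 0; 2]`_e.

Definition potential (k j : nat) : int :=
  (nth [::] [:: [:: 0; 0; -1]; [:: 0; 0; 0]; [:: 0; 0; -2]; [:: 0; -1; -1];
                [:: 0; 1; -1]; [:: 0; -1; 0]; [:: 0; -1; -3]; [:: 0; 2; 0];
                [:: 1; 0; -1]; [:: -1; 0; -1]; [:: 1; 0; 1]; [:: 1; 0; -2];
                [:: -2; 0; -2]; [:: -1; -2; -1]; [:: 2; 1; -1]; [:: -1; 1; -1]] k)`_j.

Definition reduced_cost (k e : nat) : int :=
  edge_cost e - \sum_(j < 3) edge e j * potential k j.

Lemma sum3E (V : nmodType) (F : 'I_3 -> V) : \sum_i F i = F 0 + F 1 + F 2%:R.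
Proof.
rewrite !big_ord_recl big_ord0 addr0 addrA.
by congr (F _ + F _ + F _); exact/val_inj.
Qed.

(** Dual feasibility of the potentials. The strict signs off the tree say that the dual solution is
    nondegenerate, which makes the optimal flow unique. *)
Lemma reduced_cost_sign (k e : nat) : (k < 16)%N -> (e < 6)%N ->
  [/\ tree_sign k e = 0 -> reduced_cost k e = 0,
      tree_sign k e = 1 -> reduced_cost k e < 0 &
      tree_sign k e = -1 -> 0 < reduced_cost k e].
Proof.
rewrite /reduced_cost sum3E.
by do 16 (case: k => [|k]; first by do 6 (case: e => [|e]; first by [])).
Qed.

Lemma tree_sign_cases (k e : nat) : (k < 16)%N -> (e < 6)%N ->
  [\/ tree_sign k e = 0, tree_sign k e = 1 | tree_sign k e = -1].
Proof.
by do 16 (case: k => [|k]; first by do 6 (case: e => [|e]; first by constructor)).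
Qed.

(** All spanning trees have three edges, so none contains a different one; checked by
    enumeration. *)
Lemma tree_sign_neq (k l : nat) : (k < 16)%N -> (l < 16)%N -> k != l ->
  exists2 e : 'I_6, tree_sign k e != 0 & tree_sign l e = 0.
Proof.
move=> k16 l16 kl.
suff /hasP[e] : has (fun e => (tree_sign k e != 0) && (tree_sign l e == 0)) (iota 0 6).
  by rewrite mem_iota => /= e6 /andP[ke /eqP le]; exists (Ordinal e6).
have : all (fun k => all (fun l => (k == l) || has (fun e => (tree_sign k e != 0) && (tree_sign l e == 0))
   (iota 0 6)) (iota 0 16)) (iota 0 16) by [].
move=> /allP/(_ k); rewrite mem_iota => /(_ k16) /allP/(_ l).
by rewrite mem_iota => /(_ l16); rewrite (negbTE kl).
Qed.

(** * Bounded flows on K_4 and the zonotope of their divergences *)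

Section Zonotope.
Variable R : realType.
Local Notation mR := (measurableTypeR R).
Local Notation T3 := (mR * mR * mR)%type.
Variable p : nat -> R.
Hypothesis p0 : forall e, 0 <= p e.

Definition edge_vec (e : nat) : 'rV[R]_3 := \row_j (edge e j)%:~R.

(** The net outflow at the vertices 1, 2, 3, every edge being oriented towards its larger end. *)
Definition flow (f : 'I_6 -> R) : 'rV[R]_3 := \sum_e f e *: edge_vec e.

Definition tree_flow (k : nat) (f : 'I_6 -> R) : Prop := forall e : 'I_6,
  if tree_sign k e == 0 then `|2 * f e| < p e else 2 * f e == (tree_sign k e)%:~R * p e.

(** Costs and reduced costs differ by a potential difference along each edge, whose total depends
    only on the divergence of the flow. *)
Lemma flow_cost (k : nat) (f g : 'I_6 -> R) : flow f = flow g ->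
  \sum_(e < 6) (reduced_cost k e)%:~R * (g e - f e) =
  \sum_(e < 6) (edge_cost e)%:~R * (g e - f e).
Proof.
move=> fg; under eq_bigr do rewrite /reduced_cost rmorphB/= mulrBl.
rewrite sumrB [X in _ - X](_ : _ = 0) ?subr0//.
under eq_bigr do rewrite rmorph_sum/= mulr_suml.
rewrite exchange_big/= big1// => j _.
under eq_bigr do rewrite rmorphM/= mulrAC mulrC.
rewrite -mulr_sumr.
have -> : \sum_(e < 6) (edge e j)%:~R * (g e - f e) = (flow g - flow f) 0 j.
  rewrite !mxE !summxE -sumrB; apply: eq_bigr => e _.
  by rewrite !mxE mulrBr [_ * g e]mulrC [_ * f e]mulrC.
by rewrite fg subrr mxE mulr0.
Qed.

(* Complementary slackness: a tree flow is the unique minimizer of the edge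
   costs among the flows in the box with the same divergence. *)
Lemma tree_flow_cost_ge0 (k : nat) (f g : 'I_6 -> R) (e : 'I_6) : (k < 16)%N ->
  tree_flow k f -> (forall e, `|2 * g e| <= p e) ->
  0 <= (reduced_cost k e)%:~R * (g e - f e).
Proof.
move=> k16 /(_ e) fk /(_ e); rewrite ler_norml => /andP[g1 g2].
have [c0 c1 cN] := reduced_cost_sign k16 (ltn_ord e).
have [s0|s1|sN] := tree_sign_cases k16 (ltn_ord e).
- by rewrite c0// mul0r.
- move: fk; rewrite s1 /= mul1r => /eqP fk; rewrite mulr_le0//; last by lra.
  by rewrite lerz0 ltW// c1.
- move: fk; rewrite sN /= => /eqP fk; rewrite mulr_ge0//; last by lra.
  by rewrite ler0z ltW// cN.
Qed.

Lemma tree_flow_le (k : nat) (f : 'I_6 -> R) : (k < 16)%N -> tree_flow k f ->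
  forall e, `|2 * f e| <= p e.
Proof.
move=> k16 fk e; move: (fk e).
have [->|->|->] := tree_sign_cases k16 (ltn_ord e) => /=.
- exact: ltW.
- by move=> /eqP ->; rewrite mul1r ger0_norm.
- by move=> /eqP ->; rewrite mulN1r normrN ger0_norm.
Qed.

(** Both flows minimize the same cost, so the sum of the nonnegative slackness terms of [k] is 0 and
    each term vanishes. On an edge of tree [l] outside tree [k] this forces [g] to equal [f], which
    is at an end of the range, while [g] is strictly inside. *)
Lemma tree_flow_disjoint (k l : nat) (f g : 'I_6 -> R) :
  (k < 16)%N -> (l < 16)%N -> tree_flow k f -> tree_flow l g ->
  flow f = flow g -> k = l.
Proof.
move=> k16 l16 fk gl fg; apply/eqP/negPn/negP => kl.
have [e ke le] := tree_sign_neq k16 l16 kl.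
have kge0 e' := tree_flow_cost_ge0 e' k16 fk (tree_flow_le l16 gl).
have lge0 e' := tree_flow_cost_ge0 e' l16 gl (tree_flow_le k16 fk).
have S0 : \sum_(e < 6) (reduced_cost k e)%:~R * (g e - f e) = 0.
  apply/eqP; rewrite eq_le sumr_ge0 ?andbT//.
  rewrite flow_cost// -oppr_ge0 -sumrN.
  under eq_bigr do rewrite -mulrN opprB.
  by rewrite -(flow_cost l)// sumr_ge0.
have /eqP : (reduced_cost k e)%:~R * (g e - f e) = 0.
  exact: (psumr_eq0P (fun e _ => kge0 e) S0).
rewrite mulf_eq0 intr_eq0 [g e - f e == 0]subr_eq0 => /orP[/eqP r0|/eqP gf].
  have [_ c1 cN] := reduced_cost_sign k16 (ltn_ord e); move: ke.
  have [->//|s1|sN] := tree_sign_cases k16 (ltn_ord e).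
    by move: (c1 s1); rewrite r0.
  by move: (cN sN); rewrite r0.
move: (gl e) (fk e); rewrite le eqxx (negbTE ke) gf => fl /eqP fe; move: fl; rewrite fe.
have [s0|->|->] := tree_sign_cases k16 (ltn_ord e); first by rewrite s0 in ke.
  by rewrite mul1r ger0_norm// ltxx.
by rewrite mulN1r normrN ger0_norm// ltxx.
Qed.

(* [p e] is the Selling parameter - v_i . v_j of the pair e = ij of vectors of a
   superbase v_0 + v_1 + v_2 + v_3 = 0; the basis is v_1, v_2, v_3. *)
Definition conorm_gram : 'M[R]_3 :=
  \sum_(e < 6) p e *: ((edge_vec e)^T *m edge_vec e).

(** Both sides split over the edges. For one edge, with the integer t as its product with z, the
    claim is 2 f t <= p t^2, which follows from |t| <= t^2. *)
Lemma flow_dual_cell (f : 'I_6 -> R) : (forall e, `|2 * f e| <= p e) ->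
  dual_cell conorm_gram (flow f).
Proof.
move=> fp z; set zv := intvec3 R z.
have tI (e : 'I_6) : bform 1%:M (edge_vec e) zv \is a Num.int.
  rewrite -dotvE /dotv rpred_sum// => j _; rewrite !mxE rpredM// ?intr_int//.
  by case: j => [[|[|[|//]]] ?] /=; exact: intr_int.
have -> : bform conorm_gram zv zv = \sum_(e < 6) p e * bform 1%:M (edge_vec e) zv ^+ 2.
  rewrite /bform /conorm_gram mulmx_sumr mulmx_suml summxE; apply: eq_bigr => e _.
  rewrite -scalemxAr -scalemxAl mxE; congr (_ * _).
  rewrite mulmx1 expr2 (_ : _ *m zv^T = (zv *m (edge_vec e)^T) *m (edge_vec e *m zv^T)); last by rewrite !mulmxA.
  rewrite mxE big_ord1 (_ : zv *m (edge_vec e)^T = (edge_vec e *m zv^T)^T); last by rewrite trmx_mul trmxK.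
  by rewrite [in LHS]mxE.
rewrite /flow [X in 2 * X](_ : _ = \sum_(e < 6) f e * bform 1%:M (edge_vec e) zv); last first.
  by rewrite /bform !mulmx_suml summxE; apply: eq_bigr => e _; rewrite -!scalemxAl mxE.
rewrite mulr_sumr; apply: ler_sum => e _; move: (fp e) (tI e) => {}fp /intrP[t ->].
rewrite mulrA; apply: le_trans (ler_norm _) _; rewrite normrM.
apply: le_trans (ler_wpM2r (normr_ge0 _) fp) _; apply: ler_wpM2l => //.
rewrite -intr_norm -rmorphXn/= ler_int; nia.
Qed.

End Zonotope.

Lemma det3 (K : comPzRingType) (A : 'M[K]_3) : \det A =
  A 0 0 * (A 1 1 * A 2%:R 2%:R - A 1 2%:R * A 2%:R 1)
  - A 0 1 * (A 1 0 * A 2%:R 2%:R - A 1 2%:R * A 2%:R 0)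
  + A 0 2%:R * (A 1 0 * A 2%:R 1 - A 1 1 * A 2%:R 0).
Proof.
pose a i j := A (inord i) (inord j).
have AE i j : A i j = a i j by rewrite /a !inord_val.
have -> : A = \matrix_(i, j) a i j by apply/matrixP => i j; rewrite mxE AE.
rewrite !mxE !(expand_det_row _ ord0) !big_ord_recl !big_ord0 /cofactor.
rewrite !(expand_det_row _ ord0) !big_ord_recl !big_ord0 /cofactor !det_mx11 !mxE /=.
by rewrite /bump /= !(add0n, addn0, add1n, addn1) !expr0 !expr1 !expr2; ring.
Qed.

Definition tree (k : nat) : seq nat := [seq e <- iota 0 6 | tree_sign k e == 0].

Definition tree_edge (k i : nat) : nat := nth 0%N (tree k) i.

Lemma size_tree k : (k < 16)%N -> size (tree k) = 3%N.
Proof. by do 16 (case: k => [|k]; first by []). Qed.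

Definition tree_imx (k : nat) : 'M[int]_3 := \matrix_(i, j) edge (tree_edge k i) j.

(** Unimodularity of incidence matrices of trees; it makes the map from tree flows to divergences
    preserve volume. *)
Lemma det_tree_imx k : (k < 16)%N -> `|\det (tree_imx k)| = 1.
Proof.
by rewrite det3 !mxE /=; do 16 (case: k => [|k]; first by []).
Qed.

(** * The parallelepipeds of the spanning trees *)

Section TreeCells.
Variable R : realType.
Local Notation mR := (measurableTypeR R).
Local Notation T3 := (mR * mR * mR)%type.
Variable p : nat -> R.
Hypothesis p0 : forall e, 0 <= p e.

Definition tree_mx (k : nat) : 'M[R]_3 := map_mx intr (tree_imx k).

Definition tree_shift (k : nat) : 'rV[R]_3 :=
  \sum_(e < 6) ((tree_sign k e)%:~R * p e / 2) *: edge_vec R e.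

Definition tree_box (k : nat) : T3 :=
  (p (tree_edge k 0) / 2, p (tree_edge k 1) / 2, p (tree_edge k 2) / 2).

(** The parallelepiped centred at [tree_shift k], written as a preimage under the inverse affine map
    because measurability and change of variables are available for preimages. *)
Definition tree_cell (k : nat) : set T3 :=
  act3 (invmx (tree_mx k)) (- (tree_shift k *m invmx (tree_mx k))) @^-1`
    box3 (tree_box k).

Lemma norm_det_tree_mx k : (k < 16)%N -> `|\det (tree_mx k)| = 1.
Proof. by move=> k16; rewrite det_map_mx -intr_norm det_tree_imx. Qed.

Lemma tree_mx_unit k : (k < 16)%N -> tree_mx k \in unitmx.
Proof.
move=> k16; rewrite unitmxE unitfE -normr_eq0 norm_det_tree_mx//.
Qed.

Lemma measurable_tree_cell k : measurable (tree_cell k).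
Proof.
by rewrite -[X in measurable X]setTI; apply: measurable_act3 => //; exact: measurable_box3.
Qed.

Lemma tree_cell_flow k q : (k < 16)%N -> tree_cell k q ->
  exists2 f, tree_flow p k f & flow f = vec3 q.
Proof.
move=> k16; rewrite /tree_cell /=; set s := act3 _ _ q => sB.
have uN := tree_mx_unit k16.
have qE : vec3 q = vec3 s *m tree_mx k + tree_shift k.
  by rewrite /s /act3 unvec3K mulmxDl mulNmx !mulmxKV// subrK.
pose sv (i : nat) := [:: s.1.1; s.1.2; s.2]`_i.
have svB i : (i < 3)%N -> `|2 * sv i| < p (tree_edge k i).
  move: sB; rewrite /box3 /segment /= !in_itv/= => -[[/andP[h1 h2] /andP[h3 h4]] /andP[h5 h6]].
  by move=> i3; rewrite ltr_norml; do 3 (case: i i3 => [|i] i3; first by apply/andP; split; rewrite /sv /=; lra).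
(* A tree edge carries the box coordinate at its position in the list [tree k]; any other edge
   carries its prescribed extreme value. *)
pose f (e : 'I_6) := if tree_sign k e == 0 then sv (index (e : nat) (tree k))
  else (tree_sign k e)%:~R * p e / 2.
exists f.
  move=> e; rewrite /f; case: ifPn => [|e0]; last first.
    by rewrite (negbTE e0) mulrC divfK.
  move=> e0; rewrite e0; have ek : (e : nat) \in tree k by rewrite mem_filter e0 mem_iota/=.
  rewrite -{2}(nth_index 0%N ek); apply: svB.
  by move: ek; rewrite -index_mem size_tree.
have fE (e : 'I_6) : f e = (if tree_sign k e == 0 then sv (index (e : nat) (tree k)) else 0) +
    (tree_sign k e)%:~R * p e / 2.
  rewrite /f; case: ifPn => [/eqP ->|]; last by rewrite add0r.
  by rewrite !mul0r addr0.
rewrite /flow qE; under eq_bigr do rewrite fE scalerDl.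
rewrite big_split /=; congr (_ + _).
rewrite mulmx_sum_row.
under eq_bigr do rewrite (fun_if (fun x => x *: _)) scale0r.
rewrite -big_mkcond /= -(big_mkord (fun e => tree_sign k e == 0) (fun e => sv (index e (tree k)) *: edge_vec R e)).
rewrite /index_iota subn0 -big_filter -/(tree k) (big_nth 0%N) big_mkord size_tree//.
apply: eq_bigr => i _; rewrite index_uniq ?size_tree//; last by rewrite filter_uniq ?iota_uniq.
by rewrite mxE; congr (_ *: _); apply/rowP => j; rewrite !mxE.
Qed.

Lemma tree_cell_sub k : (k < 16)%N -> tree_cell k `<=` rowset (dual_cell (conorm_gram p)).
Proof.
move=> k16 q /(tree_cell_flow k16)[f fk fq]; rewrite /rowset /= -fq.
by apply: flow_dual_cell => //; exact: (tree_flow_le p0 k16 fk).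
Qed.

Lemma tree_cell_disjoint k l q : (k < 16)%N -> (l < 16)%N ->
  tree_cell k q -> tree_cell l q -> k = l.
Proof.
move=> k16 l16 /(tree_cell_flow k16)[f fk fq] /(tree_cell_flow l16)[g gl gq].
by apply: (tree_flow_disjoint p0 k16 l16 fk gl); rewrite fq gq.
Qed.

Lemma integral_tree_cell (k : nat) (f : T3 -> \bar R) : (k < 16)%N ->
  measurable_fun setT f -> (forall q, 0 <= f q)%E ->
  (\int[leb3 R]_(q in tree_cell k) f q =
   \int[leb3 R]_(s in box3 (tree_box k)) f (act3 (tree_mx k) (tree_shift k) s))%E.
Proof.
move=> k16 mf f0; have uN := tree_mx_unit k16.
have := integral_act3_set (tree_shift k) uN (measurable_tree_cell k) (measurable_funTS mf) f0.
rewrite norm_det_tree_mx// invr1 mul1e => <-; congr (\int[leb3 R]_(s in _) _)%E.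
apply/seteqP; split=> s; rewrite /tree_cell /= [act3 _ _ (act3 _ _ s)](_ : _ = s)//;
  by rewrite /act3 unvec3K mulmxDl mulmxK// addrK vec3K.
Qed.

Let leb_segment h : 0 <= h -> @lebesgue_measure R (segment h) = (2 * h)%:E.
Proof.
rewrite /segment lebesgue_measure_itv/= lte_fin => h0; case: ifPn => [_|].
  by rewrite -EFinB; congr (_%:E); ring.
by rewrite -leNgt => h1; congr (_%:E); lra.
Qed.

Lemma leb3_tree_cell (k : nat) : (k < 16)%N -> leb3 R (tree_cell k) =
  (p (tree_edge k 0) * p (tree_edge k 1) * p (tree_edge k 2))%:E.
Proof.
move=> k16; have uN := tree_mx_unit k16.
have -> : leb3 R (tree_cell k) = leb3 R (box3 (tree_box k)).
  rewrite leb3_act3 ?unitmx_inv//; last exact: measurable_box3.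
  by rewrite det_inv normfV norm_det_tree_mx// !invr1 mul1e.
have mS h := @measurable_segment R h.
rewrite /box3 -[LHS]/(((@lebesgue_measure R \x @lebesgue_measure R) \x @lebesgue_measure R)%E _).
rewrite product_measure1E//; last exact: measurableX.
rewrite -[X in (X * _)%E]/((@lebesgue_measure R \x @lebesgue_measure R)%E _) product_measure1E//.
rewrite -[LHS]/(@lebesgue_measure R (segment (tree_box k).1.1) *
  @lebesgue_measure R (segment (tree_box k).1.2) * @lebesgue_measure R (segment (tree_box k).2))%E.
rewrite !leb_segment ?divr_ge0// -!EFinM; congr (_%:E); rewrite /tree_box/=; by field.
Qed.

(** The parallel axis theorem: volume times the value at the centre, plus the central moment, in
    which a side of length p contributes p^2 / 12. *)
Lemma integral_tree_cell_quad (k : nat) (A : 'M[R]_3) : (k < 16)%N -> A^T = A ->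
  (forall x, 0 <= bform A x x) ->
  (\int[leb3 R]_(q in tree_cell k) (bform A (vec3 q) (vec3 q))%:E =
   (p (tree_edge k 0) * p (tree_edge k 1) * p (tree_edge k 2) *
    (bform A (tree_shift k) (tree_shift k) +
     \sum_(i < 3) bform A (row i (tree_mx k)) (row i (tree_mx k)) *
       p (tree_edge k i) ^+ 2 / 12))%:E)%E.
Proof.
move=> k16 sA qA.
pose r i := row i (tree_mx k); set d := tree_shift k; pose b := bform A.
have mf : measurable_fun setT (fun q : T3 => (bform A (vec3 q) (vec3 q))%:E).
  by apply/measurable_EFinP; exact: measurable_quad.
rewrite integral_tree_cell//; last by move=> q; rewrite lee_fin.
pose g (s : T3) := b d d + (2 * b (r 0) d) * s.1.1 + (2 * b (r 1) d) * s.1.2 +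
  (2 * b (r 2%:R) d) * s.2 + b (r 0) (r 0) * s.1.1 ^+ 2 + b (r 1) (r 1) * s.1.2 ^+ 2 +
  b (r 2%:R) (r 2%:R) * s.2 ^+ 2 + (2 * b (r 0) (r 1)) * s.1.1 * s.1.2 +
  (2 * b (r 0) (r 2%:R)) * s.1.1 * s.2 + (2 * b (r 1) (r 2%:R)) * s.1.2 * s.2.
have gE s : bform A (vec3 (act3 (tree_mx k) d s)) (vec3 (act3 (tree_mx k) d s)) = g s.
  have -> : vec3 (act3 (tree_mx k) d s) = s.1.1 *: r 0 + s.1.2 *: r 1 + s.2 *: r 2%:R + d.
    by rewrite /act3 unvec3K mulmx_sum_row sum3E !mxE.
  rewrite !(bformDl, bformDr) !(bformZl, bformZr) -/b.
  have bC x y : b x y = b y x by exact: bformC.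
  rewrite (bC d (r 0)) (bC d (r 1)) (bC d (r 2%:R)).
  rewrite (bC (r 1) (r 0)) (bC (r 2%:R) (r 0)) (bC (r 2%:R) (r 1)).
  by rewrite /g; ring.
have mg : measurable_fun setT g.
  rewrite (_ : g = fun s => bform A (vec3 (act3 (tree_mx k) d s)) (vec3 (act3 (tree_mx k) d s))).
    exact: (measurableT_comp (measurable_quad A) (measurable_act3 _ _)).
  by apply/funext => s; rewrite gE.
under eq_integral do rewrite gE.
rewrite /tree_box integral_quadratic_box ?divr_ge0//.
- by congr (_%:E); rewrite sum3E -/b -/(r 0) -/(r 1) -/(r 2%:R) /=; field.
- by move=> s; have := qA (vec3 (act3 (tree_mx k) d s)); rewrite gE.
Qed.

End TreeCells.

Definition mx3 (K : Type) (a00 a01 a02 a10 a11 a12 a20 a21 a22 : K) : 'M[K]_3 :=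
  \matrix_(i, j) nth a00 (nth [::] [:: [:: a00; a01; a02]; [:: a10; a11; a12];
    [:: a20; a21; a22]] i) j.

Lemma mx3P (K : Type) (A B : 'M[K]_3) :
  A 0 0 = B 0 0 -> A 0 1 = B 0 1 -> A 0 2%:R = B 0 2%:R ->
  A 1 0 = B 1 0 -> A 1 1 = B 1 1 -> A 1 2%:R = B 1 2%:R ->
  A 2%:R 0 = B 2%:R 0 -> A 2%:R 1 = B 2%:R 1 -> A 2%:R 2%:R = B 2%:R 2%:R -> A = B.
Proof.
have o i : [\/ i = 0 :> 'I_3, i = 1 | i = 2%:R].
  by case: i => [[|[|[|//]]] h]; [apply: Or31|apply: Or32|apply: Or33]; exact/val_inj.
move=> *; apply/matrixP => i j.
by have [->|->|->] := o i; have [->|->|->] := o j.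
Qed.

(** The adjugate with explicit entries, so that identities about it are within reach of [ring]. *)
Definition adj3 (K : comPzRingType) (A : 'M[K]_3) : 'M[K]_3 := mx3
  (A 1 1 * A 2%:R 2%:R - A 1 2%:R * A 2%:R 1)
  (A 0 2%:R * A 2%:R 1 - A 0 1 * A 2%:R 2%:R)
  (A 0 1 * A 1 2%:R - A 0 2%:R * A 1 1)
  (A 1 2%:R * A 2%:R 0 - A 1 0 * A 2%:R 2%:R)
  (A 0 0 * A 2%:R 2%:R - A 0 2%:R * A 2%:R 0)
  (A 0 2%:R * A 1 0 - A 0 0 * A 1 2%:R)
  (A 1 0 * A 2%:R 1 - A 1 1 * A 2%:R 0)
  (A 0 1 * A 2%:R 0 - A 0 0 * A 2%:R 1)
  (A 0 0 * A 1 1 - A 0 1 * A 1 0).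

Lemma mul_mx_adj3 (K : comPzRingType) (A : 'M[K]_3) : A *m adj3 A = (\det A)%:M.
Proof. by apply: mx3P; rewrite det3 !mxE sum3E !mxE /= ?mulr1n ?mulr0n; ring. Qed.

Lemma adj3_tr (K : comPzRingType) (A : 'M[K]_3) : (adj3 A)^T = adj3 A^T.
Proof. by apply: mx3P; rewrite !mxE /=; ring. Qed.

Lemma sum6E (V : nmodType) (F : nat -> V) :
  \sum_(e < 6) F e = F 0%N + F 1%N + F 2%N + F 3%N + F 4%N + F 5%N.
Proof. by rewrite !big_ord_recr big_ord0 /= add0r. Qed.

Lemma bform_diagE (R : realType) (A : 'M[R]_3) (x : 'rV[R]_3) :
  bform A x x =
    A 0 0 * x 0 0 ^+ 2 + A 1 1 * x 0 1 ^+ 2 + A 2%:R 2%:R * x 0 2%:R ^+ 2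
    + (A 0 1 + A 1 0) * x 0 0 * x 0 1 + (A 0 2%:R + A 2%:R 0) * x 0 0 * x 0 2%:R
    + (A 1 2%:R + A 2%:R 1) * x 0 1 * x 0 2%:R.
Proof. by rewrite /bform mxE sum3E !mxE !sum3E; ring. Qed.

(** * Volume and second moment as polynomials in the Selling parameters *)

Section CellMoments.
Variable R : realType.
Local Notation mR := (measurableTypeR R).
Local Notation T3 := (mR * mR * mR)%type.
Variable p : nat -> R.

Lemma conorm_gramE : conorm_gram p = mx3
  (p 0 + p 3 + p 4) (- p 3) (- p 4)
  (- p 3) (p 1 + p 3 + p 5) (- p 5)
  (- p 4) (- p 5) (p 2 + p 4 + p 5).
Proof.
have E i j : conorm_gram p i j =
    \sum_(e < 6) p e * ((edge e i)%:~R * (edge e j)%:~R).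
  by rewrite /conorm_gram summxE; apply: eq_bigr => e _; rewrite !mxE big_ord1 !mxE.
apply: mx3P; rewrite E (sum6E (fun e => p e * ((edge e _)%:~R * (edge e _)%:~R))) !mxE /edge /=; ring.
Qed.

Definition tree_poly : R := \sum_(k < 16)
  p (tree_edge k 0) * p (tree_edge k 1) * p (tree_edge k 2).

(** The weighted matrix-tree theorem for K_4. *)
Lemma det_conorm_gram : \det (conorm_gram p) = tree_poly.
Proof.
rewrite conorm_gramE det3 /tree_poly !mxE !big_ord_recr big_ord0 /=; ring.
Qed.

(** The quartic part runs over the 15 sets of four edges of K_4: coefficient 2 for the three
    4-cycles, 1 for the twelve triangles with a pendant edge. *)
Definition moment_poly : R :=
  tree_poly * (p 0 + p 1 + p 2 + p 3 + p 4 + p 5) +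
  (p 0 * p 1 * p 2 * p 3 + p 0 * p 1 * p 2 * p 4 + p 0 * p 1 * p 2 * p 5 +
   p 0 * p 1 * p 3 * p 4 + p 0 * p 1 * p 3 * p 5 + 2 * (p 0 * p 1 * p 4 * p 5) +
   p 0 * p 2 * p 3 * p 4 + 2 * (p 0 * p 2 * p 3 * p 5) + p 0 * p 2 * p 4 * p 5 +
   p 0 * p 3 * p 4 * p 5 + 2 * (p 1 * p 2 * p 3 * p 4) + p 1 * p 2 * p 3 * p 5 +
   p 1 * p 2 * p 4 * p 5 + p 1 * p 3 * p 4 * p 5 + p 2 * p 3 * p 4 * p 5).

Let Q (x y z : R) : R :=
  ((p 1 + p 3 + p 5) * (p 2 + p 4 + p 5) - p 5 ^+ 2) * x ^+ 2 +
  ((p 0 + p 3 + p 4) * (p 2 + p 4 + p 5) - p 4 ^+ 2) * y ^+ 2 +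
  ((p 0 + p 3 + p 4) * (p 1 + p 3 + p 5) - p 3 ^+ 2) * z ^+ 2 +
  2 * (p 4 * p 5 + p 3 * (p 2 + p 4 + p 5)) * x * y +
  2 * (p 3 * p 5 + p 4 * (p 1 + p 3 + p 5)) * x * z +
  2 * (p 3 * p 4 + p 5 * (p 0 + p 3 + p 4)) * y * z.

Let QE x : bform (adj3 (conorm_gram p)) x x = Q (x 0 0) (x 0 1) (x 0 2%:R).
Proof.
rewrite bform_diagE; move: conorm_gramE; move: (conorm_gram p) => G GE.
have [e0 [e1 e2]] : [/\ G 0 0 = p 0 + p 3 + p 4, G 1 1 = p 1 + p 3 + p 5 &
    G 2%:R 2%:R = p 2 + p 4 + p 5] /\ [/\ G 0 1 = - p 3, G 1 0 = - p 3 &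
    G 0 2%:R = - p 4] /\ [/\ G 2%:R 0 = - p 4, G 1 2%:R = - p 5 & G 2%:R 1 = - p 5].
  by rewrite GE !mxE.
move: e0 e1 e2 => [a b c] [d e f] [g h i].
by rewrite !mxE /= a b c d e f g h i /Q; ring.
Qed.

Let shift2 k j : R := \sum_(e < 6) (tree_sign k e * edge e j)%:~R * p e.

Let tree_shiftE k j : tree_shift p k 0 j = shift2 k j / 2.
Proof.
rewrite summxE mulr_suml; apply: eq_bigr => e _; rewrite !mxE rmorphM/=.
by rewrite -!mulrA [_^-1 * _]mulrC !mulrA -!mulrA; congr (_ * _); rewrite mulrCA.
Qed.

(** Twelve times the moment of the k-th parallelepiped; the value at the centre comes with factor 3
    because [shift2] is twice the centre. This leaves an identity of degree 7 with integer
    coefficients. *)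
Let term k : R := p (tree_edge k 0) * p (tree_edge k 1) * p (tree_edge k 2) *
  (3 * Q (shift2 k 0) (shift2 k 1) (shift2 k 2) +
   (Q (edge (tree_edge k 0) 0)%:~R (edge (tree_edge k 0) 1)%:~R
      (edge (tree_edge k 0) 2)%:~R * p (tree_edge k 0) ^+ 2 +
    Q (edge (tree_edge k 1) 0)%:~R (edge (tree_edge k 1) 1)%:~R
      (edge (tree_edge k 1) 2)%:~R * p (tree_edge k 1) ^+ 2 +
    Q (edge (tree_edge k 2) 0)%:~R (edge (tree_edge k 2) 1)%:~R
      (edge (tree_edge k 2) 2)%:~R * p (tree_edge k 2) ^+ 2)).

Lemma sum_tree_moments (A := adj3 (conorm_gram p)) :
  \sum_(k < 16) p (tree_edge k 0) * p (tree_edge k 1) * p (tree_edge k 2) *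
    (bform A (tree_shift p k) (tree_shift p k) +
     \sum_(i < 3) bform A (row i (tree_mx R k)) (row i (tree_mx R k)) *
       p (tree_edge k i) ^+ 2 / 12) = tree_poly * moment_poly / 12.
Proof.
transitivity (\sum_(k < 16) term k / 12).
  apply: eq_bigr => k _; rewrite sum3E !QE !tree_shiftE !mxE /term.
  by rewrite /Q /=; field.
rewrite -mulr_suml; congr (_ / _).
rewrite !big_ord_recr big_ord0 /= add0r /term /tree_edge /=.
rewrite /shift2 !(sum6E (fun e => (tree_sign _ e * edge e _)%:~R * p e)) /tree_sign /edge /=.
rewrite !(mulr0, mul0r, mulr1, mul1r, mulrNN, mulrN1, mulN1r, rmorphN, rmorph0, rmorph1)/=.
rewrite !(mul0r, mul1r, mulN1r, add0r, addr0).
rewrite /moment_poly /tree_poly !big_ord_recr big_ord0 /= add0r /tree_edge /=.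
rewrite /Q; ring.
Qed.

End CellMoments.

(** * The quantization error of a lattice with an obtuse superbase *)

Section QuantizationError.
Variable R : realType.
Local Notation mR := (measurableTypeR R).
Local Notation T3 := (mR * mR * mR)%type.
Variable p : nat -> R.
Hypothesis p0 : forall e, 0 <= p e.
Variable B : 'M[R]_3.
Hypothesis uB : B \in unitmx.
Hypothesis gB : gram B = conorm_gram p.

Lemma tree_polyE : tree_poly p = (\det B) ^+ 2.
Proof. by rewrite -det_conorm_gram -gB gramE det_mulmx det_tr expr2. Qed.

Lemma tree_poly_gt0 : 0 < tree_poly p.
Proof. by rewrite tree_polyE exprn_even_gt0//= -unitfE -unitmxE. Qed.

Lemma dotv_ge0 n (x : 'rV[R]_n) : 0 <= dotv x x.
Proof. by rewrite /dotv; apply: sumr_ge0 => i _; rewrite -expr2 sqr_ge0. Qed.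

Lemma dotv_eq0 n (x : 'rV[R]_n) : dotv x x = 0 -> x = 0.
Proof.
move=> x0; apply/rowP => i; rewrite mxE; apply/eqP.
rewrite -sqrf_eq0 expr2; apply/eqP.
have := @psumr_eq0P _ _ xpredT (fun i => x 0 i * x 0 i) _ x0; apply => // j _.
by rewrite -expr2 sqr_ge0.
Qed.

Let C : set T3 := rowset (dual_cell (conorm_gram p)).

Let mC : measurable C. Proof. exact: measurable_dual_cell. Qed.

Let cells : set T3 := \big[setU/set0]_(k < 16) tree_cell p k.

Let cells_triv : trivIset [set: 'I_16] (fun k : 'I_16 => tree_cell p k).
Proof.
apply/trivIsetP => k l _ _ kl; apply/seteqP; split=> // q [qk ql].
by move/eqP: kl; apply; apply/val_inj; exact: (tree_cell_disjoint p0 (ltn_ord k) (ltn_ord l) qk ql).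
Qed.

Let cells_sub : cells `<=` C.
Proof.
move=> q; rewrite /cells -bigcup_seq => -[k _].
exact: tree_cell_sub.
Qed.

Let mcells : measurable cells.
Proof. by apply: bigsetU_measurable => k _; exact: measurable_tree_cell. Qed.

Let leb3_cells : leb3 R cells = (tree_poly p)%:E.
Proof.
rewrite /cells measure_bigsetU_ord//; last by move=> k; exact: measurable_tree_cell.
rewrite /tree_poly -sumEFin; apply: eq_bigr => k _.
exact: leb3_tree_cell.
Qed.

(** The disjoint parallelepipeds inside the cell give one inequality and the packing bound the
    other; hence the cell and their union agree up to a null set. *)
Let leb3_C : leb3 R C = (tree_poly p)%:E.
Proof.
apply/le_anti/andP; split; last first.
  by rewrite -leb3_cells; apply: le_measure; rewrite ?inE.
rewrite -det_conorm_gram; apply: dual_cell_packing.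
  by rewrite det_conorm_gram tree_poly_gt0.
move=> z z0; rewrite -gB gramE.
have -> : bform (B *m B^T) (intvec3 R z) (intvec3 R z) =
    dotv (intvec3 R z *m B) (intvec3 R z *m B).
  by rewrite dotvE !(bform_mulr, bform_mull) mul1mx.
rewrite lt_neqAle dotv_ge0 andbT eq_sym; apply/eqP => /dotv_eq0 zB.
have /rowP iz : intvec3 R z = 0 by rewrite -(mulmxK uB (intvec3 R z)) zB mul0mx.
move: (iz 0) (iz 1) (iz 2%:R) z0; rewrite !mxE /=; case: z {zB iz} => [[a b] c] /=.
by move=> /eqP + /eqP + /eqP; rewrite !intr_eq0 => /eqP -> /eqP -> /eqP ->; rewrite eqxx.
Qed.

Let A : 'M[R]_3 := adj3 (conorm_gram p).

Let A_ge0 x : 0 <= bform A x x.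
Proof.
have uBT : B^T \in unitmx by rewrite unitmx_tr.
have BAB : B^T *m A *m B = (tree_poly p)%:M.
  apply: (can_inj (mulKmx uB)).
  by rewrite !mulmxA -gramE gB mul_mx_adj3 det_conorm_gram mul_mx_scalar mul_scalar_mx.
rewrite -(mulmxKV uBT x); move: (x *m _) => y.
rewrite !(bform_mulr, bform_mull) trmxK mulmxA BAB.
rewrite /bform mul_mx_scalar -scalemxAl mxE mulr_ge0 ?(ltW tree_poly_gt0)//.
by have := dotv_ge0 y; rewrite dotvE /bform mulmx1.
Qed.

Let A_sym : A^T = A.
Proof.
rewrite /A adj3_tr; congr adj3; rewrite /conorm_gram linear_sum/=.
by apply: eq_bigr => e _; rewrite linearZ/= trmx_mul trmxK.
Qed.

Let integral_C : (\int[leb3 R]_(q in C) (bform A (vec3 q) (vec3 q))%:E =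
  (tree_poly p * moment_poly p / 12)%:E)%E.
Proof.
have mf : measurable_fun setT (fun q : T3 => (bform A (vec3 q) (vec3 q))%:E).
  by apply/measurable_EFinP; exact: measurable_quad.
have fC : (leb3 R C < +oo)%E by rewrite leb3_C ltry.
have CD0 : leb3 R (C `\` cells) = 0%E.
  have -> : leb3 R (C `\` cells) = (leb3 R C - leb3 R (C `&` cells))%E.
    exact: measureD.
  by rewrite (setIidr cells_sub) leb3_C leb3_cells subee.
rewrite (@ge0_negligible_integral _ _ _ (leb3 R) C (C `\` cells))//; last 3 first.
- exact: measurableD.
- exact: measurable_funTS.
- by move=> q _; rewrite lee_fin.
rewrite setDD (setIidr cells_sub) /cells -[in LHS]big_enum/=.
rewrite ge0_integral_bigsetU//=.
- rewrite big_enum /= -sum_tree_moments -sumEFin; apply: eq_bigr => k _.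
  by rewrite integral_tree_cell_quad.
- by move=> k; exact: measurable_tree_cell.
- by rewrite enum_uniq.
- exact: sub_trivIset cells_triv.
- exact: measurable_funTS.
- by move=> q _; rewrite lee_fin.
Qed.

(** With D the determinant of the Gram matrix, the volume is D^(1/2) and the moment D^(-1/2)
    [moment_poly p] / 12, so the exponent is - 5/6 - 1/2 = - 4/3. *)
Lemma quantization_error_conorm : quantization_error (zspan B) =
  moment_poly p / 36 * tree_poly p `^ (- (4 / 3)).
Proof.
have D0 := tree_poly_gt0; set D := tree_poly p in D0 *.
have d0 : 0 < `|\det B| by rewrite normr_gt0 -unitfE -unitmxE.
have dD : `|\det B| ^+ 2 = D by rewrite /D tree_polyE -normrX ger0_norm ?sqr_ge0.
have V : volume3 (voronoi (zspan B)) = `|\det B|.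
  rewrite /volume3 -/(rowset _) leb3_voronoi// gB leb3_C /= -/D -dD.
  by rewrite expr2 mulKf// gt_eqF.
have M : second_moment3 (voronoi (zspan B)) = `|\det B|^-1 * moment_poly p / 12.
  rewrite /second_moment3 /Rintegral -/(rowset _) (@integral_voronoi _ _ A D)//.
    by rewrite gB integral_C /= -/D; field; rewrite !gt_eqF.
  by rewrite gB mul_mx_adj3 det_conorm_gram.
rewrite /quantization_error V M -dD -powR_mulrn ?(ltW d0)// -powRrM.
have -> : `|\det B|^-1 = `|\det B| `^ (-1) by rewrite powR_inv1 ?(ltW d0).
have -> : `|\det B| `^ (2%:R * - (4 / 3)) =
    `|\det B| `^ (- 1 - 2 / 3) * `|\det B| `^ (-1).
  rewrite -powRD ?(gt_eqF d0) ?implybT//; congr (_ `^ _); lra.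
by field.
Qed.

End QuantizationError.

(** * Reduction of integral and positive definite forms *)

(** The Smith normal form of a single row: k is a multiple of a primitive vector, and primitive
    vectors extend to bases. *)
Lemma int_row_basis n (k : 'rV[int]_n.+1) :
  exists2 P : 'M[int]_n.+1, P \in unitmx & exists d : int, k = d *: row 0 P.
Proof.
have [L _ [P uP [s _ ->]]] := int_Smith_normal_form k.
exists P => //; exists (L 0 0 * s`_0).
rewrite -mulmxA; apply/rowP => j; rewrite !mxE big_ord1 -mulrA; congr (_ * _).
rewrite mxE (bigD1 ord0)//= big1 ?addr0; last first.
  by move=> [[|i] hi] i0 /=; rewrite ?eqxx// in i0 *; rewrite !mxE mul0r.
by rewrite !mxE.
Qed.

Definition congr_mx (K : comPzRingType) n (P G : 'M[K]_n) : 'M[K]_n :=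
  P *m G *m P^T.

Section PositiveForms.
Variable R : realType.

Definition zmx m n (P : 'M[int]_(m, n)) : 'M[R]_(m, n) := map_mx intr P.

Lemma zmxM m n q (P : 'M[int]_(m, n)) (Q : 'M[int]_(n, q)) :
  zmx (P *m Q) = zmx P *m zmx Q.
Proof. exact: map_mxM. Qed.

Lemma zmx_unit n (P : 'M[int]_n) : P \in unitmx -> zmx P \in unitmx.
Proof. by rewrite !unitmxE det_map_mx unitfE intr_eq0 => /unitrP[q [_ Pq]]; apply/eqP => P0; move: Pq; rewrite P0 mul0r. Qed.

Lemma zmx_inj m n : injective (@zmx m n).
Proof.
move=> P Q /matrixP PQ; apply/matrixP => i j; have := PQ i j.
by rewrite !mxE => /intr_inj.
Qed.

Definition posdef n (G : 'M[R]_n) : Prop :=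
  G^T = G /\ forall x, x != 0 -> 0 < bform G x x.

Lemma bform_congr n (P G : 'M[R]_n) x y :
  bform (congr_mx P G) x y = bform G (x *m P) (y *m P).
Proof. by rewrite bform_mull bform_mulr. Qed.

Lemma posdef_congr n (P G : 'M[R]_n) : P \in unitmx -> posdef G ->
  posdef (congr_mx P G).
Proof.
move=> uP [sG pG]; split; first by rewrite /congr_mx !trmx_mul trmxK sG mulmxA.
move=> x x0; rewrite bform_congr; apply: pG; apply: contra_neq x0 => xP.
by rewrite -(mulmxK uP x) xP mul0mx.
Qed.

Lemma posdef_unit n (G : 'M[R]_n) : posdef G -> G \in unitmx.
Proof.
move=> [_ pG]; rewrite -row_free_unit -kermx_eq0; apply/rowV0P => v /sub_kermxP vG.
apply/eqP/negPn/negP => v0; have := pG _ v0.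
by rewrite /bform vG mul0mx mxE ltxx.
Qed.

Lemma posdef_ge0 n (G : 'M[R]_n) x : posdef G -> 0 <= bform G x x.
Proof.
move=> [_ pG]; have [->|/pG/ltW//] := eqVneq x 0.
by rewrite /bform !mul0mx mxE.
Qed.

Lemma posdef_cauchy_schwarz n (G : 'M[R]_n) x y : posdef G ->
  bform G x y ^+ 2 <= bform G x x * bform G y y.
Proof.
move=> pG; have [y0|y0] := eqVneq y 0.
  by rewrite y0 /bform trmx0 !mulmx0 !mxE expr0n mulr0.
have gy : 0 < bform G y y by apply pG.2.
have := @posdef_ge0 _ _ (x - (bform G x y / bform G y y) *: y) pG.
rewrite !(bformDl, bformDr, bformNl, bformNr) !(bformZl, bformZr) (bformC y x pG.1).
set a := bform G x y; set b := bform G y y in gy *; set c := bform G x x.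
have -> : c + - (a / b * a) + (- (a / b * a) + - - (a / b * (a / b * b))) = c - a ^+ 2 / b.
  by field; rewrite gt_eqF.
by rewrite subr_ge0 ler_pdivrMr.
Qed.

(** Cauchy-Schwarz against the dual basis [v] bounds every coordinate of a vector by its norm, so
    only finitely many integer vectors compete. The set [A] is arbitrary because the minimum is also
    taken over an orbit of a Lorentz group. *)
Lemma form_minimum n (G : 'M[R]_n) (A : set 'rV[int]_n) : posdef G -> A !=set0 ->
  exists2 x, A x & forall y, A y -> bform G (zmx x) (zmx x) <= bform G (zmx y) (zmx y).
Proof.
move=> pG [a Aa]; have uG := posdef_unit pG.
pose v i : 'rV[R]_n := delta_mx 0 i *m invmx G.
have vE x i : bform G x (v i) = x 0 i.
  by rewrite bformC ?pG.1// /bform /v mulmxKV// -rowE mxE [in LHS]mxE.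
pose q (x : 'rV[int]_n) := bform G (zmx x) (zmx x).
have bnd i : exists N : nat, forall x : 'rV[int]_n, q x <= q a -> `|x 0 i| <= N%:R.
  have [N hN] : exists N : nat, q a * bform G (v i) (v i) <= N%:R.
    by exists (Num.truncn (q a * bform G (v i) (v i))).+1; rewrite ltW// truncnS_gt.
  exists N => x qx.
  have := posdef_cauchy_schwarz (zmx x) (v i) pG; rewrite vE mxE -/(q x) => h.
  have h2 : (x 0 i)%:~R ^+ 2 <= N%:R :> R.
    apply: le_trans h _; apply: le_trans _ hN; apply: ler_wpM2r => //.
    exact: posdef_ge0.
  have : (x 0 i) ^+ 2 <= N%:R by rewrite -(ler_int R) rmorphXn/= mulrz_nat.
  nia.
have [N hN] : exists N : nat, forall i (x : 'rV[int]_n), q x <= q a -> `|x 0 i| <= N%:R.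
  have [f hf] := choice bnd.
  exists (\max_i f i) => i x /(hf i) h; apply: le_trans h _.
  by rewrite ler_nat leq_bigmax.
pose T := {ffun 'I_n -> 'I_(N + N).+1}.
pose dec (t : T) : 'rV[int]_n := \row_i ((t i : nat)%:Z - N%:Z).
have enc x : q x <= q a -> exists t, dec t = x.
  move=> qx; exists [ffun i => inord (absz (x 0 i + N%:Z))]; apply/rowP => i.
  have := hN i x qx; rewrite mxE ffunE => h; rewrite inordK; lia.
have [ta ea] := enc a (lexx _).
pose P (t : T) := `[< A (dec t) >].
have Pa : P ta by apply/asboolP; rewrite ea.
case: (Order.TotalTheory.arg_minP (fun t => q (dec t)) Pa) => t /asboolP At tmin.
exists (dec t) => // y Ay; rewrite -/(q _) -/(q _).
have [ya|ay] := leP (q y) (q a).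
  have [u eu] := enc y ya; rewrite -eu; apply: tmin.
  by apply/asboolP; rewrite eu.
by apply: le_trans (ltW ay); rewrite -ea; exact: tmin.
Qed.

End PositiveForms.

Section Reduction.
Variable R : realType.

Lemma minimal_basis n (G : 'M[R]_n.+1) : posdef G ->
  exists2 P : 'M[int]_n.+1, P \in unitmx & forall y : 'rV[int]_n.+1, y != 0 ->
    bform G (zmx R (row 0 P)) (zmx R (row 0 P)) <= bform G (zmx R y) (zmx R y).
Proof.
move=> posG.
have [x x0 xmin] : exists2 x : 'rV[int]_n.+1, x != 0 &
    forall y, y != 0 -> bform G (zmx R x) (zmx R x) <= bform G (zmx R y) (zmx R y).
  apply: (form_minimum (A := [set y | y != 0]) posG).
  by exists (const_mx 1); apply/eqP => /rowP/(_ 0); rewrite !mxE.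
have [P uP [d xE]] := int_row_basis x; exists P => // y /xmin; apply: le_trans.
have d0 : d != 0 by apply: contra_neq x0 => d0; rewrite xE d0 scale0r.
rewrite xE /zmx map_mxZ bformZl bformZr mulrA -expr2 -rmorphXn/=.
rewrite ler_peMl ?(posdef_ge0 _ posG)//.
by rewrite ler1z; have : d ^+ 2 >= 1 by nia.
Qed.

Lemma unitmx_sqr_det n (P : 'M[int]_n) : P \in unitmx -> (\det P) ^+ 2 = 1.
Proof. by rewrite unitmxE => /orP[/eqP|/eqP] ->. Qed.

Lemma det2 (K : comPzRingType) (A : 'M[K]_2) :
  \det A = A 0 0 * A 1 1 - A 0 1 * A 1 0.
Proof.
pose a i j := A (inord i) (inord j).
have AE i j : A i j = a i j by rewrite /a !inord_val.
have -> : A = \matrix_(i, j) a i j by apply/matrixP => i j; rewrite mxE AE.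
rewrite !mxE !(expand_det_row _ ord0) !big_ord_recl !big_ord0 /cofactor !det_mx11 !mxE /=.
by rewrite /bump /= !(add0n, addn0, add1n, addn1) !expr0 !expr1; ring.
Qed.

Lemma nearest_int (a b : R) : 0 < a -> exists n : int, `|b + n%:~R * a| <= a / 2.
Proof.
move=> a0; exists (- Num.floor (b / a + 2^-1)).
have := floor_itv (b / a + 2^-1); rewrite intrD1; move: (Num.floor _) => f.
have -> : b + (- f)%:~R * a = (b / a - f%:~R) * a by rewrite rmorphN/=; field; rewrite gt_eqF.
rewrite normrM (gtr0_norm a0) => /andP[h1 h2].
have h : `|b / a - f%:~R| <= 2^-1 by rewrite ler_norml; apply/andP; split; lra.
by have := ler_wpM2r (ltW a0) h; rewrite [2^-1 * a]mulrC.
Qed.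

Definition bilin2 (a b c : R) (m n q r : int) : R :=
  a * (m * q)%:~R + b * (m * r + n * q)%:~R + c * (n * r)%:~R.

(** Gauss reduction with nonpositive inner product: the two new basis vectors and minus their sum
    form an obtuse superbase of the plane. A shortest vector comes first, the second is shifted to
    the nearest multiple and, if necessary, reversed. *)
Lemma reduce2 (a b c : R) : 0 < a -> 0 < a * c - b ^+ 2 ->
  exists m n q r : int, [/\ (m * r - n * q) ^+ 2 = 1,
    bilin2 a b c m n q r <= 0,
    0 <= bilin2 a b c m n m n + 2 * bilin2 a b c m n q r &
    bilin2 a b c m n m n <= bilin2 a b c q r q r].
Proof.
move=> a0 D0.
pose G : 'M[R]_2 := \matrix_(i, j) (if i + j == 0 then a else if i + j == 2 then c else b)%N.
have GE (x y : 'rV[int]_2) : bform G (zmx R x) (zmx R y) =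
    bilin2 a b c (x 0 0) (x 0 1) (y 0 0) (y 0 1).
  rewrite /bform !(mxE, big_ord_recl, big_ord0) /= /bilin2.
  rewrite (_ : lift ord0 ord0 = 1); last exact/val_inj.
  by ring.
have posG : posdef G.
  split.
    apply/matrixP => i j; rewrite !mxE [(j + i)%N]addnC.
    by [].
  move=> x x0; have -> : bform G x x = a * x 0 0 ^+ 2 + 2 * b * x 0 0 * x 0 1 + c * x 0 1 ^+ 2.
    rewrite /bform !(mxE, big_ord_recl, big_ord0) /=.
    rewrite (_ : lift ord0 ord0 = 1); last exact/val_inj.
    by ring.
  have : (x 0 0 != 0) || (x 0 1 != 0).
    apply: contra_neqT x0; rewrite negb_or !negbK => /andP[/eqP h0 /eqP h1].
    apply/rowP => i; rewrite mxE; case: i => [[|[|//]] hi].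
      by rewrite -h0; congr (x _ _); exact/val_inj.
    by rewrite -h1; congr (x _ _); exact/val_inj.
  move: (x 0 0) (x 0 1) => u v uv.
  rewrite -(pmulr_rgt0 _ a0).
  have -> : a * (a * u ^+ 2 + 2 * b * u * v + c * v ^+ 2) = (a * u + b * v) ^+ 2 + (a * c - b ^+ 2) * v ^+ 2 by ring.
  have [v0|v0] := eqVneq v 0.
    have u0 : u != 0 by move: uv; rewrite v0 eqxx orbF.
    rewrite v0 mulr0 addr0 expr0n mulr0 addr0 exprn_even_gt0//=.
    by apply: mulf_neq0 => //; rewrite gt_eqF.
  by rewrite ltr_wpDl ?sqr_ge0// mulr_gt0// exprn_even_gt0.
have [P uP e0min] := minimal_basis posG.
have detP := unitmx_sqr_det uP; rewrite det2 in detP.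
have minS (y0 y1 : int) : ~ (y0 = 0 /\ y1 = 0) ->
    bilin2 a b c (P 0 0) (P 0 1) (P 0 0) (P 0 1) <= bilin2 a b c y0 y1 y0 y1.
  move=> y00; have := e0min (\row_i [:: y0; y1]`_i); rewrite !GE !mxE /=; apply.
  apply/eqP => /(congr1 (fun v : 'rV[int]_2 => (v 0 0, v 0 1))).
  by rewrite !mxE /= => -[h0 h1]; apply: y00.
move: (P 0 0) (P 0 1) (P 1 0) (P 1 1) detP minS => m n k l mnkl minS {P uP e0min}.
have a0' : 0 < bilin2 a b c m n m n.
  have := posG.2 (zmx R (\row_i [:: m; n]`_i)); rewrite GE !mxE /=; apply.
  apply/eqP => /(congr1 (fun v : 'rV[R]_2 => (v 0 0, v 0 1))).
  rewrite !mxE /= => -[/eqP + /eqP +]; rewrite !intr_eq0 => /eqP h0 /eqP h1.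
  by move: mnkl; rewrite h0 h1 !mul0r subrr expr0n.
have [t ht] := nearest_int (bilin2 a b c m n k l) a0'.
have {}ht : `|bilin2 a b c m n (k + t * m) (l + t * n)| <= bilin2 a b c m n m n / 2.
  rewrite (_ : bilin2 a b c m n (k + t * m) (l + t * n) =
    bilin2 a b c m n k l + t%:~R * bilin2 a b c m n m n)// /bilin2.
  by rewrite !(rmorphD, rmorphM)/=; ring.
have {}mnkl : (m * (l + t * n) - n * (k + t * m)) ^+ 2 = 1.
  by rewrite -mnkl; congr (_ ^+ 2); ring.
move: (k + t * m) (l + t * n) ht mnkl => {k l t} q r ht mnqr.
have le_last : bilin2 a b c m n m n <= bilin2 a b c q r q r.
  by apply: minS => -[q0 r0]; move: mnqr; rewrite q0 r0 !mulr0 subrr expr0n.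
move: ht; rewrite ler_norml => /andP[h1 h2].
have [qN|qP] := leP (bilin2 a b c m n q r) 0.
  by exists m, n, q, r; split => //; lra.
have qNE : bilin2 a b c m n (- q) (- r) = - bilin2 a b c m n q r.
  by rewrite /bilin2 !(rmorphD, rmorphM, rmorphN)/=; ring.
have rNE : bilin2 a b c (- q) (- r) (- q) (- r) = bilin2 a b c q r q r.
  by rewrite /bilin2 !(rmorphD, rmorphM, rmorphN)/=; ring.
exists m, n, (- q), (- r); rewrite qNE rNE; split => //; [|lra|lra].
by rewrite -mnqr; ring.
Qed.

End Reduction.

(** * Forms bounded below by M_3, and the inequality for prisms *)

Section Families.
Variable R : realType.

Lemma tree_polyE6 (p : nat -> R) : tree_poly p =
  p 0%N * p 1%N * p 2%N + p 0%N * p 1%N * p 4%N + p 0%N * p 1%N * p 5%N + p 0%N * p 2%N * p 3%N +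
  p 0%N * p 2%N * p 5%N + p 0%N * p 3%N * p 4%N + p 0%N * p 3%N * p 5%N + p 0%N * p 4%N * p 5%N +
  p 1%N * p 2%N * p 3%N + p 1%N * p 2%N * p 4%N + p 1%N * p 3%N * p 4%N + p 1%N * p 3%N * p 5%N +
  p 1%N * p 4%N * p 5%N + p 2%N * p 3%N * p 4%N + p 2%N * p 3%N * p 5%N + p 2%N * p 4%N * p 5%N.
Proof. by rewrite -det_conorm_gram conorm_gramE det3 !mxE /=; ring. Qed.

(* 36 times the quantization error of the m.c.c. lattice. *)
Definition mcc_moment : R := 17 / 8 + Num.sqrt 2 / 2.

(** Nonnegativity of [p] says that the rows of P and minus their sum form an obtuse superbase for G.
    The property depends only on the integral class of G, so G may be replaced by any convenient
    congruent form. *)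
Definition dominates_mcc (G : 'M[R]_3) : Prop := exists2 P : 'M[int]_3, P \in unitmx &
  exists p : nat -> R, [/\ forall e, 0 <= p e,
    congr_mx (zmx R P) G = conorm_gram p, tree_poly p = 1 &
    mcc_moment <= moment_poly p].

Lemma dominates_mcc_congr (P : 'M[int]_3) (G : 'M[R]_3) : P \in unitmx ->
  dominates_mcc (congr_mx (zmx R P) G) -> dominates_mcc G.
Proof.
move=> uP [Q uQ [p [p0 e D m]]]; exists (Q *m P); first by rewrite unitmx_mul uQ.
by exists p; split => //; rewrite -e /congr_mx zmxM trmx_mul !mulmxA.
Qed.

Definition sym3 (K : Type) (a b c d e f : K) : 'M[K]_3 := mx3 a b c b d e c e f.

Lemma unitmx_det3 (P : 'M[int]_3) : \det P ^+ 2 = 1 -> P \in unitmx.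
Proof.
by rewrite unitmxE => /eqP; rewrite sqrf_eq1 => /orP[]/eqP ->.
Qed.

Lemma zmx_mx3 (a b c d e f g h i : int) : zmx R (mx3 a b c d e f g h i) =
  mx3 a%:~R b%:~R c%:~R d%:~R e%:~R f%:~R g%:~R h%:~R i%:~R.
Proof. by apply: mx3P; rewrite !mxE. Qed.

Lemma sqrt2E : (Num.sqrt 2 : R) ^+ 2 = 2. Proof. by rewrite sqr_sqrtr. Qed.

Lemma sqrt2_gt0 : 0 < (Num.sqrt 2 : R). Proof. by rewrite sqrtr_gt0. Qed.

Lemma schur (x y z : R) : 0 <= x -> 0 <= y -> 0 <= z ->
  0 <= x * (x - y) * (x - z) + y * (y - x) * (y - z) + z * (z - x) * (z - y).
Proof.
have ord (u v w : R) : 0 <= w -> w <= v -> v <= u ->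
    0 <= u * (u - v) * (u - w) + v * (v - u) * (v - w) + w * (w - u) * (w - v).
  move=> w0 wv vu.
  have -> : u * (u - v) * (u - w) + v * (v - u) * (v - w) + w * (w - u) * (w - v) =
      (u - v) ^+ 2 * (u + v - w) + w * (u - w) * (v - w) by ring.
  by rewrite addr_ge0 ?mulr_ge0 ?sqr_ge0//; lra.
move=> x0 y0 z0.
have [xy|/ltW xy] := leP x y; have [xz|/ltW xz] := leP x z; have [yz|/ltW yz] := leP y z;
  [have := ord z y x | have := ord y z x | have := ord z y x | have := ord y x z
  |have := ord z x y | have := ord y z x | have := ord x z y | have := ord x y z]; lra.
Qed.

(** Here s and t stand for x + y + z and x y z when x y + y z + z x = 1; the last hypothesis is then
    Schur's inequality. The bound is not sharp, so 17/12 may replace the square root of 2. *)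
Lemma block_moment_bound (s t : R) : 0 <= s -> 3 <= s ^+ 2 -> 0 <= t ->
  0 <= s ^+ 3 - 4 * s + 9 * t -> mcc_moment <= 1 + s + t.
Proof.
move=> s0 s3 t0 sch.
have h2 : (Num.sqrt 2 : R) <= 17 / 12.
  by move: sqrt2E sqrt2_gt0; move: (Num.sqrt 2) => r; nra.
rewrite /mcc_moment; move: (Num.sqrt 2) h2 => r h2.
have [sb|sb] := leP (19 / 10) s; first by lra.
(* 19/11 lies just below the square root of 3. Schur gives 9 (s + t) >= 13 s - s^3, and the product
   of [u1] and [u2] compares this cubic with its value at 19/11. *)
have u1 : 0 <= s - 19 / 11 by nra.
have u2 : 0 <= 13 - (s ^+ 2 + 19 / 11 * s + (19 / 11) ^+ 2) by nra.
have := mulr_ge0 u1 u2.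
rewrite (_ : _ * _ = 13 * s - s ^+ 3 - (13 * (19 / 11) - (19 / 11) ^+ 3)); last by ring.
lra.
Qed.

Lemma block_moment (x y z : R) : 0 <= x -> 0 <= y -> 0 <= z ->
  x * y + y * z + z * x = 1 -> mcc_moment <= 1 + x + y + z + x * y * z.
Proof.
move=> x0 y0 z0 q1; rewrite (_ : 1 + x + y + z + _ = 1 + (x + y + z) + x * y * z); last by ring.
apply: block_moment_bound; [by rewrite !addr_ge0 | | by rewrite !mulr_ge0 | ].
  have -> : (x + y + z) ^+ 2 =
      ((x - y) ^+ 2 + (y - z) ^+ 2 + (z - x) ^+ 2) / 2 + 3 * (x * y + y * z + z * x) by field.
  by rewrite q1 mulr1 lerDr divr_ge0// !addr_ge0// sqr_ge0.
rewrite (_ : _ + _ = x * (x - y) * (x - z) + y * (y - x) * (y - z) + z * (z - x) * (z - y)).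
  exact: schur.
rewrite [in RHS](_ : _ + _ = (x + y + z) ^+ 3
  - 4 * (x + y + z) * (x * y + y * z + z * x) + 9 * (x * y * z)); last by ring.
by rewrite q1 mulr1.
Qed.

End Families.

Section Congruence.
Variable K : comPzRingType.

Definition bilin3 (G : 'M[K]_3) (a b c d e f : K) : K :=
  G 0 0 * a * d + G 1 1 * b * e + G 2%:R 2%:R * c * f +
  G 0 1 * (a * e + b * d) + G 0 2%:R * (a * f + c * d) + G 1 2%:R * (b * f + c * e).

Lemma congr_mx3 (a b c d e f g h i : K) (G : 'M[K]_3) : G^T = G ->
  congr_mx (mx3 a b c d e f g h i) G =
  sym3 (bilin3 G a b c a b c) (bilin3 G a b c d e f) (bilin3 G a b c g h i)
    (bilin3 G d e f d e f) (bilin3 G d e f g h i) (bilin3 G g h i g h i).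
Proof.
move=> sG.
have [s01 s02 s12] : [/\ G 1 0 = G 0 1, G 2%:R 0 = G 0 2%:R & G 2%:R 1 = G 1 2%:R].
  by split; rewrite -[in LHS]sG mxE.
by rewrite /congr_mx; apply: mx3P; rewrite !mxE !sum3E !mxE !sum3E !mxE /= ?s01 ?s02 ?s12 /bilin3; ring.
Qed.

Lemma tr_sym3 (a b c d e f : K) : (sym3 a b c d e f)^T = sym3 a b c d e f.
Proof. by apply: mx3P; rewrite !mxE. Qed.

Lemma bilin3_sym3 (p q r s t u a b c d e f : K) : bilin3 (sym3 p q r s t u) a b c d e f =
  p * a * d + s * b * e + u * c * f + q * (a * e + b * d) + r * (a * f + c * d) + t * (b * f + c * e).
Proof. by rewrite /bilin3 !mxE. Qed.

Lemma sym3E (G : 'M[K]_3) : G^T = G ->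
  G = sym3 (G 0 0) (G 0 1) (G 0 2%:R) (G 1 1) (G 1 2%:R) (G 2%:R 2%:R).
Proof. by move=> sG; apply: mx3P; rewrite !mxE //= -[in LHS]sG mxE. Qed.

Lemma det_mx3 (a b c d e f g h i : K) : \det (mx3 a b c d e f g h i) =
  a * (e * i - f * h) - b * (d * i - f * g) + c * (d * h - e * g).
Proof. by rewrite det3 !mxE /=; ring. Qed.

End Congruence.

Section Block.
Variable R : realType.

Lemma dominates_mcc_mx3 (a b c d e f g h i : int) (G : 'M[R]_3) (p : nat -> R) :
  G^T = G -> (a * (e * i - f * h) - b * (d * i - f * g) + c * (d * h - e * g)) ^+ 2 = 1 ->
  (forall k, 0 <= p k) ->
  bilin3 G a%:~R b%:~R c%:~R a%:~R b%:~R c%:~R = p 0%N + p 3%N + p 4%N ->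
  bilin3 G d%:~R e%:~R f%:~R d%:~R e%:~R f%:~R = p 1%N + p 3%N + p 5%N ->
  bilin3 G g%:~R h%:~R i%:~R g%:~R h%:~R i%:~R = p 2%N + p 4%N + p 5%N ->
  bilin3 G a%:~R b%:~R c%:~R d%:~R e%:~R f%:~R = - p 3%N ->
  bilin3 G a%:~R b%:~R c%:~R g%:~R h%:~R i%:~R = - p 4%N ->
  bilin3 G d%:~R e%:~R f%:~R g%:~R h%:~R i%:~R = - p 5%N ->
  tree_poly p = 1 -> mcc_moment R <= moment_poly p -> dominates_mcc G.
Proof.
move=> sG dP p0 e00 e11 e22 e01 e02 e12 t1 m1.
exists (mx3 a b c d e f g h i); first by apply: unitmx_det3; rewrite det_mx3.
exists p; split => //.
by rewrite zmx_mx3 (congr_mx3 _ _ _ _ _ _ _ _ _ sG) e00 e11 e22 e01 e02 e12 conorm_gramE.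
Qed.

(** The cell is a right prism of height 1 over a planar Voronoi cell. The unit vector is orthogonal
    to the plane, so the parameters 4 and 5 on its edges to the reduced planar basis, up to
    numbering, contribute no new terms and the moment is 1 + x + y + z + x y z. *)
Lemma dominates_mcc_block (a b c : R) : 0 < a -> a * c - b ^+ 2 = 1 -> dominates_mcc (sym3 1 0 0 a b c).
Proof.
move=> a0 D1; have [|m [n [q [r [mnqr b'0 ab' aclt]]]]] := @reduce2 R a b c a0.
  by rewrite D1.
pose a' := bilin2 a b c m n m n; pose b' := bilin2 a b c m n q r; pose c' := bilin2 a b c q r q r.
have D' : a' * c' - b' ^+ 2 = 1.
  rewrite -D1 -[RHS]mulr1 -(rmorph1 (intr : int -> R)) -mnqr /a' /b' /c' /bilin2.
  by rewrite !(rmorphXn, rmorphD, rmorphB, rmorphM, rmorph1)/=; ring.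
have [e1 e2 e3] : [/\ a' = bilin2 a b c m n m n, b' = bilin2 a b c m n q r & c' = bilin2 a b c q r q r] by [].
rewrite -e1 -e2 -e3 in b'0 ab' aclt.
have q0 : 0 <= a' + 2 * b' by exact: ab'.
apply: (@dominates_mcc_mx3 1 0 0 0 m n 0 q r _ (fun k => nth 0 [:: 1; a' + b'; c' + b'; 0; 0; - b'] k)).
exact: tr_sym3.
by apply: etrans mnqr; ring.
by case=> [|[|[|[|[|[|k]]]]]] //=; rewrite ?nth_nil; lra.
all: rewrite ?bilin3_sym3 /=.
ring.
by rewrite [RHS](_ : _ = a') /a' /bilin2 ?(rmorphD, rmorphM)/=; ring.
by rewrite [RHS](_ : _ = c') /c' /bilin2 ?(rmorphD, rmorphM)/=; ring.
ring.
ring.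
by rewrite opprK /b' /bilin2 ?(rmorphD, rmorphM)/=; ring.
by rewrite tree_polyE6; apply: etrans D' => /=; ring.
rewrite /moment_poly tree_polyE6 /=.
have := @block_moment R (a' + b') (c' + b') (- b').
rewrite (_ : _ + _ + _ * _ = a' * c' - b' ^+ 2); last by ring.
rewrite D' => /(_ _ _ _ erefl) h; apply: le_trans (h _ _ _) _; [lra..|].
rewrite le_eqVlt; apply/orP; left; apply/eqP.
rewrite [RHS](_ : _ = (a' * c' - b' ^+ 2) * (1 + a' + c' + b') + (a' + b') * (c' + b') * - b'); last by ring.
by rewrite D'; ring.
Qed.

End Block.

(** * The moment inequality for the half-turn family *)

Section FamilyOne.
Variable R : realType.

(** The variables stand for a^2, 2 b c and (b - c)^2. The coefficient of D is nonpositive here, so D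
    must be bounded above. This region stays away from M_3, and the rational bound 11/6 suffices. *)
Lemma family1_far (w e D : R) : 0 <= e -> 0 <= w -> w + e <= 1 -> 1 <= w ^+ 2 + 2 * w ->
  0 <= D -> 4 * w * D = (1 - w - e) ^+ 2 - 8 * w * e ->
  11 / 6 <= 2 * (1 - w * e) ^+ 2 + 2 * D * (1 - 2 * w - w ^+ 2).
Proof.
move=> e0 w0 we1 k0 D0 DE.
(* 41/100 is just below the positive root, sqrt 2 - 1, of w^2 + 2 w = 1. *)
have wl : 41 / 100 <= w by nra.
have w1 : w <= 1 by lra.
(* The value of D at e = 0; for larger e the relation [DE] costs at least 2 e. *)
pose B := (1 - w) ^+ 2 / (4 * w).
have BE : 4 * w * B = (1 - w) ^+ 2 by rewrite /B; field; lra.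
have DB : D <= B - 2 * e.
  rewrite -(@ler_pM2l _ (4 * w)); last by lra.
  rewrite DE mulrBr BE.
  suff : 0 <= e * (2 * (1 - w - e) + e) by lra.
  by apply: mulr_ge0 => //; lra.
have eb : e * (1 + 7 * w) <= (1 - w) ^+ 2.
  have : 0 <= 4 * w * D by rewrite !mulr_ge0//; lra.
  have : 0 <= e * (1 - w - e) by rewrite mulr_ge0//; lra.
  rewrite DE; lra.
have h1 : 2 - 4 * (w * e) <= 2 * (1 - w * e) ^+ 2.
  by have := sqr_ge0 (w * e); lra.
have h2 : (B - 2 * e) * (1 - 2 * w - w ^+ 2) <= D * (1 - 2 * w - w ^+ 2).
  by apply: ler_wnM2r => //; lra.
suff : 4 * e * (1 - w - w ^+ 2) + 2 * B * (w ^+ 2 + 2 * w - 1) <= 1 / 6 by lra.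
have [ww|/ltW ww] := leP 1 (w + w ^+ 2).
  have h3 : e * (1 - w - w ^+ 2) <= 0 by apply: mulr_ge0_le0 => //; lra.
  suff : 2 * B * (w ^+ 2 + 2 * w - 1) <= 1 / 6 by lra.
  rewrite -(@ler_pM2l _ (2 * w)); last by lra.
  rewrite [leLHS](_ : _ = 4 * w * B * (w ^+ 2 + 2 * w - 1)); last by ring.
  rewrite BE; have wb : 6 / 10 <= w by nra.
  have u1 : (1 - w) ^+ 2 * (w ^+ 2 + 2 * w - 1) <= (1 - w) * (4 / 10) * (3 * w - 1).
    by apply: ler_pM; rewrite ?sqr_ge0//; [lra | rewrite expr2 ler_wpM2l//; lra | nra].
  apply: le_trans u1 _; have := sqr_ge0 (w - 2 / 3); lra.
have h3 : e * (1 + 7 * w) * (1 - w - w ^+ 2) <= (1 - w) ^+ 2 * (1 - w - w ^+ 2).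
  by apply: ler_wpM2r => //; lra.
rewrite -(@ler_pM2l _ (2 * w * (1 + 7 * w))); last by apply: mulr_gt0; lra.
have -> : 2 * w * (1 + 7 * w) * (4 * e * (1 - w - w ^+ 2) + 2 * B * (w ^+ 2 + 2 * w - 1)) =
  8 * w * (e * (1 + 7 * w) * (1 - w - w ^+ 2)) + (4 * w * B) * (1 + 7 * w) * (w ^+ 2 + 2 * w - 1).
  by ring.
have h4 := ler_wpM2l (_ : 0 <= 8 * w) h3.
rewrite BE; apply: le_trans (lerD (h4 _) (lexx _)) _; first by lra.
(* 62/100 is just above the positive root of w + w^2 = 1. *)
have wu : w <= 62 / 100 by nra.
move: wl wu; clear => wl wu.
have : (1 - w) ^+ 2 * (7 * w ^+ 2 + 3 * w - 1 - w ^+ 3) <= (w + 7 * w ^+ 2) / 3.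
  have P0 : 0 <= 7 * w ^+ 2 + 3 * w - 1 - w ^+ 3 by nra.
  have [h|/ltW h] := leP w (1 / 2).
    pose t := w - 41 / 100.
    have t0 : 0 <= t <= 9 / 100 by rewrite /t; lra.
    have wE : w = 41 / 100 + t by rewrite /t; ring.
    have c1 : (1 - w) ^+ 2 <= 35 / 100 - 1 * t by rewrite wE; nra.
    have c2 : 7 * w ^+ 2 + 3 * w - 1 - w ^+ 3 <= 134 / 100 + 9 * t by rewrite wE; nra.
    apply: le_trans (ler_pM (sqr_ge0 _) P0 c1 c2) _; rewrite wE; nra.
  have c1 : (1 - w) ^+ 2 <= 1 / 4 by nra.
  apply: le_trans (ler_wpM2r P0 c1) _; have : 0 <= w ^+ 3 by rewrite exprn_ge0//; lra.
  have := sqr_ge0 (w - 1 / 2); lra.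
lra.
Qed.

(** The bound is m^2 with m = (sqrt 2 - 1) / 2. If w e > m^2, then w + e > 2 m and v > sqrt 2 m, and
    the total exceeds 2 m (1 + sqrt 2) = 1. Equality at w = e = m is M_3. *)
Lemma family1_near (w e v : R) : 0 <= w -> 0 <= e -> 0 <= v -> w + e + 2 * v = 1 ->
  2 * (w * e) <= v ^+ 2 -> w * e <= (3 - 2 * Num.sqrt 2) / 4.
Proof.
move=> w0 e0 v0 we1 vq; have r2 := sqrt2E R; have r0 := sqrt2_gt0 R.
move: (Num.sqrt 2) r2 r0 => r r2 r0.
have r1 : 1 < r by nra.
pose m := (r - 1) / 2.
have m0 : 0 < m by rewrite /m; lra.
have m2 : m ^+ 2 = (3 - 2 * r) / 4.
  by rewrite /m (_ : _ ^+ 2 = (r ^+ 2 - 2 * r + 1) / 4); [rewrite r2; field | field].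
have mr : 2 * m * (1 + r) = 1 by rewrite /m (_ : _ * _ = r ^+ 2 - 1); [rewrite r2; ring|field].
rewrite -m2 leNgt; apply/negP => lt.
have h1 : 2 * m < w + e.
  rewrite -(@ltr_pXn2r _ 2) ?nnegrE; [|by []|lra|lra].
  by have := sqr_ge0 (w - e); lra.
have h2 : r * m < v.
  rewrite -(@ltr_pXn2r _ 2) ?nnegrE; [|by []|by rewrite mulr_ge0// ltW|by []].
  by rewrite exprMn r2; lra.
lra.
Qed.

Lemma family1_moment (a b c : R) : 0 <= a -> 0 <= b -> 0 <= c ->
  a ^+ 2 + 2 * a * b + 2 * a * c + 2 * b * c = 1 ->
  mcc_moment R <=
    1 + 2 * (1 - 2 * a ^+ 2 * b * c) ^+ 2 + 2 * (b - c) ^+ 2 * (1 - 2 * a ^+ 2 - a ^+ 4).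
Proof.
move=> a0 b0 c0 q1; rewrite /mcc_moment.
have w0 := sqr_ge0 a; have D0 := sqr_ge0 (b - c).
have e0 : 0 <= 2 * b * c by rewrite !mulr_ge0.
have v0 : 0 <= a * (b + c) by rewrite mulr_ge0// addr_ge0.
have a4 : a ^+ 4 = (a ^+ 2) ^+ 2 by ring.
have [k|/ltW k] := leP 1 ((a ^+ 2) ^+ 2 + 2 * a ^+ 2).
  have we1 : a ^+ 2 + 2 * b * c <= 1 by lra.
  have DE : 4 * a ^+ 2 * (b - c) ^+ 2 = (1 - a ^+ 2 - 2 * b * c) ^+ 2 - 8 * a ^+ 2 * (2 * b * c).
    by rewrite (_ : 1 - _ - _ = 2 * a * (b + c)); [ring | lra].
  have := family1_far e0 w0 we1 k D0 DE.
  rewrite a4 (_ : a ^+ 2 * (2 * b * c) = 2 * a ^+ 2 * b * c); last by ring.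
  have : (Num.sqrt 2 : R) <= 17 / 12.
    by move: (sqrt2E R) (sqrt2_gt0 R); move: (Num.sqrt 2) => r; nra.
  lra.
have h1 : 0 <= 2 * (b - c) ^+ 2 * (1 - 2 * a ^+ 2 - a ^+ 4).
  by apply: mulr_ge0; [lra | rewrite a4; lra].
have wev : a ^+ 2 + 2 * b * c + 2 * (a * (b + c)) = 1 by lra.
have vq : 2 * (a ^+ 2 * (2 * b * c)) <= (a * (b + c)) ^+ 2.
  rewrite -subr_ge0 (_ : _ - _ = (a * (b - c)) ^+ 2); [exact: sqr_ge0 | ring].
have := family1_near w0 e0 v0 wev vq.
rewrite (_ : a ^+ 2 * (2 * b * c) = 2 * a ^+ 2 * b * c); last by ring.
have r2 := sqrt2E R; have r0 := sqrt2_gt0 R.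
move: h1; set T := 2 * (b - c) ^+ 2 * _; move: T (2 * a ^+ 2 * b * c) => T Q T0.
move: (Num.sqrt 2) r2 r0 => r r2 r0 Qm.
(* With the extremal [Q] = (3 - 2 r) / 4 one has 1 - Q = (1 + 2 r) / 4, and 1 + 2 (1 - Q)^2 is
   exactly [mcc_moment]. *)
have : ((1 + 2 * r) / 4) ^+ 2 <= (1 - Q) ^+ 2.
  by rewrite ler_pXn2r ?nnegrE//; lra.
rewrite (_ : _ ^+ 2 = (1 + 4 * r + 4 * r ^+ 2) / 16); last by field.
by rewrite r2; lra.
Qed.
End FamilyOne.

(** * Half-turn forms attached to x^2 - y^2 - z^2 *)

Section Lorentz.
Variable R : realType.

Definition unimodular_form n (G : 'M[R]_n) : Prop := posdef G /\ \det G = 1.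

Lemma unimodular_congr n (P : 'M[int]_n) (G : 'M[R]_n) : P \in unitmx ->
  unimodular_form G -> unimodular_form (congr_mx (zmx R P) G).
Proof.
move=> uP [pG dG]; split; first exact: posdef_congr (zmx_unit R uP) pG.
rewrite /congr_mx !det_mulmx det_tr dG mulr1 -expr2 det_map_mx -rmorphXn.
by rewrite /= unitmx_sqr_det.
Qed.

(** G is the reflected form of (u0, -u1, -u2). Writing u0 = a + u1 + u2 with a >= 0 makes all six
    Selling parameters polynomials with nonnegative coefficients. *)
Lemma dominates_mcc_family1 (u0 u1 u2 : R) (G : 'M[R]_3) : 0 <= u1 -> 0 <= u2 -> u1 + u2 <= u0 ->
  u0 ^+ 2 - u1 ^+ 2 - u2 ^+ 2 = 1 ->
  G = sym3 (2 * u0 ^+ 2 - 1) (- 2 * u0 * u1) (- 2 * u0 * u2) (2 * u1 ^+ 2 + 1)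
    (2 * u1 * u2) (2 * u2 ^+ 2 + 1) -> dominates_mcc G.
Proof.
move=> b0 c0 a0' q1' ->; have [a uE] : exists a, u0 = a + u1 + u2.
  by exists (u0 - u1 - u2); ring.
have a0 : 0 <= a by lra.
move: u1 u2 b0 c0 uE q1' {a0'} => b c b0 c0 uE q1'.
have q1 : a ^+ 2 + 2 * a * b + 2 * a * c + 2 * b * c = 1.
  by rewrite -[RHS]q1' uE; ring.
apply: (@dominates_mcc_mx3 R 1 1 0 0 (-1) 0 0 0 1 _ (fun k => nth 0 [:: a ^+ 2; 2 * b * (a + b);
  a ^+ 2 + 2 * a * b; a ^+ 2 + 2 * a * c; 2 * c * (a + c); 2 * b * c] k)).
exact: tr_sym3.
by [].
by case=> [|[|[|[|[|[|k]]]]]] //=; rewrite ?nth_nil// ?(addr_ge0, mulr_ge0, sqr_ge0).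
1-6: rewrite bilin3_sym3 /= uE.
1-6: by move: q1 => /eqP; lra.
rewrite tree_polyE6 /= (_ : _ + _ = (a ^+ 2 + 2 * a * b + 2 * a * c + 2 * b * c) ^+ 3).
  by rewrite q1 expr1n.
ring.
have := family1_moment a0 b0 c0 q1.
(* The bound is homogenized by powers of the quadratic form whose value is 1; the equality then
   holds identically and [ring] applies. *)
rewrite (_ : moment_poly _ = (a ^+ 2 + 2 * a * b + 2 * a * c + 2 * b * c) ^+ 4
  + 2 * ((a ^+ 2 + 2 * a * b + 2 * a * c + 2 * b * c) ^+ 2 - 2 * a ^+ 2 * b * c) ^+ 2
  + 2 * (b - c) ^+ 2 * ((a ^+ 2 + 2 * a * b + 2 * a * c + 2 * b * c) ^+ 3
  - 2 * a ^+ 2 * (a ^+ 2 + 2 * a * b + 2 * a * c + 2 * b * c) ^+ 2 - 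
  a ^+ 4 * (a ^+ 2 + 2 * a * b + 2 * a * c + 2 * b * c))).
  by rewrite q1 !expr1n !mulr1.
by rewrite /moment_poly tree_polyE6 /=; ring.
Qed.

Lemma congr_mxM (K : comPzRingType) n (P Q G : 'M[K]_n) :
  congr_mx (Q *m P) G = congr_mx Q (congr_mx P G).
Proof. by rewrite /congr_mx trmx_mul !mulmxA. Qed.

(* If [w U^-1 w^T] is 1, this is - U with its values on the line spanned by the
   vector dual to w changed in sign. *)
Definition reflected_form (w : 'rV[R]_3) (U : 'M[int]_3) : 'M[R]_3 :=
  2 *: (w^T *m w) - zmx R U.

Lemma reflected_formE w U i j :
  reflected_form w U i j = 2 * (w 0 i * w 0 j) - (U i j)%:~R.
Proof. by rewrite !mxE big_ord1 !mxE. Qed.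

Lemma congr_reflected P w U : congr_mx (zmx R P) (reflected_form w U) =
  reflected_form (w *m (zmx R P)^T) (congr_mx P U).
Proof.
rewrite /congr_mx /reflected_form trmx_mul trmxK !zmxM /zmx map_trmx.
by rewrite mulmxBr mulmxBl -scalemxAr -scalemxAl !mulmxA.
Qed.

Definition signature1 : 'M[int]_3 := mx3 1 0 0 0 (-1) 0 0 0 (-1).

Lemma sign_int (x : R) : exists2 s : int, s ^+ 2 = 1 & s%:~R * x = `|x|.
Proof.
have [x0|x0] := leP 0 x; first by exists 1; rewrite ?expr1n// ger0_norm// mul1r.
by exists (-1); rewrite ?sqrrN ?expr1n// ltr0_norm// mulN1r.
Qed.

(** Among the automorphs of the Lorentz form, take one whose first row is shortest for G, which
    means that the first coordinate of the transformed w is smallest in absolute value. Comparison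
    with one reflection then gives the inequality required by the explicit superbase. *)
Lemma dominates_mcc_signature1 w : unimodular_form (reflected_form w signature1) ->
  dominates_mcc (reflected_form w signature1).
Proof.
move=> uG; have [pG _] := uG.
pose A := [set x : 'rV[int]_3 | exists2 P : 'M[int]_3, P \in unitmx /\
  congr_mx P signature1 = signature1 & row 0 P = x].
have [|x [P [uP PU] xE] xmin] := form_minimum (A := A) pG.
  exists (row 0 1%:M), 1%:M => //; split; first exact: unitmx1.
  by rewrite /congr_mx mul1mx trmx1 mulmx1.
apply: (dominates_mcc_congr uP); rewrite congr_reflected PU.
pose v := w *m (zmx R P)^T; rewrite -/v.
have GE : congr_mx (zmx R P) (reflected_form w signature1) = reflected_form v signature1.
  by rewrite congr_reflected PU.
have uG' : unimodular_form (reflected_form v signature1).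
  by rewrite -GE; exact: unimodular_congr.
have fE (y : 'rV[int]_3) : bform (reflected_form v signature1) (zmx R y) (zmx R y) =
    2 * (v 0 0 * (y 0 0)%:~R + v 0 1 * (y 0 1)%:~R + v 0 2%:R * (y 0 2%:R)%:~R) ^+ 2
    - (y 0 0 ^+ 2 - y 0 1 ^+ 2 - y 0 2%:R ^+ 2)%:~R.
  by rewrite bform_diagE !reflected_formE !mxE /=; ring.
have vmin (Q : 'M[int]_3) : Q \in unitmx -> congr_mx Q signature1 = signature1 ->
    bform (reflected_form v signature1) (zmx R (row 0 1%:M)) (zmx R (row 0 1%:M)) <=
    bform (reflected_form v signature1) (zmx R (row 0 Q)) (zmx R (row 0 Q)).
  move=> uQ QU; have := xmin (row 0 (Q *m P)).
  rewrite -GE !bform_congr -!zmxM -!row_mul mul1mx xE; apply.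
  exists (Q *m P) => //; split; first by rewrite unitmx_mul uQ.
  by rewrite congr_mxM PU QU.
have vE : v 0 0 ^+ 2 - v 0 1 ^+ 2 - v 0 2%:R ^+ 2 = 1.
  move: v {GE fE vmin} uG' => v [_].
  by rewrite det3 !reflected_formE !mxE /=; lra.
move: v {GE xmin xE A} uG' fE vmin vE => v uG' fE vmin.
have [s0 s02 e0] := sign_int (v 0 0); have [s1 s12 e1] := sign_int (v 0 1).
have [s2 s22 e2] := sign_int (v 0 2%:R).
have s012 : (s0 * (s1 * s2)) ^+ 2 = 1 by rewrite !exprMn s02 s12 s22.
have abs2 (t : R) : `|t| ^+ 2 = t ^+ 2 by rewrite real_normK// num_real.
(* Up to signs, the reflection in the root (1, 1, 1) of the Lorentz form. *)
pose Q := mx3 (3 * s0) (- 2 * s1) (- 2 * s2) (- 2 * s0) s1 (2 * s2) (- 2 * s0) (2 * s1) s2.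
have uQ : Q \in unitmx by apply: unitmx_det3; rewrite det_mx3 -[RHS]s012; ring.
have QU : congr_mx Q signature1 = signature1.
  rewrite congr_mx3; last by apply: mx3P; rewrite !mxE.
  apply: mx3P; rewrite !mxE /bilin3 !mxE /=; lia.
have /= := vmin Q uQ QU; rewrite !fE !mxE /=.
rewrite -(abs2 (v 0 0)) -(abs2 (v 0 1)) -(abs2 (v 0 2%:R)).
have -> : (3 * s0) ^+ 2 - (- 2 * s1) ^+ 2 - (- 2 * s2) ^+ 2 = 1.
  by rewrite !exprMn s02 s12 s22.
have -> : v 0 0 * (3 * s0)%:~R + v 0 1 * (- 2 * s1)%:~R + v 0 2%:R * (- 2 * s2)%:~R =
    3 * `|v 0 0| - 2 * `|v 0 1| - 2 * `|v 0 2%:R|.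
  by rewrite -e0 -e1 -e2 !rmorphM/= rmorphN/=; ring.
have -> : (1 ^+ 2 - 0 ^+ 2 - 0 ^+ 2)%:~R = 1 :> R by rewrite !expr0n !subr0 expr1n.
have -> : v 0 0 * 1%:~R + v 0 1 * 0%:~R + v 0 2%:R * 0%:~R = v 0 0 by ring.
rewrite -(abs2 (v 0 0)).
have [n0 n1 n2] := And3 (normr_ge0 (v 0 0)) (normr_ge0 (v 0 1)) (normr_ge0 (v 0 2%:R)).
move=> le_v0 vE; set u0 := `|v 0 0| in n0 e0 le_v0 vE *.
set u1 := `|v 0 1| in n1 e1 le_v0 vE *; set u2 := `|v 0 2%:R| in n2 e2 le_v0 vE *.
(* Otherwise u0 < u1 + u2 < 2 u0, the second since u1^2 + u2^2 < u0^2, and the reflected first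
   coordinate 3 u0 - 2 (u1 + u2) would be smaller in absolute value than u0. *)
have ord : u1 + u2 <= u0.
  rewrite leNgt; apply/negP => lt.
  have : u1 + u2 < 2 * u0.
    rewrite -(@ltr_pXn2r _ 2) ?nnegrE; [|by []|lra|lra].
    by have := sqr_ge0 u0; have := sqr_ge0 (u1 - u2); lra.
  nra.
have uD : mx3 s0 0 0 0 (- s1) 0 0 0 (- s2) \in unitmx.
  by apply: unitmx_det3; rewrite det_mx3 -[RHS]s012; ring.
apply: (dominates_mcc_congr uD); apply: (dominates_mcc_family1 n1 n2 ord vE).
have sqR (s : int) : s ^+ 2 = 1 -> s%:~R * s%:~R = 1 :> R.
  by move=> s1'; rewrite -rmorphM -expr2 s1'.
have [q0 q1 q2] := And3 (sqR _ s02) (sqR _ s12) (sqR _ s22).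
rewrite zmx_mx3 congr_mx3; last by case: uG' => -[].
rewrite /bilin3 !reflected_formE !mxE /= -e0 -e1 -e2 !rmorphN /=.
congr (sym3 _ _ _ _ _ _); ring: q0 q1 q2.
Qed.

End Lorentz.

(** * Hermite's bound in dimension three *)

Section SmallVector.
Variable R : realType.

Definition rv3 (K : Type) (a b c : K) : 'rV[K]_3 := \row_i nth a [:: a; b; c] i.

Lemma bform_rv3 (G : 'M[R]_3) (a b c : R) : G^T = G ->
  bform G (rv3 a b c) (rv3 a b c) = bilin3 G a b c a b c.
Proof.
move=> sG; have [s01 s02 s12] : [/\ G 1 0 = G 0 1, G 2%:R 0 = G 0 2%:R & G 2%:R 1 = G 1 2%:R].
  by split; rewrite -[in LHS]sG mxE.
by rewrite bform_diagE !mxE /= /bilin3 s01 s02 s12; ring.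
Qed.

Lemma rv3_eq0 (K : nmodType) (a b c : K) : rv3 a b c = 0 -> [/\ a = 0, b = 0 & c = 0].
Proof. by move=> /rowP e; split; [have := e 0|have := e 1|have := e 2%:R]; rewrite !mxE. Qed.

Lemma zmx_rv3 (a b c : int) : zmx R (rv3 a b c) = rv3 a%:~R b%:~R c%:~R.
Proof. by apply/rowP => -[[|[|[|//]]] h]; rewrite !mxE. Qed.

(** Hermite's induction: project along the minimal vector, of norm l. A projected vector lifts at
    the cost of at most l / 4, so its norm a' is at least 3 l / 4; the projected form has
    determinant 1 / l, and Gauss reduction gives 3 a'^2 / 4 <= 1 / l. Together l^3 <= 64/27. *)
Lemma hermite3_minimal (G : 'M[R]_3) : unimodular_form G ->
  (forall y : 'rV[int]_3, y != 0 -> G 0 0 <= bform G (zmx R y) (zmx R y)) -> G 0 0 <= 4 / 3.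
Proof.
move=> [pG dG] Gmin; have [sG posG] := pG.
have {}Gmin (t m n : int) : ~ (m = 0 /\ n = 0) ->
    G 0 0 <= bilin3 G t%:~R m%:~R n%:~R t%:~R m%:~R n%:~R.
  move=> mn0; rewrite -bform_rv3// -zmx_rv3; apply: Gmin; apply/eqP.
  by move=> /rv3_eq0[_ m0 n0]; apply: mn0.
have l0 : 0 < G 0 0.
  have := posG (rv3 1 0 0); rewrite bform_rv3// /bilin3 !(mulr0, mul0r, addr0, mulr1); apply.
  by apply/eqP => /rv3_eq0[/eqP]; rewrite oner_eq0.
have S0 : 0 < G 0 0 * G 1 1 - G 0 1 ^+ 2.
  have := posG (rv3 (- G 0 1) (G 0 0) 0); rewrite bform_rv3// /bilin3 => h.
  rewrite -(pmulr_rgt0 _ l0); apply: lt_le_trans (h _) _; last first.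
    by rewrite le_eqVlt; apply/orP; left; apply/eqP; ring.
  by apply/eqP => /rv3_eq0[_ /eqP]; rewrite gt_eqF.
have dE : G 0 0 * (G 1 1 * G 2%:R 2%:R - G 1 2%:R ^+ 2) - G 0 1 * (G 0 1 * G 2%:R 2%:R - G 1 2%:R * G 0 2%:R)
    + G 0 2%:R * (G 0 1 * G 1 2%:R - G 1 1 * G 0 2%:R) = 1.
  by rewrite -dG det3 (sym3E sG) !mxE /=; ring.
rewrite /bilin3 in Gmin.
move: (G 0 0) (G 0 1) (G 0 2%:R) (G 1 1) (G 1 2%:R) (G 2%:R 2%:R) l0 S0 dE Gmin => l x y a b c l0 S0 dE Gmin.
pose A := a - x ^+ 2 / l; pose B := b - x * y / l; pose C := c - y ^+ 2 / l.
have D : l * (A * C - B ^+ 2) = 1.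
  by rewrite -[RHS]dE /A /B /C; field; rewrite gt_eqF.
have D0 : 0 < A * C - B ^+ 2 by rewrite -(pmulr_rgt0 _ l0) D.
have A0 : 0 < A.
  by rewrite -(pmulr_rgt0 _ l0) (_ : l * A = l * a - x ^+ 2)// /A; field; rewrite gt_eqF.
have [m [n [q [r [mnqr b'0 ab' ac']]]]] := reduce2 A0 D0.
have [t ht] := nearest_int (m%:~R * x + n%:~R * y) l0.
have mn0 : ~ (m = 0 /\ n = 0) by move=> [m0 n0]; move: mnqr; rewrite m0 n0 !mul0r subrr expr0n.
have {Gmin} := Gmin t m n mn0.
have DE : l * (bilin2 A B C m n m n * bilin2 A B C q r q r - bilin2 A B C m n q r ^+ 2) = 1.
  have mnqrR : ((m * r - n * q) ^+ 2)%:~R = 1 :> R by rewrite mnqr.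
  transitivity (l * (A * C - B ^+ 2) * ((m * r - n * q) ^+ 2)%:~R); last by rewrite D mnqrR mulr1.
  by rewrite /bilin2 !(rmorphXn, rmorphD, rmorphB, rmorphM)/=; ring.
set Sx := bilin2 A B C m n m n in ab' ac' DE *.
have -> : l * t%:~R * t%:~R + a * m%:~R * m%:~R + c * n%:~R * n%:~R
  + x * (t%:~R * m%:~R + m%:~R * t%:~R) + y * (t%:~R * n%:~R + n%:~R * t%:~R)
  + b * (m%:~R * n%:~R + n%:~R * m%:~R) =
    (m%:~R * x + n%:~R * y + t%:~R * l) ^+ 2 / l + Sx.
  by rewrite /Sx /bilin2 /A /B /C !(rmorphD, rmorphM)/=; field; rewrite gt_eqF.
set u := (m%:~R * x + n%:~R * y + t%:~R * l) in ht *.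
move=> le_l; have u2 : u ^+ 2 / l <= l / 4.
  rewrite ler_pdivrMr//; move: ht; rewrite ler_norml => /andP[h1 h2]; nra.
have Sl : 3 * l / 4 <= Sx by lra.
clear le_l; move: ab' ac' DE b'0 Sl; move: Sx (bilin2 A B C m n q r) (bilin2 A B C q r q r) => a' b' c' ab' ac' DE b'0 Sl.
rewrite leNgt; apply/negP => lt.
have a1 : 1 < a' by lra.
have b2 : b' ^+ 2 <= a' ^+ 2 / 4 by nra.
have : 3 / 4 * a' ^+ 2 <= a' * c' - b' ^+ 2 by nra.
have : 1 < a' ^+ 2 by nra.
move=> a2 h; have : l * (3 / 4 * a' ^+ 2) <= 1 by rewrite -[leRHS]DE ler_pM2l.
nra.
Qed.

Lemma hermite3 (G : 'M[R]_3) : unimodular_form G ->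
  exists2 P : 'M[int]_3, P \in unitmx & congr_mx (zmx R P) G 0 0 <= 4 / 3.
Proof.
move=> uG; have [P uP Pmin] := minimal_basis uG.1; exists P => //.
have uG' := unimodular_congr uP uG; apply: hermite3_minimal => // y y0.
have -> : congr_mx (zmx R P) G 0 0 = bform G (zmx R (row 0 P)) (zmx R (row 0 P)).
  have -> : row 0 P = row 0 (1%:M : 'M[int]_3) *m P by rewrite -row_mul mul1mx.
  rewrite zmxM -bform_congr bform_diagE !mxE /=.
  by rewrite !(expr1n, expr0n, mulr0, mulr1, addr0).
rewrite bform_congr -zmxM; apply: Pmin; apply: contra_neq y0 => yP.
by rewrite -(mulmxK uP y) yP mul0mx.
Qed.

End SmallVector.

(** * Isodual forms *)

Section LorentzForms.
Variable R : realType.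

Lemma congr_zmx (P U : 'M[int]_3) : congr_mx (zmx R P) (zmx R U) = zmx R (congr_mx P U).
Proof. by rewrite /congr_mx !zmxM /zmx map_trmx. Qed.

Lemma tr_congr (K : comPzRingType) n (P U : 'M[K]_n) : U^T = U -> (congr_mx P U)^T = congr_mx P U.
Proof. by move=> sU; rewrite /congr_mx !trmx_mul trmxK sU mulmxA. Qed.

Lemma det_congr n (P U : 'M[int]_n) : P \in unitmx -> \det (congr_mx P U) = \det U.
Proof.
move=> uP; rewrite /congr_mx !det_mulmx det_tr mulrAC -expr2.
by rewrite unitmx_sqr_det// mul1r.
Qed.

(** A vector of norm 1 with integral inner products splits off orthogonally, which leaves a
    prism. *)
Lemma dominates_mcc_unit_corner (G : 'M[R]_3) (x y : int) : unimodular_form G ->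
  G 0 0 = 1 -> G 0 1 = x%:~R -> G 0 2%:R = y%:~R -> dominates_mcc G.
Proof.
move=> uG e0 e1 e2; pose P := mx3 1 0 0 (- x) 1 0 (- y) 0 1.
have uP : P \in unitmx by apply: unitmx_det3; rewrite det_mx3; ring.
apply: (dominates_mcc_congr uP); have := unimodular_congr uP uG.
rewrite /P zmx_mx3 (congr_mx3 _ _ _ _ _ _ _ _ _ uG.1.1) !rmorphN/=.
rewrite [X in sym3 X](_ : _ = 1); last by rewrite /bilin3 e0 e1 e2; ring.
rewrite [X in sym3 _ X](_ : _ = 0); last by rewrite /bilin3 e0 e1 e2; ring.
rewrite [X in sym3 _ _ X](_ : _ = 0); last by rewrite /bilin3 e0 e1 e2; ring.
move: (bilin3 _ _ _ _ _ _ _) (bilin3 _ _ _ _ _ _ _) (bilin3 _ _ _ _ _ _ _) => c b a [[_ pG] dG].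
apply: dominates_mcc_block; last by rewrite -dG det_mx3; ring.
have := pG (rv3 0 1 0); rewrite bform_rv3 ?tr_sym3// bilin3_sym3 => h.
rewrite [ltRHS](_ : a = 1 * 0 * 0 + a * 1 * 1 + c * 0 * 0 + 0 * (0 * 1 + 1 * 0) +
   0 * (0 * 0 + 0 * 0) + b * (1 * 0 + 0 * 1)); last by ring.
by apply: h; apply/eqP => /rv3_eq0[_ /eqP]; rewrite oner_eq0.
Qed.

Lemma dominates_mcc_integral (U : 'M[int]_3) : unimodular_form (zmx R U) -> dominates_mcc (zmx R U).
Proof.
move=> uG; have [P uP small] := hermite3 uG; apply: (dominates_mcc_congr uP).
have := unimodular_congr uP uG; move: small; rewrite congr_zmx.
move: (congr_mx P U) => {uG uP}U small uG.
apply: (dominates_mcc_unit_corner (x := U 0 1) (y := U 0 2%:R)) => //; rewrite !mxE//.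
have : 0 < bform (zmx R U) (rv3 1 0 0) (rv3 1 0 0).
  by apply: uG.1.2; apply/eqP => /rv3_eq0[/eqP]; rewrite oner_eq0.
rewrite bform_rv3 ?uG.1.1// /bilin3 !(mulr0, mul0r, addr0, mulr1).
move: small; rewrite !mxE.
move: (U 0 0) => u h; rewrite ltr0z => u0.
have -> : u = 1; last by [].
apply/eqP; rewrite eq_le; apply/andP; split; last by lia.
have : u%:~R < 2%:~R :> R by apply: le_lt_trans h _; lra.
rewrite ltr_int; lia.
Qed.

(** Quantifying over all w makes this a property of the integral class of U alone, so U can be
    normalized without following w. *)
Definition lorentz_dominates (U : 'M[int]_3) : Prop := forall w : 'rV[R]_3,
  unimodular_form (reflected_form w U) -> dominates_mcc (reflected_form w U).

Lemma lorentz_dominates_congr (P U : 'M[int]_3) : P \in unitmx ->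
  lorentz_dominates (congr_mx P U) -> lorentz_dominates U.
Proof.
move=> uP gU w uG; apply: (dominates_mcc_congr uP); rewrite congr_reflected; apply: gU.
by rewrite -congr_reflected; exact: unimodular_congr.
Qed.

Lemma lorentz_dominates_mx3 (a b c d e f g h i : int) (U V : 'M[int]_3) : U^T = U ->
  (a * (e * i - f * h) - b * (d * i - f * g) + c * (d * h - e * g)) ^+ 2 = 1 ->
  sym3 (bilin3 U a b c a b c) (bilin3 U a b c d e f) (bilin3 U a b c g h i)
    (bilin3 U d e f d e f) (bilin3 U d e f g h i) (bilin3 U g h i g h i) = V ->
  lorentz_dominates V -> lorentz_dominates U.
Proof.
move=> sU dP e' gV; apply: (@lorentz_dominates_congr (mx3 a b c d e f g h i)).
  by apply: unitmx_det3; rewrite det_mx3.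
by rewrite congr_mx3// e'.
Qed.

Lemma lorentz_dominates_signature1 : lorentz_dominates signature1.
Proof. exact: dominates_mcc_signature1. Qed.

(** A shear along the isotropic vector reduces a to 0 or 1. The matrices given then list orthogonal
    vectors of norms 1, -1, -1. *)
Lemma lorentz_dominates_hyperbolic (a : int) : lorentz_dominates (sym3 0 1 0 a 0 (-1)).
Proof.
have [t aE] : exists t : int, a = 2 * t \/ a = 2 * t + 1.
  by exists (a %/ 2)%Z; lia.
apply: (@lorentz_dominates_mx3 1 0 0 (- t) 1 0 0 0 1 _ (sym3 0 1 0 (a - 2 * t) 0 (-1))).
exact: tr_sym3.
by ring.
by rewrite !bilin3_sym3; congr sym3; ring.
have [{}aE|{}aE] : a - 2 * t = 0 \/ a - 2 * t = 1 by lia.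
  apply: (lorentz_dominates_mx3 (a := 1) (b := 1) (c := 1) (d := 1) (e := 0) (f := 1)
    (g := 0) (h := 1) (i := 1)) lorentz_dominates_signature1; rewrite ?tr_sym3//.
  by rewrite !bilin3_sym3 aE.
apply: (lorentz_dominates_mx3 (a := 0) (b := 1) (c := 0) (d := 1) (e := -1) (f := 0)
    (g := 0) (h := 0) (i := 1)) lorentz_dominates_signature1; rewrite ?tr_sym3//.
by rewrite !bilin3_sym3 aE.
Qed.

Lemma lorentz_dominates_isotropic0 (U : 'M[int]_3) : U^T = U -> \det U = 1 -> U 0 0 = 0 ->
  lorentz_dominates U.
Proof.
move=> sU; rewrite (sym3E sU) det_mx3 !mxE /= => + e0; rewrite e0.
move: (U 0 1) (U 0 2%:R) (U 1 1) (U 1 2%:R) (U 2%:R 2%:R) => x y a b c dU.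
(* With corner 0, the expansion of the determinant is itself a Bezout identity for x and y; it also
   says that (0, -y, x), orthogonal to the isotropic vector, has norm -1. *)
pose m := 2 * y * b - x * c; pose n := - (y * a).
have bez : m * x + n * y = 1 by rewrite -[RHS]dU /m /n; ring.
pose a' := a * m * m + c * n * n + b * (m * n + n * m).
pose b' := - (a * m * y) + c * n * x + b * (m * x - n * y).
have cE : a * y * y + c * x * x - b * (y * x + x * y) = -1 by lia.
apply: (@lorentz_dominates_mx3 1 0 0 0 m n 0 (- y) x _ (sym3 0 1 0 a' b' (-1))).
exact: tr_sym3.
by apply: etrans (_ : (m * x + n * y) ^+ 2 = 1); [ring | rewrite bez].
rewrite !bilin3_sym3; congr sym3; rewrite ?/a' ?/b'; try (by ring).
by apply: etrans bez; ring.
by apply: etrans cE; ring.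
apply: (@lorentz_dominates_mx3 1 0 0 0 1 b' 0 0 1 _ (sym3 0 1 0 (a' + b' ^+ 2) 0 (-1))).
exact: tr_sym3.
by ring.
by rewrite !bilin3_sym3; congr sym3; ring.
exact: lorentz_dominates_hyperbolic.
Qed.

End LorentzForms.

(** * Normalization of Lorentz forms by their corner entry *)

Section LorentzMain.
Variable R : realType.

Lemma congr_corner (K : comPzRingType) (U : 'M[K]_3) (P : 'M[K]_3) : U^T = U ->
  congr_mx P U 0 0 = bilin3 U (P 0 0) (P 0 1) (P 0 2%:R) (P 0 0) (P 0 1) (P 0 2%:R).
Proof.
move=> sU.
have -> : P = mx3 (P 0 0) (P 0 1) (P 0 2%:R) (P 1 0) (P 1 1) (P 1 2%:R)
    (P 2%:R 0) (P 2%:R 1) (P 2%:R 2%:R) by apply: mx3P; rewrite !mxE.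
by rewrite congr_mx3// !mxE.
Qed.

Lemma lorentz_dominates_isotropic (U : 'M[int]_3) (x y z : int) : U^T = U -> \det U = 1 ->
  ~ [/\ x = 0, y = 0 & z = 0] -> bilin3 U x y z x y z = 0 -> @lorentz_dominates R U.
Proof.
move=> sU dU xyz iso; have [P uP [d kE]] := int_row_basis (rv3 x y z).
apply: (lorentz_dominates_congr uP); apply: lorentz_dominates_isotropic0.
- exact: tr_congr.
- by rewrite det_congr.
rewrite congr_corner//.
have [e0 e1 e2] : [/\ x = d * P 0 0, y = d * P 0 1 & z = d * P 0 2%:R].
  by split; [have /rowP/(_ 0) := kE | have /rowP/(_ 1) := kE | have /rowP/(_ 2%:R) := kE]; rewrite !mxE.
have d0 : d != 0 by apply/eqP => d0; apply: xyz; rewrite e0 e1 e2 d0 !mul0r.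
apply/eqP; rewrite -(mulrI_eq0 _ (mulfI (mulf_neq0 d0 d0))); apply/eqP.
by rewrite -iso e0 e1 e2 /bilin3; ring.
Qed.

(** The vector of norm -1 splits off. Its complement has determinant -1 and hence the isotropic
    vector (1 - q, p), or (1, 0) when that one is zero. *)
Lemma lorentz_dominates_cornerN1 (U : 'M[int]_3) : U^T = U -> \det U = 1 -> U 0 0 = -1 ->
  @lorentz_dominates R U.
Proof.
move=> sU dU e0; move: dU; rewrite (sym3E sU) e0 det_mx3.
move: (U 0 1) (U 0 2%:R) (U 1 1) (U 1 2%:R) (U 2%:R 2%:R) => x y a b c dU.
apply: (@lorentz_dominates_mx3 R 1 0 0 x 1 0 y 0 1 _ (sym3 (-1) 0 0 (a + x ^+ 2) (b + x * y) (c + y ^+ 2))).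
exact: tr_sym3.
by ring.
by rewrite !bilin3_sym3; congr sym3; ring.
have D : (a + x ^+ 2) * (c + y ^+ 2) - (b + x * y) ^+ 2 = -1.
  apply/eqP; rewrite -eqr_opp opprK -[in eqbRHS]dU; apply/eqP; ring.
move: (a + x ^+ 2) (b + x * y) (c + y ^+ 2) D => p q s D.
have dU' : \det (sym3 (-1) 0 0 p q s) = 1 by rewrite det_mx3; lia.
have [|pq] := pselect (p = 0 /\ q = 1).
  move=> [p0 q1]; apply: (@lorentz_dominates_isotropic _ 0 1 0 (tr_sym3 _ _ _ _ _ _) dU').
    by case.
  by rewrite bilin3_sym3 p0; ring.
apply: (@lorentz_dominates_isotropic _ 0 (1 - q) p (tr_sym3 _ _ _ _ _ _) dU').
  by case=> _ q1 p0; apply: pq; split => //; lia.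
rewrite bilin3_sym3; transitivity (p * (p * s - q ^+ 2 + 1)); first by ring.
by rewrite D addNr mulr0.
Qed.

(** A reduced form satisfies 3 a'^2 / 4 <= 1, so a' = 1, and then b' = 0. *)
Lemma int_binary_form (a b c : int) : 0 < a -> a * c - b ^+ 2 = 1 ->
  exists m n q r : int, [/\ (m * r - n * q) ^+ 2 = 1,
    a * m * m + 2 * b * m * n + c * n * n = 1,
    a * m * q + b * (m * r + n * q) + c * n * r = 0 &
    a * q * q + 2 * b * q * r + c * r * r = 1].
Proof.
move=> a0 D; have [||m [n [q [r [mnqr b'0 ab' ac']]]]] := @reduce2 R a%:~R b%:~R c%:~R.
- by rewrite ltr0z.
- by rewrite -rmorphM -rmorphXn -rmorphB/= D ltr01.
exists m, n, q, r.
have E (k l u v : int) : bilin2 a%:~R b%:~R c%:~R k l u v =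
    (a * k * u + b * (k * v + l * u) + c * l * v)%:~R :> R.
  by rewrite /bilin2 !(rmorphD, rmorphM)/=; ring.
rewrite !E in b'0 ab' ac'; rewrite lerz0 in b'0; rewrite ler_int in ac'.
have {}ab' : 0 <= a * m * m + b * (m * n + n * m) + c * n * n +
    2 * (a * m * q + b * (m * r + n * q) + c * n * r).
  by rewrite -(ler0z R) rmorphD/= rmorphM.
move: b'0 ab' ac'.
have D' : (a * m * m + b * (m * n + n * m) + c * n * n) * (a * q * q + b * (q * r + r * q) + c * r * r)
    - (a * m * q + b * (m * r + n * q) + c * n * r) ^+ 2 = 1.
  by transitivity ((a * c - b ^+ 2) * (m * r - n * q) ^+ 2); [ring | rewrite D mnqr].
rewrite (_ : a * m * m + 2 * b * m * n + c * n * n = a * m * m + b * (m * n + n * m) + c * n * n); last by ring.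
rewrite (_ : a * q * q + 2 * b * q * r + c * r * r = a * q * q + b * (q * r + r * q) + c * r * r); last by ring.
move: D'; set a' := a * m * m + _ + _; set b' := a * m * q + _ + _; set c' := a * q * q + _ + _.
move: a' b' c' => a' b' c' D' b'0 ab' ac'.
have a1 : a' = 1 by nia.
have b1 : b' = 0 by nia.
by split => //; move: D'; rewrite a1 b1; lia.
Qed.

(** The complement of the vector of norm 1 has determinant 1, so it is definite. It must be
    negative: on a vector of the complement that w annihilates, the positive form G is minus U.
    Hence U is equivalent to [signature1]. *)
Lemma lorentz_dominates_corner1 (U : 'M[int]_3) : U^T = U -> \det U = 1 -> U 0 0 = 1 ->
  @lorentz_dominates R U.
Proof.
move=> sU dU e0; move: dU; rewrite (sym3E sU) e0 det_mx3.
move: (U 0 1) (U 0 2%:R) (U 1 1) (U 1 2%:R) (U 2%:R 2%:R) => x y a b c dU.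
apply: (@lorentz_dominates_mx3 R 1 0 0 (- x) 1 0 (- y) 0 1 _ (sym3 1 0 0 (a - x ^+ 2) (b - x * y) (c - y ^+ 2))).
exact: tr_sym3.
by ring.
by rewrite !bilin3_sym3; congr sym3; ring.
have D : (a - x ^+ 2) * (c - y ^+ 2) - (b - x * y) ^+ 2 = 1.
  by apply: etrans dU; ring.
move: (a - x ^+ 2) (b - x * y) (c - y ^+ 2) D => p q s D w uG.
have p0 : p < 0.
  rewrite ltNge; apply/negP => p0.
  have {}p0 : 0 < p.
    rewrite lt0r p0 andbT; apply: contra_eq_neq D => ->; rewrite mul0r sub0r.
    by have := sqr_ge0 q; lia.
  have pos (t u : R) : ~ (t = 0 /\ u = 0) -> 0 < 2 * (w 0 1 * t + w 0 2%:R * u) ^+ 2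
      - (p%:~R * t ^+ 2 + 2 * q%:~R * t * u + s%:~R * u ^+ 2).
    move=> tu; have := uG.1.2 (rv3 0 t u); rewrite bform_rv3 ?uG.1.1// => h.
    rewrite [ltRHS](_ : _ = bilin3 (reflected_form w (sym3 1 0 0 p q s)) 0 t u 0 t u).
      by apply: h; apply/eqP => /rv3_eq0[_ t0 u0]; apply: tu.
    by rewrite /bilin3 !reflected_formE !mxE /=; ring.
  have [w0|w0] := pselect (w 0 2%:R = 0 /\ w 0 1 = 0).
    have := pos 1 0; rewrite w0.1 w0.2 => /(_ _)/wrap[]; first by case=> /eqP; rewrite oner_eq0.
    have : 0 < p%:~R :> R by rewrite ltr0z.
    lra.
  have := pos (w 0 2%:R) (- w 0 1) => /(_ _)/wrap[]; first by case=> h1 /eqP; rewrite oppr_eq0 => /eqP h2; apply: w0.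
  move: (w 0 1) (w 0 2%:R) => t u.
  rewrite (_ : t * u + u * - t = 0); last by ring.
  have pR : 0 < p%:~R :> R by rewrite ltr0z.
  have DR : p%:~R * s%:~R - q%:~R ^+ 2 = 1 :> R by rewrite -rmorphM -rmorphXn -rmorphB/= D.
  move: (p%:~R) (q%:~R) (s%:~R) pR DR => p' q' s' pR DR h.
  have : 0 <= p' * (p' * u ^+ 2 - 2 * q' * u * t + s' * t ^+ 2).
    rewrite (_ : _ * _ = (p' * u - q' * t) ^+ 2 + (p' * s' - q' ^+ 2) * t ^+ 2); last by ring.
    by rewrite DR mul1r addr_ge0 ?sqr_ge0.
  by rewrite pmulr_rge0//; lra.
have [||m [n [k [r [d1 h1 h2 h3]]]]] := @int_binary_form (- p) (- q) (- s).
- by lia.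
- by rewrite -D; ring.
apply: (@lorentz_dominates_mx3 R 1 0 0 0 m n 0 k r _ signature1) uG.
- exact: tr_sym3.
- by apply: etrans d1; ring.
- by rewrite !bilin3_sym3 (_ : signature1 = sym3 1 0 0 (-1) 0 (-1))//; congr sym3; lia.
exact: lorentz_dominates_signature1.
Qed.

End LorentzMain.

Section Symmetric.
Variable R : realType.

Lemma adj3_mul_mx (K : comPzRingType) (A : 'M[K]_3) : adj3 A *m A = (\det A)%:M.
Proof.
have := congr1 trmx (mul_mx_adj3 A^T).
by rewrite trmx_mul adj3_tr trmxK det_tr tr_scalar_mx.
Qed.

Lemma det_reflected (w : 'rV[R]_3) (U : 'M[int]_3) : \det (reflected_form w U) =
  2 * (w *m adj3 (zmx R U) *m w^T) 0 0 - (\det U)%:~R.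
Proof.
rewrite !det3 !reflected_formE !(mxE, sum3E) /=.
by rewrite !(rmorphD, rmorphM, rmorphB)/=; ring.
Qed.

(** For v = w U^-1 the determinant of the reflected form G gives v w^T = 1, whence v G = w and v has
    norm 1; apply Cauchy-Schwarz to v and the first basis vector. *)
Lemma reflected_corner_ge (w : 'rV[R]_3) (U : 'M[int]_3) : \det U = 1 ->
  unimodular_form (reflected_form w U) -> w 0 0 ^+ 2 <= reflected_form w U 0 0.
Proof.
move=> dU [pG dG]; set v := w *m adj3 (zmx R U).
have vw : v *m w^T = 1%:M.
  have := dG; rewrite det_reflected dU -/v rmorph1 => h.
  apply/rowP => i; rewrite [i]ord1 [RHS]mxE eqxx mulr1n.
  by move: h; move: ((v *m w^T) 0 0) => t h; lra.
have vG : v *m reflected_form w U = w.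
  rewrite mulmxBr -scalemxAr mulmxA vw mul1mx /v -mulmxA adj3_mul_mx.
  have -> : \det (zmx R U) = 1 by rewrite det_map_mx dU rmorph1.
  by rewrite mulmx1 mulr2n scalerDl scale1r addrK.
have := posdef_cauchy_schwarz v (rv3 1 0 0) pG.
rewrite {2}/bform vG -[w *m v^T]trmxK trmx_mul trmxK vw trmx1 mxE eqxx mul1r.
rewrite bform_rv3 ?pG.1// /bilin3 !(mulr0, mul0r, addr0, mulr1) {1}/bform vG.
by rewrite !(mxE, sum3E) /= !(mulr0, addr0, mulr1).
Qed.

(** In a basis with G_00 <= 4/3, the corner of U is 2 w_0^2 - G_00 with 0 <= w_0^2 <= G_00, an
    integer of absolute value at most 4/3. *)
Lemma lorentz_dominates_det1 (U : 'M[int]_3) : U^T = U -> \det U = 1 -> @lorentz_dominates R U.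
Proof.
move=> sU dU w uG; have [P uP] := hermite3 uG.
have := unimodular_congr uP uG; rewrite congr_reflected => uG' small.
apply: (dominates_mcc_congr uP); rewrite congr_reflected.
have sU' := tr_congr P sU; have dU' : \det (congr_mx P U) = 1 by rewrite det_congr.
have := reflected_corner_ge dU' uG'.
move: (congr_mx P U) sU' dU' (w *m _) uG' small => {sU dU uG uP}U sU dU {}w uG small.
have := small; rewrite reflected_formE -expr2 => h1 h2.
have h3 := sqr_ge0 (w 0 0).
have l1 : (-2)%:~R < (U 0 0)%:~R :> R by rewrite rmorphN/=; lra.
have l2 : (U 0 0)%:~R < 2%:~R :> R by lra.
rewrite !ltr_int in l1 l2.
have [e0|[e0|e0]] : U 0 0 = 0 \/ U 0 0 = 1 \/ U 0 0 = -1 by lia.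
- exact: (lorentz_dominates_isotropic0 sU dU e0).
- exact: (lorentz_dominates_corner1 sU dU e0).
- exact: (lorentz_dominates_cornerN1 sU dU e0).
Qed.

End Symmetric.

(** * Isodualities with a symmetric matrix *)

Section SymmetricIsoduality.
Variable R : realType.

(** The Cayley-Hamilton expression of the adjugate, doubled to avoid division. *)
Lemma adj3_cayley (K : comPzRingType) (A : 'M[K]_3) : 2 *: adj3 A =
  2 *: (A *m A) - (2 * \tr A) *: A + (\tr A ^+ 2 - \tr (A *m A))%:M.
Proof. by apply: mx3P; rewrite /mxtrace !(mxE, sum3E) /= ?mulr1n ?mulr0n; ring. Qed.

Lemma adj3M (K : comPzRingType) (A B : 'M[K]_3) : adj3 (A *m B) = adj3 B *m adj3 A.
Proof. by apply: mx3P; rewrite !(mxE, sum3E) /=; ring. Qed.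

Lemma psd_rank1 (W : 'M[R]_3) : W^T = W -> adj3 W = 0 -> (forall i, 0 <= W i i) ->
  exists w : 'rV[R]_3, W = 2 *: (w^T *m w).
Proof.
move=> sW aW W0.
have minor i j k : W i j * W i k = W i i * W j k.
  have s a b : W a b = W b a by rewrite -[in LHS]sW mxE.
  have e a b : adj3 W a b = 0 by rewrite aW mxE.
  have := e 0 0; have := e 0 1; have := e 0 2%:R; have := e 1 1; have := e 1 2%:R; have := e 2%:R 2%:R.
  rewrite !mxE /= !(s 1 0) !(s 2%:R 0) !(s 2%:R 1).
  have o x : [\/ x = 0 :> 'I_3, x = 1 | x = 2%:R].
    by case: x => [[|[|[|//]]] h]; [apply: Or31|apply: Or32|apply: Or33]; exact/val_inj.
  have [->|->|->] := o i; have [->|->|->] := o j; have [->|->|->] := o k;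
    rewrite ?(s 1 0) ?(s 2%:R 0) ?(s 2%:R 1); lra.
have [Z|] := pselect (forall i, W i i = 0).
  exists 0; rewrite mulmx0 scaler0; apply/matrixP => i j; rewrite mxE.
  by apply/eqP; rewrite -sqrf_eq0 expr2 minor Z mul0r.
move=> /existsNP[i /eqP Wi].
have Wi0 : 0 < W i i by rewrite lt0r Wi W0.
exists ((Num.sqrt (2 * W i i))^-1 *: row i W); apply/matrixP => j k.
rewrite !mxE big_ord1 !mxE.
have q : Num.sqrt (2 * W i i) ^+ 2 = 2 * W i i by rewrite sqr_sqrtr// mulr_ge0// ltW.
have q0 : Num.sqrt (2 * W i i) != 0 by rewrite gt_eqF// sqrtr_gt0 mulr_gt0.
move: (Num.sqrt _) q q0 => t q q0.
rewrite (_ : 2 * _ = 2 * (W i j * W i k) / t ^+ 2); last by field.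
by rewrite minor q; field; rewrite gt_eqF.
Qed.

(** Since det G = 1, [adj3 G] is the inverse of G. *)
Definition isodual_form (G : 'M[R]_3) (U : 'M[int]_3) : Prop :=
  [/\ unimodular_form G, \det U = 1 & zmx R U *m adj3 G *m (zmx R U)^T = G].

Lemma isodual_form_congr (P U : 'M[int]_3) G : P \in unitmx -> isodual_form G U ->
  isodual_form (congr_mx (zmx R P) G) (congr_mx P U).
Proof.
move=> uP [uG dU GU]; split; [exact: unimodular_congr | by rewrite det_congr |].
have dP : zmx R P *m adj3 (zmx R P) = (\det P)%:~R%:M by rewrite mul_mx_adj3 det_map_mx.
have dP2 : (\det P)%:~R ^+ 2 = 1 :> R by rewrite -rmorphXn/= unitmx_sqr_det.
rewrite -congr_zmx /congr_mx !adj3M -adj3_tr !trmx_mul !trmxK.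
have dPt : (zmx R P)^T *m (adj3 (zmx R P))^T = (\det P)%:~R%:M.
  rewrite adj3_tr mul_mx_adj3 det_tr det_map_mx//.
have dPt2 : adj3 (zmx R P) *m zmx R P = (\det P)%:~R%:M by rewrite adj3_mul_mx det_map_mx.
rewrite !mulmxA -[_ *m zmx R U *m (zmx R P)^T *m (adj3 (zmx R P))^T]mulmxA dPt.
rewrite -[_ *m adj3 (zmx R P) *m zmx R P]mulmxA dPt2.
rewrite !mul_mx_scalar -!scalemxAl scalerA -expr2 dP2 scale1r.
by rewrite -{2}GU !mulmxA.
Qed.

(* [S] below is an involution of determinant 1: the identity or a half-turn. *)
Lemma isodual_symmetric G U : isodual_form G U -> U^T = U -> dominates_mcc G.
Proof.
move=> [uG dU GU] sU; have [[sG pG] dG] := uG.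
set V := zmx R U in GU; have sV : V^T = V by rewrite /V /zmx map_trmx sU.
have dV : \det V = 1 by rewrite det_map_mx dU rmorph1.
rewrite sV in GU; pose S := V *m adj3 G.
have GaG : G *m adj3 G = 1%:M by rewrite mul_mx_adj3 dG.
have aGG : adj3 G *m G = 1%:M by rewrite adj3_mul_mx dG.
have SS : S *m S = 1%:M by rewrite /S mulmxA GU GaG.
have SG : S *m G = V by rewrite /S -mulmxA aGG mulmx1.
have dS : \det S = 1.
  have : \det (S *m G) = 1 by rewrite SG dV.
  by rewrite det_mulmx dG mulr1.
have aS : adj3 S = S.
  by rewrite -[LHS]mul1mx -SS -mulmxA mul_mx_adj3 dS mulmx1.
have := adj3_cayley S; rewrite aS SS mxtrace1; set t := \tr S => cS.
(* The identity [cS] amounts to 2 (1 + t) S = (t^2 - 1) I: either S is scalar, hence the identity,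
   or its trace is -1 and it is a half-turn. *)
have [t1|t1] := eqVneq (1 + t) 0; last first.
  have SE : S = ((t - 1) / 2)%:M.
    apply: (scalerI t1); apply: (scalerI (_ : (2 : R) != 0)) => //.
    apply/matrixP => i j; have /matrixP/(_ i j) := cS; rewrite !mxE => h.
    case: (i == j) h => h; rewrite ?mulr1n ?mulr0n in h *; lra.
  move: SG dS; rewrite SE mul_scalar_mx det_scalar; move: (_ / 2) => s SG s3.
  have s1 : s = 1.
    apply/eqP; rewrite -subr_eq0 -(mulrI_eq0 _ (mulfI (_ : s ^+ 2 + s + 1 != 0))); last first.
      by rewrite gt_eqF//; have := sqr_ge0 (s + 1 / 2); lra.
    rewrite [eqbLHS](_ : _ = s ^+ 3 - 1); last by ring.
    by rewrite s3 subrr.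
  rewrite s1 scale1r in SG; rewrite SG; apply: dominates_mcc_integral.
  by rewrite -/V -SG.
(* Twice the projection onto the axis of the half-turn. It has rank one, and therefore so has A G =
   G + V. *)
pose A := 1%:M + S.
have AA : A *m A = 2 *: A.
  rewrite /A mulmxDl mul1mx mulmxDr mulmx1 SS [S + _]addrC -mulr2n.
  by rewrite -scaler_nat.
have trA : \tr A = 2 by rewrite /A mxtraceD mxtrace1 -/t; lra.
have aA : adj3 A = 0.
  apply: (scalerI (_ : (2 : R) != 0)) => //; rewrite scaler0 adj3_cayley AA mxtraceZ trA.
  by rewrite scalerA subrr add0r (_ : 2 ^+ 2 - 2 * 2 = 0 :> R) ?raddf0//; rewrite expr2 subrr.
pose W := A *m G.
have WE : W = G + V by rewrite /W /A mulmxDl mul1mx SG.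
have sW : W^T = W by rewrite WE linearD/= sG sV.
have WW : 2 *: W = W *m adj3 G *m W^T.
  by rewrite sW /W -[A *m G *m adj3 G]mulmxA GaG mulmx1 mulmxA AA scalemxAl.
have [w wE] : exists w : 'rV[R]_3, W = 2 *: (w^T *m w).
  apply: psd_rank1 => //; first by rewrite /W adj3M aA mulmx0.
  move=> i; rewrite -(@pmulr_rge0 _ 2)//.
  have -> : 2 * W i i = bform G (row i W *m adj3 G) (row i W *m adj3 G).
    have /matrixP/(_ i i) := WW; rewrite mxE => ->.
    rewrite /bform [(row i W *m _)^T]trmx_mul adj3_tr sG -[_ *m G]mulmxA aGG mulmx1 mulmxA.
    by rewrite -row_mul !mxE; apply: eq_bigr => j _; rewrite !mxE.
  exact: posdef_ge0.
have -> : G = reflected_form w U by rewrite /reflected_form -wE WE addrK.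
apply: lorentz_dominates_det1 => //.
by rewrite /reflected_form -wE WE addrK.
Qed.

End SymmetricIsoduality.

(** * Isodualities with a matrix that is not symmetric *)

Section SkewIsoduality.
Variable R : realType.

(* The rotation U G^-1 has axis e_0, and [k] is the cosine of its angle. *)
Lemma skew_block (al x y be ga ga' de : int) (g11 g12 g22 : R) :
  let G := sym3 al%:~R x%:~R y%:~R g11 g12 g22 in
  isodual_form G (mx3 al x y x be ga y ga' de) ->
  exists k : R, [/\ 0 < al, 4 * k ^+ 2 + al%:~R * (ga - ga')%:~R ^+ 2 = 4,
    (al * be - x ^+ 2)%:~R = k * (al%:~R * g11 - x%:~R ^+ 2),
    (al * (ga + ga') - 2 * x * y)%:~R = 2 * k * (al%:~R * g12 - x%:~R * y%:~R) &
    (al * de - y ^+ 2)%:~R = k * (al%:~R * g22 - y%:~R ^+ 2)].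
Proof.
move=> G [[[sG pG] dG] dU GU].
have al0 : 0 < al.
  have := pG (rv3 1 0 0); rewrite bform_rv3// bilin3_sym3 !(mulr0, mul0r, addr0, mulr1) ltr0z; apply.
  by apply/eqP => /rv3_eq0[/eqP]; rewrite oner_eq0.
have alR : 0 < al%:~R :> R by rewrite ltr0z.
have a0 : 0 < al%:~R * g11 - x%:~R ^+ 2.
  have := pG (rv3 (- x%:~R) al%:~R 0); rewrite bform_rv3// bilin3_sym3 => h.
  rewrite -(pmulr_rgt0 _ alR); apply: lt_le_trans (h _) _; last first.
    by rewrite le_eqVlt; apply/orP; left; apply/eqP; ring.
  by apply/eqP => /rv3_eq0[_ /eqP]; rewrite gt_eqF.
move: GU dU; set U := mx3 _ _ _ _ _ _ _ _ _ => GU dU.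
have e : adj3 G *m (zmx R U)^T = adj3 (zmx R U) *m G.
  by rewrite -[G in RHS]GU !mulmxA adj3_mul_mx det_map_mx dU rmorph1 mul1mx.
have dUR : \det (zmx R U) = 1 by rewrite det_map_mx dU rmorph1.
move: e dUR; rewrite /U zmx_mx3 det_mx3 => e dUR.
have e1 := congr1 (fun A : 'M[R]_3 => A 1 1) e.
have e2 := congr1 (fun A : 'M[R]_3 => A 1 2%:R) e.
have e3 := congr1 (fun A : 'M[R]_3 => A 2%:R 1) e.
rewrite !mxE !sum3E !mxE /= in e1.
rewrite !mxE !sum3E !mxE /= in e2.
rewrite !mxE !sum3E !mxE /= in e3.
rewrite /G det_mx3 in dG; move: dG e3 e2 e1.
rewrite !(rmorphB, rmorphD, rmorphM, rmorphXn)/=.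
move: (al%:~R) (x%:~R) (y%:~R) (be%:~R) (ga%:~R) (ga'%:~R) (de%:~R) alR a0 dUR =>
  A X Y B C C' D A0 a0 dUR dG e3 e2 e1.
pose a := A * g11 - X ^+ 2; pose b := A * g12 - X * Y; pose c := A * g22 - Y ^+ 2.
pose u := A * B - X ^+ 2; pose s := A * C - X * Y; pose s' := A * C' - X * Y; pose v := A * D - Y ^+ 2.
have An0 : A != 0 by rewrite gt_eqF.
have acb : a * c - b ^+ 2 = A.
  rewrite -[RHS]mulr1 -dG /a /b /c; ring.
have uvs : u * v - s * s' = A.
  rewrite -[RHS]mulr1 -dUR /u /v /s /s'; ring.
have h1 : c * u = v * a.
  by have := congr1 (fun t => A * t) e1; rewrite /a /c /u /v; lra.
have h2 : c * (s + s') = 2 * b * v.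
  by have := congr1 (fun t => A * t) e2; rewrite /b /c /s /s' /v; lra.
have h3 : a * (s + s') = 2 * b * u.
  by have := congr1 (fun t => A * t) e3; rewrite /a /b /s /s' /u; lra.
have an0 : a != 0 by rewrite gt_eqF.
pose k := u / a.
have uE : u = k * a by rewrite /k; field.
have vE : v = k * c by apply: (mulIf an0); rewrite -h1 uE; ring.
have sE : s + s' = 2 * k * b by apply: (mulfI an0); rewrite h3 uE; ring.
have dE : s - s' = A * (C - C') by rewrite /s /s'; ring.
exists k; split => //.
- apply: (mulfI An0); rewrite -[X in A * X = _](addrC).
  transitivity (4 * k ^+ 2 * (a * c - b ^+ 2) + (A * (C - C')) ^+ 2); first by rewrite acb; ring.
  rewrite -dE; transitivity (4 * (u * v) - (s + s') ^+ 2 + (s - s') ^+ 2).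
    by rewrite sE vE uE; ring.
  by rewrite -[in RHS]uvs; ring.
- by apply: etrans sE; rewrite /s /s'; ring.
Qed.

(** The Selling parameters of the given Gram matrix: the smaller value belongs to the opposite edges
    01 and 23. The default keeps the function nonnegative at every index. *)
Definition mcc_conorm (e : nat) : R :=
  nth (1 / 2) [:: (Num.sqrt 2 - 1) / 2; 1 / 2; 1 / 2; 1 / 2; 1 / 2; (Num.sqrt 2 - 1) / 2] e.

Lemma mcc_conorm_ge0 e : 0 <= mcc_conorm e.
Proof.
have h : 1 <= (Num.sqrt 2 : R)
  by have := sqrt2E R; have := sqrt2_gt0 R; move: (Num.sqrt 2) => r; nra.
by case: e => [|[|[|[|[|[|e]]]]]]; rewrite /mcc_conorm /= ?nth_nil; lra.
Qed.

Lemma tree_poly_mcc : tree_poly mcc_conorm = 1.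
Proof. by rewrite tree_polyE6 /mcc_conorm /=; have := sqrt2E R; lra. Qed.

Lemma moment_poly_mcc : moment_poly mcc_conorm = mcc_moment R.
Proof.
rewrite /moment_poly tree_poly_mcc /mcc_conorm /mcc_moment /=.
by have := sqrt2E R; move: (Num.sqrt 2) => r r2; lra.
Qed.

Lemma dominates_mcc_mcc (r : R) : r = Num.sqrt 2 / 2 ->
  dominates_mcc (sym3 2 1 1 (1 / 2 + r) (1 / 2) (1 / 2 + r)).
Proof.
move=> ->; apply: (@dominates_mcc_mx3 R 0 1 0 0 0 (-1) (-1) 0 1 _ mcc_conorm).
exact: tr_sym3.
by [].
exact: mcc_conorm_ge0.
1-6: by rewrite bilin3_sym3 /mcc_conorm /=; field.
exact: tree_poly_mcc.
by rewrite moment_poly_mcc.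
Qed.

End SkewIsoduality.

Section SkewGood.
Variable R : realType.

(** The cosine is 1/2 or -1/2. With U the isoduality matrix and r = (3, x, y), the integral matrix V
    = r^T r - U - U^T is symmetric of determinant 1. For k = -1/2 it equals G; for k = 1/2, G is a
    reflected form of V. *)
Lemma dominates_mcc_corner3 (x y be ga ga' de : int) (g11 g12 g22 k : R) :
  let G := sym3 3 x%:~R y%:~R g11 g12 g22 in
  unimodular_form G -> \det (mx3 3 x y x be ga y ga' de) = 1 -> (ga - ga') ^+ 2 = 1 ->
  4 * k ^+ 2 = 1 ->
  (3 * be - x ^+ 2)%:~R = k * (3 * g11 - x%:~R ^+ 2) ->
  (3 * (ga + ga') - 2 * x * y)%:~R = 2 * k * (3 * g12 - x%:~R * y%:~R) ->
  (3 * de - y ^+ 2)%:~R = k * (3 * g22 - y%:~R ^+ 2) -> dominates_mcc G.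
Proof.
move=> G uG dU d2 k2 h1 h2 h3.
pose V := sym3 3 x y (x ^+ 2 - 2 * be) (x * y - ga - ga') (y ^+ 2 - 2 * de).
have sV : V^T = V by exact: tr_sym3.
have dV : \det V = 1.
  transitivity (4 * \det (mx3 3 x y x be ga y ga' de) - 3 * (ga - ga') ^+ 2); last by rewrite dU d2.
  by rewrite !det_mx3; ring.
move: h1 h2 h3; rewrite !(rmorphB, rmorphD, rmorphM, rmorphXn)/= => h1 h2 h3.
have : (2 * k - 1) * (2 * k + 1) = 0 by lra.
move=> /eqP; rewrite mulf_eq0 => /orP[/eqP kE|/eqP kE].
  have {}kE : k = 1 / 2 by lra.
  pose t : R := Num.sqrt 3.
  have t2 : t ^+ 2 = 3 by rewrite sqr_sqrtr.
  have t0 : t != 0 by rewrite gt_eqF// sqrtr_gt0.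
  have GE : G = reflected_form (t^-1 *: rv3 3 x%:~R y%:~R) V.
    have E (a b : R) : 2 * (t^-1 * a * (t^-1 * b)) = 2 / 3 * a * b.
      by rewrite -t2; field.
    rewrite kE in h1 h2 h3.
    by apply: mx3P; rewrite reflected_formE !mxE /= E ?(rmorphB, rmorphD, rmorphM, rmorphXn) /=; lra.
  by rewrite GE; apply: lorentz_dominates_det1 => //; rewrite -GE.
have {}kE : k = - (1 / 2) by lra.
have GE : G = zmx R V.
  rewrite kE in h1 h2 h3.
  by apply: mx3P; rewrite !mxE /= ?(rmorphB, rmorphD, rmorphM, rmorphXn) /=; lra.
by rewrite GE; apply: dominates_mcc_integral; rewrite -GE.
Qed.

(** The cosine satisfies 2 k^2 = 1. The symmetric part of U projected along the axis is an integral
    binary form of determinant 1, hence a sum of two squares up to sign. This fixes the projection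
    of G, and parity fixes its inner products with the axis: G is the form of M_3. *)
Lemma dominates_mcc_corner2 (x y be ga ga' de : int) (g11 g12 g22 k : R) :
  let G := sym3 2 x%:~R y%:~R g11 g12 g22 in
  unimodular_form G -> \det (mx3 2 x y x be ga y ga' de) = 1 -> (ga - ga') ^+ 2 = 1 ->
  4 * k ^+ 2 = 2 ->
  (2 * be - x ^+ 2)%:~R = k * (2 * g11 - x%:~R ^+ 2) ->
  (2 * (ga + ga') - 2 * x * y)%:~R = 2 * k * (2 * g12 - x%:~R * y%:~R) ->
  (2 * de - y ^+ 2)%:~R = k * (2 * g22 - y%:~R ^+ 2) -> dominates_mcc G.
Proof.
move=> G uG dU d2 k2 h1 h2 h3.
have a0 : 0 < 2 * g11 - x%:~R ^+ 2.
  have := uG.1.2 (rv3 (- x%:~R) 2 0); rewrite bform_rv3 ?uG.1.1// bilin3_sym3 => h.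
  rewrite -(@pmulr_rgt0 _ 2)//; apply: lt_le_trans (h _) _; last first.
    by rewrite le_eqVlt; apply/orP; left; apply/eqP; ring.
  by apply/eqP => /rv3_eq0[_ /eqP]; rewrite pnatr_eq0.
pose p := 2 * be - x ^+ 2; pose q := ga + ga' - x * y; pose r := 2 * de - y ^+ 2.
have D : p * r - q ^+ 2 = 1.
  transitivity (2 * \det (mx3 2 x y x be ga y ga' de) - (ga - ga') ^+ 2); last by rewrite dU d2.
  by rewrite det_mx3 /p /q /r; ring.
have kk : 2 * k * k = 1 by lra.
have pE : 2 * g11 - x%:~R ^+ 2 = 2 * k * p%:~R by rewrite /p h1 mulrA kk mul1r.
have qE : 2 * g12 - x%:~R * y%:~R = 2 * k * q%:~R.
  have : (2 * q)%:~R = 2 * k * (2 * g12 - x%:~R * y%:~R).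
    by rewrite -h2 /q; congr (_%:~R); ring.
  rewrite rmorphM/= => h; have -> : q%:~R = k * (2 * g12 - x%:~R * y%:~R) by lra.
  by rewrite mulrA kk mul1r.
have rE : 2 * g22 - y%:~R ^+ 2 = 2 * k * r%:~R by rewrite /r h3 mulrA kk mul1r.
have p0 : p != 0 by apply/eqP => p0; move: a0; rewrite pE p0 mulr0 ltxx.
have [e e2 ep] : exists2 e : int, e ^+ 2 = 1 & 0 < e * p.
  have [p1|p1] := ltP 0 p; first by exists 1; rewrite ?mul1r.
  by exists (-1) => //; rewrite mulN1r oppr_gt0 lt_neqAle p0.
have [|m [n [i [j [d1 f1 f2 f3]]]]] := @int_binary_form R (e * p) (e * q) (e * r) ep.
  by rewrite -D -[RHS]mul1r -e2; ring.
have ee (u v : int) : e * u = v -> u = e * v.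
  by move=> <-; rewrite mulrA -expr2 e2 mul1r.
have T1 : p * m * m + 2 * q * m * n + r * n * n = e.
  by rewrite -[RHS]mulr1; apply: ee; rewrite -[RHS]f1; ring.
have T2 : p * m * i + q * (m * j + n * i) + r * n * j = 0.
  by rewrite -[RHS](mulr0 e); apply: ee; rewrite -[RHS]f2; ring.
have T3 : p * i * i + 2 * q * i * j + r * j * j = e.
  by rewrite -[RHS]mulr1; apply: ee; rewrite -[RHS]f3; ring.
have e1 : e = 1 \/ e = -1 by have /eqP := e2; rewrite sqrf_eq1 => /orP[]/eqP; [left|right].
(* The projected form at (u, v) is congruent to (x u + y v)^2 modulo 2. At value 1 or -1 the inner
   product x u + y v with the axis is therefore odd, and adding multiples of the axis, of norm 2,
   makes it 1. *)
have odd_shift (u v : int) : p * u * u + 2 * q * u * v + r * v * v = e ->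
    exists t, x * u + y * v + 2 * t = 1.
  move=> T; have : exists z, e = 2 * z - (x * u + y * v) ^+ 2.
    by exists (be * u * u + (ga + ga') * u * v + de * v * v); rewrite -[LHS]T /p /q /r; ring.
  case=> z; move: (x * u + y * v) => c cE.
  have [h [ch|ch]] : exists h : int, c = 2 * h \/ c = 2 * h + 1.
      by move: (c); clear => c; exists (c %/ 2)%Z; lia.
    have : e = 2 * (z - 2 * h ^+ 2) by rewrite cE ch; ring.
    by move: (z - _) => w; case: e1 => ->; clear; lia.
  by exists (- h); rewrite ch; ring.
have [t1 x1] := odd_shift _ _ T1; have [t2 y1] := odd_shift _ _ T3.
have ke : 2 * k * e%:~R = Num.sqrt 2.
  have : (2 * k * e%:~R) ^+ 2 = 2.
    by rewrite exprMn -rmorphXn/= e2 mulr1; lra.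
  have ke0 : 0 < 2 * k * e%:~R.
    have : 0 < 2 * k * p%:~R by rewrite -pE.
    have : 0 < (e * p)%:~R :> R by rewrite ltr0z.
    rewrite rmorphM/=.
    case: e1 => ->; rewrite ?rmorphN ?rmorph1; move: (p%:~R) => p'; nra.
  by move=> s2; rewrite -[in RHS]s2 sqrtr_sqr gtr0_norm.
have uP : mx3 1 0 0 t1 m n t2 i j \in unitmx.
  by apply: unitmx_det3; rewrite det_mx3 -[RHS]d1; ring.
apply: (dominates_mcc_congr uP); rewrite zmx_mx3 congr_mx3 ?uG.1.1//.
rewrite (_ : sym3 _ _ _ _ _ _ = sym3 2 1 1 (1 / 2 + Num.sqrt 2 / 2) (1 / 2) (1 / 2 + Num.sqrt 2 / 2)).
  exact: dominates_mcc_mcc.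
clearbody p q r.
have toR (u v : int) : u = v -> u%:~R = v%:~R :> R by move=> ->.
move: (toR _ _ x1) (toR _ _ y1) (toR _ _ T1) (toR _ _ T2) (toR _ _ T3).
rewrite !(rmorphD, rmorphM, rmorph1, rmorph0) /= => X1 Y1 S1 S2 S3.
have g11E : g11 = (x%:~R ^+ 2 + 2 * k * p%:~R) / 2 by rewrite -pE; field.
have g12E : g12 = (x%:~R * y%:~R + 2 * k * q%:~R) / 2 by rewrite -qE; field.
have g22E : g22 = (y%:~R ^+ 2 + 2 * k * r%:~R) / 2 by rewrite -rE; field.
rewrite -ke !bilin3_sym3 g11E g12E g22E.
move: (t1%:~R) (t2%:~R) (x%:~R) (y%:~R) (m%:~R) (n%:~R) (i%:~R) (j%:~R) (p%:~R) (q%:~R) (r%:~R)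
  (e%:~R) X1 Y1 S1 S2 S3 => T1' T2' X Y M N I J P Q S E X1 Y1 S1 S2 S3.
congr sym3.
- ring.
- by apply: etrans X1; ring.
- by apply: etrans Y1; ring.
- transitivity ((X * M + Y * N + (1 + 1) * T1') ^+ 2 / 2
    + 2 * k * (P * M * M + (1 + 1) * Q * M * N + S * N * N) / 2); first by field.
  by rewrite X1 S1; field.
- transitivity ((X * M + Y * N + (1 + 1) * T1') * (X * I + Y * J + (1 + 1) * T2') / 2
    + k * (P * M * I + Q * (M * J + N * I) + S * N * J)); first by field.
  by rewrite X1 Y1 S2; field.
- transitivity ((X * I + Y * J + (1 + 1) * T2') ^+ 2 / 2
    + 2 * k * (P * I * I + (1 + 1) * Q * I * J + S * J * J) / 2); first by field.
  by rewrite Y1 S3; field.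
Qed.

End SkewGood.

(** * Reduction along the axis of the isoduality *)

Section Isodual.
Variable R : realType.

Definition skew_axis (K : pzRingType) (U : 'M[K]_3) : 'rV[K]_3 :=
  rv3 (U 1 2%:R - U 2%:R 1) (U 2%:R 0 - U 0 2%:R) (U 0 1 - U 1 0).

Lemma rv3P (K : Type) (u v : 'rV[K]_3) :
  u 0 0 = v 0 0 -> u 0 1 = v 0 1 -> u 0 2%:R = v 0 2%:R -> u = v.
Proof.
move=> h0 h1 h2; apply/rowP => -[[|[|[|//]]] h].
- by have -> : Ordinal h = 0 by exact/val_inj.
- by have -> : Ordinal h = 1 by exact/val_inj.
by have -> : Ordinal h = 2%:R by exact/val_inj.
Qed.

(** Skew forms transform like cross products, through the cofactors. If the axis is d times the
    first row of P, the new axis is (d det P, 0, 0). *)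
Lemma skew_axis_congr (K : comPzRingType) (P U : 'M[K]_3) :
  skew_axis (congr_mx P U) = skew_axis U *m adj3 P.
Proof. by rewrite /congr_mx; apply: rv3P; rewrite !(mxE, sum3E) /=; ring. Qed.

(* The rotation S = U G^-1 satisfies S U S^T = U, hence it fixes the axis of the
   skew part of U. *)
Lemma skew_axis_fixed (G : 'M[R]_3) (U : 'M[int]_3) : isodual_form G U ->
  skew_axis (zmx R U) *m G = skew_axis (zmx R U) *m zmx R U.
Proof.
move=> [[[sG _] dG] dU]; set V := zmx R U => GU.
have aGG : adj3 G *m G = 1%:M by rewrite adj3_mul_mx dG.
pose S := V *m adj3 G.
have SG : S *m G = V by rewrite /S -mulmxA aGG mulmx1.
have dS : \det S = 1.
  have : \det (S *m G) = 1 by rewrite SG det_map_mx dU rmorph1.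
  by rewrite det_mulmx dG mulr1.
have VS : V *m S^T = G by rewrite /S trmx_mul adj3_tr sG mulmxA.
have kS : skew_axis V *m adj3 S = skew_axis V.
  by rewrite -skew_axis_congr /congr_mx -mulmxA VS SG.
have kS1 : skew_axis V *m S = skew_axis V.
  by rewrite -[in LHS]kS -mulmxA adj3_mul_mx dS mulmx1.
by rewrite -[in LHS]kS1 -mulmxA SG.
Qed.

(** With d = ga - ga' nonzero, al d^2 <= 4 leaves al = 1, where a unit vector splits off, or d^2 = 1
    and al = 2, 3, 4. For al = 4 the cosine is 0; then x and y are even, so ga + ga' is even,
    against ga - ga' being odd. *)
Lemma isodual_axis_dominates_mcc (al x y be ga ga' de : int) (g11 g12 g22 : R) :
  let G := sym3 al%:~R x%:~R y%:~R g11 g12 g22 in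
  isodual_form G (mx3 al x y x be ga y ga' de) -> ga != ga' -> dominates_mcc G.
Proof.
move=> G GU dn0; have [uG dU _] := GU.
have [k [al0 kd h1 h2 h3]] := skew_block GU.
set d := ga - ga' in kd.
have d0 : d != 0 by rewrite subr_eq0.
have d2 : 1 <= d ^+ 2 by nia.
have : al * d ^+ 2 <= 4.
  rewrite -(ler_int R) rmorphM/= rmorphXn/=; have := sqr_ge0 k; lra.
have [al1|al1] := eqVneq al 1.
  move=> _; apply: (dominates_mcc_unit_corner (x := x) (y := y) uG); rewrite mxE //= al1.
  by [].
move=> ald; have d1 : d ^+ 2 = 1.
  move: (d) d2 ald al0 al1; clear => d d2 ald al0 al1.
  have le2 : d ^+ 2 <= 2 by nia.
  have [h|[->//|[h|[->//|h]]]] : d <= -2 \/ d = -1 \/ d = 0 \/ d = 1 \/ 2 <= d by lia.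
  - nia.
  - by move: d2; rewrite h.
  - nia.
have dR : d%:~R ^+ 2 = 1 :> R by rewrite -rmorphXn/= d1.
have [al2|[al3|al4]] : al = 2 \/ al = 3 \/ al = 4 by move: ald; rewrite d1; lia.
- move: uG dU h1 h2 h3 kd; rewrite /G al2 -[2%:~R]/(2%:R) => uG dU h1 h2 h3 kd.
  by apply: (dominates_mcc_corner2 uG dU _ _ h1 h2 h3); [by [] | move: kd; rewrite dR; lra].
- move: uG dU h1 h2 h3 kd; rewrite /G al3 -[3%:~R]/(3%:R) => uG dU h1 h2 h3 kd.
  by apply: (dominates_mcc_corner3 uG dU _ _ h1 h2 h3); [by [] | move: kd; rewrite dR; lra].
have k00 : k = 0.
  by apply/eqP; rewrite -sqrf_eq0; apply/eqP; move: kd; rewrite dR al4; lra.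
move: h1 h2 h3; rewrite al4 k00 mulr0 !mul0r => h1 h2 h3.
have {}h1 : 4 * be - x ^+ 2 = 0 by apply/eqP; rewrite -(intr_eq0 R) h1.
have {}h2 : 4 * (ga + ga') - 2 * x * y = 0 by apply/eqP; rewrite -(intr_eq0 R) h2.
have {}h3 : 4 * de - y ^+ 2 = 0 by apply/eqP; rewrite -(intr_eq0 R) h3.
exfalso; move: h1 h2 h3 d1; rewrite /d; clear => h1 h2 h3 d1.
have even (u v : int) : 4 * v - u ^+ 2 = 0 -> exists w, u = 2 * w.
  move=> uv; have [w [uE|uE]] : exists w, u = 2 * w \/ u = 2 * w + 1.
      by exists (u %/ 2)%Z; clear; lia.
    by exists w.
  by move: uv; rewrite uE (_ : _ - _ = 4 * (v - w ^+ 2 - w) - 1); [move: (v - _ - _) | ]; lia.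
have [x' xE] := even _ _ h1; have [y' yE] := even _ _ h3.
move: h2; rewrite xE yE (_ : 2 * (2 * x') * (2 * y') = 8 * (x' * y')); last by ring.
move: (x' * y') => z h2.
have : ga - ga' = 1 \/ ga - ga' = -1.
  by move/eqP: d1; rewrite sqrf_eq1 => /orP[]/eqP ->; [left | right].
by move: h2; clear; lia.
Qed.

Lemma isodual_dominates_mcc (G : 'M[R]_3) (U : 'M[int]_3) : isodual_form G U -> dominates_mcc G.
Proof.
move=> GU; have [P uP [d kE]] := int_row_basis (skew_axis U).
apply: (dominates_mcc_congr uP); have := isodual_form_congr uP GU.
have : skew_axis (congr_mx P U) = rv3 (d * \det P) 0 0.
  rewrite skew_axis_congr kE -scalemxAl -row_mul mul_mx_adj3.
  by apply: rv3P; rewrite !mxE //= ?mulr1n ?mulr0n ?mulr0.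
move: (congr_mx P U) (congr_mx _ G) (d * _) => {kE uP P d GU}U {}G d kE GU.
have [k0 k1 k2] : [/\ U 1 2%:R - U 2%:R 1 = d, U 2%:R 0 = U 0 2%:R & U 0 1 = U 1 0].
  split; [have /rowP/(_ 0) := kE | have /rowP/(_ 1) := kE | have /rowP/(_ 2%:R) := kE].
  - by rewrite !mxE.
  - by rewrite !mxE /= => h; apply: subr0_eq.
  - by rewrite !mxE /= => h; apply: subr0_eq.
have [d0|d0] := eqVneq d 0.
  apply: (isodual_symmetric GU); apply: mx3P; rewrite !mxE //.
  - by apply/esym/subr0_eq; rewrite k0.
  - by apply/subr0_eq; rewrite k0.
(* The axis is now a multiple of the first basis vector, and it is fixed by the rotation, so G and U
   have the same first row, which is therefore integral. *)
have GUr i : G 0 i = (U 0 i)%:~R.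
  have := congr1 (fun A : 'rV[R]_3 => A 0 i) (skew_axis_fixed GU).
  have -> : skew_axis (zmx R U) = rv3 d%:~R 0 0.
    by apply: rv3P; rewrite !mxE /= -?rmorphB ?k0 ?k1 ?k2 ?subrr.
  rewrite !mxE !sum3E !mxE /= !mul0r !addr0; apply: mulfI.
  by rewrite intr_eq0.
have GE : G = sym3 (U 0 0)%:~R (U 0 1)%:~R (U 0 2%:R)%:~R (G 1 1) (G 1 2%:R) (G 2%:R 2%:R).
  by rewrite -!GUr -sym3E//; case: GU => -[[]].
have UE : U = mx3 (U 0 0) (U 0 1) (U 0 2%:R) (U 0 1) (U 1 1) (U 1 2%:R) (U 0 2%:R) (U 2%:R 1) (U 2%:R 2%:R).
  by apply: mx3P; rewrite !mxE.
rewrite GE; apply: (isodual_axis_dominates_mcc (be := U 1 1) (ga := U 1 2%:R) (ga' := U 2%:R 1)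
  (de := U 2%:R 2%:R)); first by rewrite -UE -GE.
by rewrite -subr_eq0 k0.
Qed.

End Isodual.

(** * Lattices *)

Section Lattices.
Variable R : realType.

Lemma zspan_zmx n (B : 'M[R]_n) : zspan B = [set zmx R z *m B | z in setT].
Proof.
apply/seteqP; split => [x [z ->]|x [z _ <-]].
  exists (\row_i z i) => //; rewrite mulmx_sum_row; apply: eq_bigr => i _.
  by rewrite !mxE scaler_int.
exists (z 0); rewrite mulmx_sum_row; apply: eq_bigr => i _.
by rewrite !mxE scaler_int.
Qed.

Lemma zspan_unimodular n (P : 'M[int]_n) (B : 'M[R]_n) : P \in unitmx ->
  zspan (zmx R P *m B) = zspan B.
Proof.
move=> uP; rewrite !zspan_zmx; apply/seteqP; split => _ [z _ <-].
  by exists (z *m P) => //; rewrite zmxM mulmxA.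
by exists (z *m invmx P) => //; rewrite mulmxA -zmxM mulmxKV.
Qed.

Lemma zspan_eqP n (B C : 'M[R]_n) : B \in unitmx -> zspan B = zspan C ->
  exists2 P : 'M[int]_n, P \in unitmx & B = zmx R P *m C.
Proof.
move=> uB BC.
have sub (D E : 'M[R]_n) : zspan D `<=` zspan E -> exists P, D = zmx R P *m E.
  move=> DE; have rows i : exists z : 'rV[int]_n, row i D = zmx R z *m E.
    have : zspan E (row i D).
      apply: DE; rewrite zspan_zmx; exists (delta_mx 0 i) => //.
      by rewrite /zmx map_delta_mx -rowE.
    by rewrite zspan_zmx => -[z _ <-]; exists z.
  have [f fE] := choice rows; exists (\matrix_i f i); apply/row_matrixP => i.
  by rewrite fE row_mul /zmx -map_row rowK.
have [P PE] := sub B C ltac:(by rewrite BC); have [Q QE] := sub C B ltac:(by rewrite BC).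
exists P => //; suff /mulmx1_unit[] : P *m Q = 1%:M by [].
apply: (@zmx_inj R); have PQB : zmx R P *m zmx R Q *m B = B by rewrite -mulmxA -QE -PE.
by rewrite zmxM -[LHS](mulmxK uB) PQB mulmxV// /zmx map_mx1.
Qed.

Lemma dotv_mulmx n (x y : 'rV[R]_n) : dotv x y = (x *m y^T) 0 0.
Proof. by rewrite dotvE /bform mulmx1. Qed.

Lemma dual_zspan n (B : 'M[R]_n) : B \in unitmx -> dual (zspan B) = zspan (invmx B)^T.
Proof.
move=> uB; have uBT : B^T \in unitmx by rewrite unitmx_tr.
rewrite trmx_inv; apply/seteqP; split => x; rewrite !zspan_zmx => dx; last first.
  move: dx => [z _ <-] y [t _ <-]; rewrite dotv_mulmx trmx_mul mulmxA mulmxKV//.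
  by rewrite /zmx map_trmx -map_mxM mxE intr_int.
have xint i : exists m : int, (x *m B^T) 0 i = m%:~R.
  have : dotv x (row i B) \is a Num.int.
    by apply: dx; exists (delta_mx 0 i) => //; rewrite /zmx map_delta_mx -rowE.
  rewrite dotv_mulmx => /intrP[m mE]; exists m; rewrite -mE !mxE.
  by apply: eq_bigr => j _; rewrite !mxE.
have [f fE] := choice xint; exists (\row_i f i) => //.
rewrite -[RHS](mulmxK uBT); congr (_ *m _).
by apply/rowP => i; rewrite fE !mxE.
Qed.

Lemma image_zspan n (B S : 'M[R]_n) (c : R) :
  [set c *: (x *m S) | x in zspan B] = zspan (c *: (B *m S)).
Proof.
rewrite !zspan_zmx; apply/seteqP; split => [_ [_ [z _ <-] <-]|_ [z _ <-]].
  by exists z => //; rewrite -scalemxAr mulmxA.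
by exists (zmx R z *m B); [exists z | rewrite -scalemxAr mulmxA].
Qed.

Lemma orthogonal_det n (S : 'M[R]_n) : S *m S^T = 1%:M -> \det S ^+ 2 = 1.
Proof. by move=> /(congr1 determinant); rewrite det_mulmx det_tr det1 expr2. Qed.

Lemma posdef_gram n (B : 'M[R]_n) : B \in unitmx -> posdef (gram B).
Proof.
move=> uB; rewrite gramE; split; first by rewrite trmx_mul trmxK.
move=> x x0; have -> : bform (B *m B^T) x x = dotv (x *m B) (x *m B).
  by rewrite dotvE bform_mull bform_mulr mulmx1.
rewrite lt_neqAle dotv_ge0 andbT eq_sym; apply: contra_neq x0 => /dotv_eq0 xB.
by rewrite -(mulmxK uB x) xB mul0mx.
Qed.

Lemma posdefZ n (G : 'M[R]_n) (c : R) : 0 < c -> posdef G -> posdef (c *: G).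
Proof.
move=> c0 [sG pG]; split; first by rewrite linearZ/= sG.
move=> x /pG h; rewrite /bform -scalemxAr -scalemxAl mxE.
by rewrite mulr_gt0.
Qed.

(** The bases c B S and B^-T of the dual differ by a unimodular U, so U = c B S B^T, and
    orthogonality of S becomes the equation for G = c B B^T. Then det G = |det U| = 1; the sign of U
    is free and is used to get determinant 1. *)
Lemma isodual_lattice_form (B : 'M[R]_3) : B \in unitmx -> isodual_lattice (zspan B) ->
  exists (c : R) (U : 'M[int]_3), 0 < c /\ isodual_form (c *: gram B) U.
Proof.
move=> uB [_ [c [S [c0 SS]]]]; rewrite dual_zspan// image_zspan => dE.
have uBT : B^T \in unitmx by rewrite unitmx_tr.
have uS : S \in unitmx by case/mulmx1_unit: SS.
have c0' : c != 0 by rewrite gt_eqF.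
have uC : c *: (B *m S) \in unitmx by rewrite unitmxZ ?unitfE// unitmx_mul uB.
have [U uU UE] := zspan_eqP uC (esym dE).
have UR : zmx R U = c *: (B *m S *m B^T).
  by rewrite -[LHS](mulmxKV uBT) -trmx_inv -UE -scalemxAl.
exists c; pose G := c *: gram B.
have dG : \det G = 1.
  have g0 : 0 < \det G.
    rewrite detZ gramE det_mulmx det_tr -expr2; apply: mulr_gt0; first exact: exprn_gt0.
    by rewrite exprn_even_gt0//= -unitfE -unitmxE.
  have : \det G ^+ 2 = 1.
    have : (\det (zmx R U)) ^+ 2 = 1 by rewrite det_map_mx -rmorphXn/= unitmx_sqr_det.
    rewrite UR detZ !det_mulmx => <-; rewrite detZ gramE det_mulmx.
    by rewrite !exprMn (orthogonal_det SS) mulr1.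
  by move=> /eqP; rewrite sqrf_eq1 => /orP[/eqP//|/eqP h]; move: g0; rewrite h; lra.
have uG : unimodular_form G by split => //; apply: posdefZ => //; exact: posdef_gram.
have GU : zmx R U *m adj3 G *m (zmx R U)^T = G.
  have aG : adj3 G = c^-1 *: (invmx B^T *m invmx B).
    have GX : G *m (c^-1 *: (invmx B^T *m invmx B)) = 1%:M.
      by rewrite -scalemxAr /G -scalemxAl scalerA mulVf// scale1r gramE mulmxA mulmxK ?mulmxV.
    by rewrite -[LHS]mulmx1 -GX mulmxA adj3_mul_mx dG mul1mx.
  rewrite aG UR [X in _ *m X]linearZ /= !trmx_mul trmxK -!scalemxAl -!scalemxAr -!scalemxAl !scalerA.
  rewrite !mulmxA (mulmxK uBT) (mulmxKV uB) -(mulmxA B) SS mulmx1 -gramE.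
  by congr (_ *: _); field.
have : \det U = 1 \/ \det U = -1.
  by have /eqP := unitmx_sqr_det uU; rewrite sqrf_eq1 => /orP[]/eqP; [left|right].
case=> dU; first by exists U.
exists (- U); split => //; split => //.
  by rewrite -scaleN1r detZ dU.
by rewrite /zmx map_mxN linearN/= !mulNmx mulmxN opprK.
Qed.

End Lattices.

(** * Scaling, and the comparison with M_3 *)

Section Optimality.
Variable R : realType.

Lemma conorm_gramZ (a : R) (p : nat -> R) :
  conorm_gram (fun e => a * p e) = a *: conorm_gram p.
Proof. by rewrite !conorm_gramE; apply: mx3P; rewrite !mxE /=; ring. Qed.

Lemma tree_polyZ (a : R) (p : nat -> R) : tree_poly (fun e => a * p e) = a ^+ 3 * tree_poly p.
Proof. by rewrite !tree_polyE6; ring. Qed.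

Lemma moment_polyZ (a : R) (p : nat -> R) :
  moment_poly (fun e => a * p e) = a ^+ 4 * moment_poly p.
Proof. by rewrite /moment_poly tree_polyZ; ring. Qed.

Lemma quantization_error_ge_mcc (B : 'M[R]_3) (c : R) : B \in unitmx -> 0 < c ->
  dominates_mcc (c *: gram B) -> mcc_moment R / 36 <= quantization_error (zspan B).
Proof.
move=> uB c0 [P uP [p [p0 GE tp mp]]]; rewrite -(zspan_unimodular B uP).
have uPB : zmx R P *m B \in unitmx by rewrite unitmx_mul zmx_unit.
have gPB : gram (zmx R P *m B) = conorm_gram (fun e => c^-1 * p e).
  rewrite conorm_gramZ -GE !gramE /congr_mx trmx_mul -scalemxAr -scalemxAl scalerA.
  by rewrite mulVf ?gt_eqF// scale1r !mulmxA.
have q0 e : 0 <= c^-1 * p e by rewrite mulr_ge0// invr_ge0 ltW.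
rewrite (quantization_error_conorm q0 uPB gPB) moment_polyZ tree_polyZ tp mulr1.
have a0 : 0 < c^-1 by rewrite invr_gt0.
rewrite -[_ ^+ 3]powR_mulrn ?(ltW a0)// -powRrM.
(* Scale invariance: degree 3 to the power - 4/3 cancels the degree 4 of the moment. *)
rewrite (_ : 3%:R * - (4 / 3) = - 4%:R); last by field.
rewrite powRN powR_mulrn ?(ltW a0)//.
rewrite (_ : _ / 36 / _ = moment_poly p / 36); last by field; rewrite ?gt_eqF.
by rewrite ler_pM2r.
Qed.

Lemma mcc_gramE : mcc_gram R = conorm_gram (mcc_conorm R).
Proof. by rewrite conorm_gramE; apply: mx3P; rewrite !mxE /mcc_conorm /=; field. Qed.

Lemma quantization_error_mcc (B : 'M[R]_3) : B \in unitmx -> gram B = mcc_gram R ->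
  quantization_error (zspan B) = mcc_moment R / 36.
Proof.
move=> uB; rewrite mcc_gramE => /(quantization_error_conorm (@mcc_conorm_ge0 R) uB) ->.
by rewrite tree_poly_mcc powR1 mulr1 moment_poly_mcc.
Qed.

(** The witness [U] is integral and symmetric of determinant 1 with U G^-1 U^T = G. This equation is
    the orthogonality of B^-1 U B^-T, which maps the lattice onto its dual with c = 1. *)
Lemma mcc_isodual (B : 'M[R]_3) : B \in unitmx -> gram B = mcc_gram R ->
  isodual_lattice (zspan B).
Proof.
move=> uB gB; split; first by exists B.
have uBT : B^T \in unitmx by rewrite unitmx_tr.
pose U : 'M[int]_3 := mx3 0 1 0 1 (-1) 0 0 0 (-1).
have uU : U \in unitmx by apply: unitmx_det3; rewrite det_mx3.
have GU : zmx R U *m adj3 (mcc_gram R) *m (zmx R U)^T = mcc_gram R.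
  pose r : R := Num.sqrt 2.
  have r2 : r ^+ 2 = 2 by exact: sqrt2E.
  have mE : mcc_gram R = sym3 ((1 + r) / 2) (- (1 / 2)) (- (1 / 2)) ((1 + r) / 2)
      ((1 - r) / 2) ((1 + r) / 2).
    by apply: mx3P; rewrite !mxE /= -/r; field.
  have aE : adj3 (mcc_gram R) = sym3 r (r / 2) (r / 2) ((1 + r) / 2) (1 / 2) ((1 + r) / 2).
    by rewrite mE; apply: mx3P; rewrite !mxE /=; move: r r2 {mE} => r r2; lra.
  rewrite -/(congr_mx _ _) aE zmx_mx3 congr_mx3 ?tr_sym3// mE !bilin3_sym3.
  by clear; congr sym3; field.
have aG : adj3 (mcc_gram R) = invmx B^T *m invmx B.
  have GX : mcc_gram R *m (invmx B^T *m invmx B) = 1%:M.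
    by rewrite -gB gramE mulmxA mulmxK ?mulmxV.
  rewrite -[LHS]mulmx1 -GX mulmxA adj3_mul_mx mcc_gramE det_conorm_gram.
  by rewrite tree_poly_mcc mul1mx.
exists 1, (invmx B *m zmx R U *m invmx B^T); split => //.
  rewrite !trmx_mul !trmx_inv trmxK.
  transitivity (invmx B *m (zmx R U *m (invmx B^T *m invmx B) *m (zmx R U)^T) *m invmx B^T).
    by rewrite !mulmxA.
  by rewrite -aG GU -gB gramE mulmxA mulVmx// mul1mx mulmxV.
rewrite dual_zspan// image_zspan scale1r !mulmxA mulmxV// mul1mx.
by rewrite zspan_unimodular// trmx_inv.
Qed.

End Optimality.

Theorem theorem1 (R : realType) (M3 : set 'rV[R]_3) (hM3 : is_mcc M3) :
  optimal_quantizer_in (@isodual_lattice R 3) M3.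
Proof.
move: hM3 => [B [uB gB ->]]; split; first exact: mcc_isodual.
move=> _ [[C [uC ->]] iso]; rewrite (quantization_error_mcc uB gB).
have isoC : isodual_lattice (zspan C) by split; [exists C | exact: iso].
have [c [U [c0 /isodual_dominates_mcc gC]]] := isodual_lattice_form uC isoC.
exact: quantization_error_ge_mcc uC c0 gC.
Qed.
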